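(* Let $f\in H_{k,\chi,\rho}$ and let $n_0\in\mathbb{N}$ be such that $f_j(\tau)=O(e^{2\pi n_0v})$ as $v=\mathrm{Im}(\tau)\to\infty$ for each $1\le j\le m$. Let $\varphi$ be a non-zero piecewise smooth complex-valued function such that, for some $\epsilon>0$, both $\varphi(x)$ and $\varphi(x^{-1})$ are $o(e^{-2\pi(n_0+\epsilon)x})$ as $x\to\infty$. Then the series $L(s,f,\varphi):=L_f(\varphi_s)$, with $\varphi_s(x):=\varphi(x)x^{s-1}$, converges absolutely for $\mathrm{Re}(s)>\frac12$, has an analytic continuation to all $s\in\mathbb{C}$, and satisfies \[L(s,f,\varphi)=i^k\rho(S)\,L(1-s,f,\varphi|_{1-k,\chi^{-1}}S),\] where $(\varphi|_{1-k,\chi^{-1}}S)(x):=x^{k-1}\chi(S)\varphi(1/x)$.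
   Context: Let $\Gamma=\mathrm{SL}_2(\mathbb{Z})$, $S=\left(\begin{smallmatrix}0&-1\\1&0\end{smallmatrix}\right)$, $k\in\frac12\mathbb{Z}$, $\chi$ a unitary multiplier system of weight $k$ on $\Gamma$, $\rho:\Gamma\to\mathrm{GL}(m,\mathbb{C})$ a unitary representation, $\mathbf{e}_j$ the standard basis of $\mathbb{C}^m$, $(f|_{k,\chi,\rho}\gamma)(\tau):=(c\tau+d)^{-k}\chi(\gamma)^{-1}\rho(\gamma)^{-1}f(\gamma\tau)$, $\kappa_1,\dots,\kappa_m\in[0,1)$ fixed. With $\tau=u+iv$, $H_{k,\chi,\rho}$ is the space of real-analytic $f=\sum_jf_j\mathbf{e}_j:\mathbb{H}\to\mathbb{C}^m$ with $f|_{k,\chi,\rho}\gamma=f$ for all $\gamma\in\Gamma$, $\Delta_kf=0$ where $\Delta_k=-4v^2\partial_\tau\partial_{\bar\tau}+2kiv\partial_{\bar\tau}$, and with Fourier expansion $f(\tau)=\sum_j\sum_{n\gg-\infty}c^+_{f,j}(n)e^{2\pi i(n+\kappa_j)\tau}\mathbf{e}_j+\sum_j\sum_{n+\kappa_j<0}c^-_{f,j}(n)\Gamma(1-k,-4\pi(n+\kappa_j)v)e^{2\pi i(n+\kappa_j)\tau}\mathbf{e}_j$ ($\Gamma(a,w)$ the incomplete gamma function). $\mathcal{L}$ is the Laplace transform. $\mathcal{F}_f$ is the space of piecewise smooth $\varphi$ with: $(\mathcal{L}\varphi)(s)$ absolutely convergent for $\mathrm{Re}(s)\ge-2\pi n_0$;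 $(\mathcal{L}\varphi_{2-k})(s)$ absolutely convergent for $\mathrm{Re}(s)>0$; and for each $j$ convergence of $\sum_n|c^+_{f,j}(n)|(\mathcal{L}|\varphi|)(2\pi(n+\kappa_j))+\sum_{n+\kappa_j<0}|c^-_{f,j}(n)|(4\pi|n+\kappa_j|)^{1-k}\int_0^\infty\frac{(\mathcal{L}|\varphi_{2-k}|)(-2\pi(n+\kappa_j)(2t+1))}{(1+t)^k}dt$. For $\varphi\in\mathcal{F}_f$, $L_f(\varphi):=\sum_j\sum_nc^+_{f,j}(n)(\mathcal{L}\varphi)(2\pi(n+\kappa_j))\mathbf{e}_j+\sum_j\sum_{n+\kappa_j<0}c^-_{f,j}(n)(-4\pi(n+\kappa_j))^{1-k}\int_0^\infty\frac{(\mathcal{L}\varphi_{2-k})(-2\pi(n+\kappa_j)(2t+1))}{(1+t)^k}dt\,\mathbf{e}_j$. ''Converges absolutely'' for $L(s,f,\varphi)$ means $\varphi_s\in\mathcal{F}_f$. *)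

(* Defs.v *)
From HB Require Import structures.
From mathcomp Require Import all_boot all_order all_algebra.
From mathcomp Require Import all_classical all_reals all_analysis.
From mathcomp Require Import spectral complex.

Set Implicit Arguments.
Unset Strict Implicit.
Unset Printing Implicit Defensive.

Import Order.TTheory GRing.Theory Num.Theory.
Import numFieldNormedType.Exports.

Local Open Scope classical_set_scope.
Local Open Scope ring_scope.
Local Open Scope complex_scope.

Local Notation Re := complex.Re.
Local Notation Im := complex.Im.

Section ComplexFunctions.
Context {R : realType}.
Local Notation C := R[i].
Local Notation mu := (@lebesgue_measure R).

(* The R-valued modulus; `|z| would be R[i]-valued. *)
Definition cnorm (z : C) : R := ComplexField.Normc.normc z.

Definition cexp (z : C) : C :=
  (expR (Re z) * cos (Im z)) +i* (expR (Re z) * sin (Im z)).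

(* Principal branch: carg z lies in ]-pi, pi] for z != 0. *)
Definition carg (z : C) : R :=
  if 0 <= Im z then acos (Re z / cnorm z) else - acos (Re z / cnorm z).

Definition clog (z : C) : C := ln (cnorm z) +i* carg z.

Definition cpow (z w : C) : C := cexp (w * clog z).

Definition cderive1 (g : R -> C) (x : R) : C :=
  derive1 (fun t => Re (g t)) x +i* derive1 (fun t => Im (g t)) x.

(* Absolute convergence of the Lebesgue integral of a complex-valued g. *)
Definition cintegrable (D : set R) (g : R -> C) : Prop :=
  mu.-integrable D (fun x => (Re (g x))%:E) /\
  mu.-integrable D (fun x => (Im (g x))%:E).

Definition cintegral (D : set R) (g : R -> C) : C :=
  (\int[mu]_(x in D) Re (g x)) +i* (\int[mu]_(x in D) Im (g x)).

(* Unconditional sums: csum D a is the sum of the family a over D whenever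
   csummable D a; esum itself only handles nonnegative families. *)
Definition csummable (I : choiceType) (D : set I) (a : I -> C) : Prop :=
  (\esum_(n in D) (cnorm (a n))%:E < +oo)%E.

Definition rsum (I : choiceType) (D : set I) (a : I -> R) : R :=
  fine (\esum_(n in D) (Num.max (a n) 0)%:E)
  - fine (\esum_(n in D) (Num.max (- a n) 0)%:E).

Definition csum (I : choiceType) (D : set I) (a : I -> C) : C :=
  rsum D (fun n => Re (a n)) +i* rsum D (fun n => Im (a n)).

Definition entire (g : C -> C) : Prop :=
  forall s : C, derivable (g : C^o -> C^o) s 1.

Definition smooth_on (a b : R) (g : R -> C) : Prop :=
  forall (n : nat) (x : R), a < x < b ->
    derivable (derive1n n (fun t => Re (g t))) x 1 /\
    derivable (derive1n n (fun t => Im (g t))) x 1.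

(* Piecewise smoothness on ]0, +oo[: the set E of break points is finite on
   compact subintervals of ]0, +oo[, and between break points phi is the
   restriction of a function that is smooth on a neighbourhood of the closed
   interval.  Values at the break points are unconstrained. *)
Definition piecewise_smooth (phi : R -> C) : Prop :=
  exists E : set R,
    (forall a b : R, 0 < a -> finite_set (E `&` `[a, b])) /\
    (forall p q : R, 0 < p -> p < q -> E `&` `]p, q[ = set0 ->
       exists (g : R -> C) (c d : R),
         [/\ c < p, q < d, smooth_on c d g &
             forall x, p < x < q -> phi x = g x]).

Definition real_analytic (g : C -> C) : Prop :=
  forall tau : C, 0 < Im tau ->
    exists (r : R) (a : nat * nat -> C), 0 < r /\
      forall x y : R, `|x| < r -> `|y| < r ->
        let t := fun pq => a pq * (x ^+ pq.1 * y ^+ pq.2)%:C in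
        csummable setT t /\ g (tau + (x +i* y)) = csum setT t.

Definition little_o_pinfty (g : R -> C) (h : R -> R) : Prop :=
  forall c : R, 0 < c -> \forall x \near +oo, cnorm (g x) <= c * h x.

Definition inc_gamma (a w : R) : R :=
  \int[mu]_(t in `[w, +oo[) (powR t (a - 1) * expR (- t)).

Definition laplace_term (phi : R -> C) (s : C) (x : R) : C :=
  phi x * cexp (- s * x%:C).

Definition laplace (phi : R -> C) (s : C) : C :=
  cintegral `]0, +oo[ (laplace_term phi s).

Definition laplace_abs (phi : R -> C) (s : R) : \bar R :=
  (\int[mu]_(x in `]0%R, +oo[) (cnorm (phi x) * expR (- s * x))%:E)%E.

Definition twist (phi : R -> C) (s : C) (x : R) : C :=
  phi x * cpow x%:C (s - 1).

End ComplexFunctions.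

Definition SL2Z (g : 'M[int]_2) : Prop := \det g = 1.

Definition Smx : 'M[int]_2 :=
  \matrix_(i, j) (nth [::] [:: [:: 0; -1]; [:: 1; 0]] i)`_j.

Section MaassForms.
Context {R : realType}.
Local Notation C := R[i].
Local Notation mu := (@lebesgue_measure R).

Definition mobius (g : 'M[int]_2) (tau : C) : C :=
  ((g 0 0)%:~R * tau + (g 0 1)%:~R) / ((g 1 0)%:~R * tau + (g 1 1)%:~R).

Definition autj (g : 'M[int]_2) (tau : C) : C :=
  (g 1 0)%:~R * tau + (g 1 1)%:~R.

Definition unitary_multiplier_system (k : R) (chi : 'M[int]_2 -> C) : Prop :=
  (forall g, SL2Z g -> cnorm (chi g) = 1) /\
  (forall g h tau, SL2Z g -> SL2Z h -> 0 < Im tau ->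
     chi (g *m h) * cpow (autj (g *m h) tau) k%:C =
     chi g * chi h * cpow (autj g (mobius h tau)) k%:C * cpow (autj h tau) k%:C).

Definition unitary_representation (m : nat) (rho : 'M[int]_2 -> 'M[C]_m) : Prop :=
  (forall g, SL2Z g -> rho g \is unitarymx) /\
  (forall g h, SL2Z g -> SL2Z h -> rho (g *m h) = rho g *m rho h).

Definition slash (m : nat) (k : R) (chi : 'M[int]_2 -> C)
    (rho : 'M[int]_2 -> 'M[C]_m) (f : C -> 'cV[C]_m) (g : 'M[int]_2) (tau : C) :
    'cV[C]_m :=
  (cpow (autj g tau) (- k%:C) * (chi g)^-1) *: (invmx (rho g) *m f (mobius g tau)).

Definition d_u (g : C -> C) (tau : C) : C :=
  cderive1 (fun u => g (u +i* Im tau)) (Re tau).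

Definition d_v (g : C -> C) (tau : C) : C :=
  cderive1 (fun v => g (Re tau +i* v)) (Im tau).

Definition d_tau (g : C -> C) (tau : C) : C := (d_u g tau - 'i * d_v g tau) / 2.

Definition d_taubar (g : C -> C) (tau : C) : C := (d_u g tau + 'i * d_v g tau) / 2.

Definition Delta (k : R) (g : C -> C) (tau : C) : C :=
  - 4 * (Im tau)%:C ^+ 2 * d_tau (d_taubar g) tau
  + 2 * k%:C * 'i * (Im tau)%:C * d_taubar g tau.

Section FourierData.
Variables (m : nat) (k : R) (kappa : 'I_m -> R).

Definition freq (j : 'I_m) (n : int) : R := n%:~R + kappa j.

Definition neg_freq (j : 'I_m) : set int := [set n | freq j n < 0].

Definition qexp (j : 'I_m) (n : int) (tau : C) : C :=
  cexp ((2 * pi * freq j n)%:C * 'i * tau).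

Definition fourier_plus (cp : 'I_m -> int -> C) (j : 'I_m) (tau : C) (n : int) : C :=
  cp j n * qexp j n tau.

Definition fourier_minus (cm : 'I_m -> int -> C) (j : 'I_m) (tau : C) (n : int) : C :=
  cm j n * (inc_gamma (1 - k) (- (4 * pi * freq j n * Im tau)))%:C * qexp j n tau.

Definition fourier_expansion (f : C -> 'cV[C]_m) (cp cm : 'I_m -> int -> C) : Prop :=
  (exists n1 : int, forall j n, n < n1 -> cp j n = 0) /\
  forall (j : 'I_m) (tau : C), 0 < Im tau ->
    [/\ csummable setT (fourier_plus cp j tau),
        csummable (neg_freq j) (fourier_minus cm j tau) &
        f tau j 0 = csum setT (fourier_plus cp j tau)
                    + csum (neg_freq j) (fourier_minus cm j tau)].

Definition harmonic_maass_form (chi : 'M[int]_2 -> C)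
    (rho : 'M[int]_2 -> 'M[C]_m) (f : C -> 'cV[C]_m) : Prop :=
  [/\ forall j, real_analytic (fun tau => f tau j 0),
      forall g tau, SL2Z g -> 0 < Im tau -> slash k chi rho f g tau = f tau,
      forall j tau, 0 < Im tau -> Delta k (fun z => f z j 0) tau = 0 &
      exists cp cm, fourier_expansion f cp cm].

(* The class F_f, for f with Fourier coefficients cp and cm.  The two sums are
   taken in the extended reals, where 0 * +oo = 0. *)
Definition test_space (n0 : nat) (cp cm : 'I_m -> int -> C) (phi : R -> C) : Prop :=
  [/\ piecewise_smooth phi,
      forall s : C, - (2 * pi * n0%:R) <= Re s ->
        cintegrable `]0, +oo[ (laplace_term phi s),
      forall s : C, 0 < Re s ->
        cintegrable `]0, +oo[ (laplace_term (twist phi (2 - k%:C)) s) &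
      forall j : 'I_m,
        (\esum_(n in setT)
            ((cnorm (cp j n))%:E * laplace_abs phi (2 * pi * freq j n)%R)
         + \esum_(n in neg_freq j)
            ((cnorm (cm j n) * powR (4 * pi * `|freq j n|) (1 - k))%:E
             * \int[mu]_(t in `]0%R, +oo[)
                 (laplace_abs (twist phi (2 - k%:C)%R)
                    (- (2 * pi * freq j n * (2 * t + 1)))%R
                  * ((powR (1 + t) k)^-1)%:E)) < +oo)%E].

Definition Lf (cp cm : 'I_m -> int -> C) (phi : R -> C) : 'cV[C]_m :=
  \col_j
    (csum setT (fun n => cp j n * laplace phi (2 * pi * freq j n)%:C)
     + csum (neg_freq j) (fun n =>
         cm j n * (powR (- (4 * pi * freq j n)) (1 - k))%:C
         * cintegral `]0, +oo[ (fun t =>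
             laplace (twist phi (2 - k%:C))
               (- (2 * pi * freq j n * (2 * t + 1)))%:C
             / (powR (1 + t) k)%:C))).

Definition Lseries (cp cm : 'I_m -> int -> C) (phi : R -> C) (s : C) : 'cV[C]_m :=
  Lf cp cm (twist phi s).

Definition Lseries_converges (n0 : nat) (cp cm : 'I_m -> int -> C)
    (phi : R -> C) (s : C) : Prop :=
  test_space n0 cp cm (twist phi s).

Definition Lseries_continuation (cp cm : 'I_m -> int -> C) (phi : R -> C)
    (Lam : C -> 'cV[C]_m) : Prop :=
  (forall j, entire (fun s => Lam s j 0)) /\
  (forall s, 1 / 2 < Re s -> Lam s = Lseries cp cm phi s).

End FourierData.

(* phi |_{1-k, chi^-1} S. *)
Definition slashS (k : R) (chi : 'M[int]_2 -> C) (phi : R -> C) (x : R) : C :=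
  cpow x%:C (k%:C - 1) * chi Smx * phi x^-1.

End MaassForms.

(* Main.v *)
(** The entries of f grow at most like exp(2 pi (n0 + d) (y + 1/y)) on the upper half-plane,
    for every d > 0: Dirichlet approximation moves a point of height y < 1 to height at least
    1/5 by a matrix whose automorphy factor lies between y and a multiple of sqrt y, and above
    that height the Fourier expansion and the hypothesis on n0 apply.  Bounding the Fourier
    coefficients by the supremum over horizontal lines, and comparing the terms at heights y
    and (1 - q) y, one gets the same bound for the sum of the absolute values of all terms of
    the expansion.

    A test function phi that is O(exp(-2 pi (n0 + eps) (x + 1/x))) therefore dominates
    everything: by Fubini, with Gamma(1 - k, w) exp(w/2) written as
    w^(1-k) times the integral over t > 0 of exp(-w (2t + 1)/2) (1 + t)^-k,
    L_f(phi) is the integral of phi(x) f(ix) over ]0, +oo[.  This class of phi is stable under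
    phi -> phi_s for every s, so the series converges on all of C and is the Mellin transform
    of a rapidly decaying function, hence entire.  The functional equation is the substitution
    x -> 1/x together with f(i/x) = (ix)^k chi(S) rho(S) f(ix). *)

Require Import Defs.
From HB Require Import structures.
From mathcomp Require Import all_boot all_order all_algebra.
From mathcomp Require Import all_classical all_reals all_analysis.
From mathcomp Require Import measurable_realfun spectral complex zify ring lra.

Import Order.TTheory GRing.Theory Num.Theory.
Import numFieldNormedType.Exports.

Set Implicit Arguments.
Unset Strict Implicit.
Unset Printing Implicit Defensive.

Local Open Scope classical_set_scope.
Local Open Scope ring_scope.
Local Open Scope complex_scope.

Local Notation Re := complex.Re.
Local Notation Im := complex.Im.

(** * Complex powers and exponentials *)

(** The growth bound is wanted for every d > 0 because each later step spends a little of d: the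
    automorphy factor, the powers of y from the gamma factors, the factor 1 / y of a geometric
    series, the factor x^(s-1). Each is dominated by exp(2 pi d (y + 1/y)) for arbitrarily small d,
    so part of the margin eps always survives.

    On a horizontal line the supremum of f controls only the total coefficient of a frequency, which
    for n + kappa_j < 0 is the sum of a holomorphic and a gamma term that might cancel. Letting y
    grow separates them: the gamma term decays up to a power of y, so a holomorphic term of
    frequency below -n0 would violate the bound and has coefficient 0. The finitely many other
    holomorphic terms of negative frequency are bounded directly, and the gamma terms follow by
    difference. The same vanishing puts every Laplace transform of phi that enters L_f with a
    non-zero coefficient into the half-plane Re(s) >= -2 pi n0, where its integral converges. *)

Section ComplexBasics.
Context {R : realType}.
Implicit Types (z w : R[i]) (x y : R).

Lemma Re_add z w : Re (z + w) = Re z + Re w. Proof. by case: z w => [? ?] []. Qed.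
Lemma Im_add z w : Im (z + w) = Im z + Im w. Proof. by case: z w => [? ?] []. Qed.
Lemma Re_opp z : Re (- z) = - Re z. Proof. by case: z. Qed.
Lemma Im_opp z : Im (- z) = - Im z. Proof. by case: z. Qed.
Lemma Re_sub z w : Re (z - w) = Re z - Re w. Proof. by rewrite Re_add Re_opp. Qed.
Lemma Im_sub z w : Im (z - w) = Im z - Im w. Proof. by rewrite Im_add Im_opp. Qed.
Lemma Re_mul z w : Re (z * w) = Re z * Re w - Im z * Im w.
Proof. by case: z w => [? ?] []. Qed.
Lemma Im_mul z w : Im (z * w) = Re z * Im w + Im z * Re w.
Proof. by case: z w => [? ?] []. Qed.
Lemma Re_mulr x z : Re (x%:C * z) = x * Re z.
Proof. by rewrite Re_mul /= mul0r subr0. Qed.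
Lemma Im_mulr x z : Im (x%:C * z) = x * Im z.
Proof. by rewrite Im_mul /= mul0r addr0. Qed.
Lemma eq_ReIm z w : Re z = Re w -> Im z = Im w -> z = w.
Proof. by case: z w => [? ?] [? ?] /= -> ->. Qed.

Lemma cnormE z : cnorm z = Num.sqrt (Re z ^+ 2 + Im z ^+ 2).
Proof. by case: z. Qed.
Lemma cnorm_ge0 z : 0 <= cnorm z. Proof. by rewrite cnormE sqrtr_ge0. Qed.
Lemma cnorm0 : cnorm (0 : R[i]) = 0. Proof. exact: ComplexField.Normc.normc0. Qed.
Lemma cnormM z w : cnorm (z * w) = cnorm z * cnorm w.
Proof. exact: ComplexField.Normc.normcM. Qed.
Lemma cnormV z : cnorm z^-1 = (cnorm z)^-1.
Proof. exact: ComplexField.Normc.normcV. Qed.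
Lemma cnormN z : cnorm (- z) = cnorm z.
Proof. by rewrite !cnormE Re_opp Im_opp !sqrrN. Qed.
Lemma cnormD z w : cnorm (z + w) <= cnorm z + cnorm w.
Proof. exact: le_normcD. Qed.
Lemma cnormB z w : cnorm (z - w) <= cnorm z + cnorm w.
Proof. by rewrite (le_trans (cnormD _ _))// cnormN. Qed.
Lemma cnorm_real x : cnorm x%:C = `|x|.
Proof. by rewrite cnormE /= expr0n addr0 sqrtr_sqr. Qed.
Lemma cnorm_eq0 z : cnorm z = 0 -> z = 0.
Proof. exact: ComplexField.Normc.eq0_normc. Qed.
Lemma cnorm_gt0 z : z != 0 -> 0 < cnorm z.
Proof.
move=> z0; rewrite lt0r cnorm_ge0 andbT.
by apply: contra z0 => /eqP/cnorm_eq0 ->.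
Qed.
Lemma normcC z : `|z| = (cnorm z)%:C. Proof. by rewrite normc_def cnormE. Qed.

Lemma Re_le_cnorm z : `|Re z| <= cnorm z.
Proof.
rewrite cnormE -[`|Re z|]ger0_norm ?normr_ge0// -sqrtr_sqr ler_wsqrtr//.
by rewrite real_normK ?num_real// lerDl sqr_ge0.
Qed.
Lemma Im_le_cnorm z : `|Im z| <= cnorm z.
Proof.
rewrite cnormE -[`|Im z|]ger0_norm ?normr_ge0// -sqrtr_sqr ler_wsqrtr//.
by rewrite real_normK ?num_real// lerDr sqr_ge0.
Qed.
Lemma cnorm_le_ReIm z : cnorm z <= `|Re z| + `|Im z|.
Proof.
rewrite cnormE -[leRHS]ger0_norm ?addr_ge0// -sqrtr_sqr ler_wsqrtr//.
rewrite sqrrD !real_normK ?num_real// -addrA lerD2l lerDr.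
by rewrite mulrn_wge0// mulr_ge0.
Qed.

Lemma cnorm_sum (I : Type) (r : seq I) (P : pred I) (F : I -> R[i]) :
  cnorm (\sum_(i <- r | P i) F i) <= \sum_(i <- r | P i) cnorm (F i).
Proof.
elim/big_ind2 : _ => //; first by rewrite cnorm0.
by move=> z a w b za wb; rewrite (le_trans (cnormD _ _))// lerD.
Qed.

Lemma cexpD z w : cexp (z + w) = cexp z * cexp w.
Proof.
apply: eq_ReIm; rewrite /= Re_add Im_add expRD ?cosD ?sinD; ring.
Qed.
Lemma cexp0 : cexp (0 : R[i]) = 1.
Proof. by apply: eq_ReIm; rewrite /= expR0 ?cos0 ?sin0 mul1r. Qed.
Lemma cnorm_cexp z : cnorm (cexp z) = expR (Re z).
Proof.
rewrite cnormE /= !exprMn -mulrDr cos2Dsin2 mulr1 sqrtr_sqr ger0_norm//.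
Qed.
Lemma cexp_neq0 z : cexp z != 0.
Proof.
apply/eqP => /(congr1 cnorm); rewrite cnorm_cexp cnorm0 => /eqP.
by rewrite gt_eqF// expR_gt0.
Qed.
Lemma cexpN z : cexp (- z) = (cexp z)^-1.
Proof.
apply: (mulfI (cexp_neq0 z)); rewrite -cexpD subrr cexp0 divff//.
exact: cexp_neq0.
Qed.
Lemma cexp_real x : cexp x%:C = (expR x)%:C.
Proof. by apply: eq_ReIm; rewrite /= ?cos0 ?sin0 ?mulr1 ?mulr0. Qed.

Lemma clog_real x : 0 < x -> clog x%:C = (ln x)%:C.
Proof.
move=> x0; rewrite /clog /carg cnorm_real gtr0_norm//= lexx.
by rewrite divff ?gt_eqF// acos1.
Qed.
Lemma cpow_real x z : 0 < x -> cpow x%:C z = cexp ((ln x)%:C * z).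
Proof. by move=> x0; rewrite /cpow clog_real// mulrC. Qed.
Lemma cnorm_cpow_real x z : 0 < x -> cnorm (cpow x%:C z) = powR x (Re z).
Proof.
by move=> x0; rewrite cpow_real// cnorm_cexp Re_mulr /powR gt_eqF// mulrC.
Qed.
Lemma cpow_real_real x y : 0 < x -> cpow x%:C y%:C = (powR x y)%:C.
Proof.
move=> x0; rewrite cpow_real// -rmorphM cexp_real /powR gt_eqF//.
by rewrite mulrC.
Qed.
Lemma cpow_realD x z w : 0 < x -> cpow x%:C (z + w) = cpow x%:C z * cpow x%:C w.
Proof. by move=> x0; rewrite !cpow_real// mulrDr cexpD. Qed.
Lemma cpow_realV x z : 0 < x -> cpow (x^-1)%:C z = cpow x%:C (- z).
Proof.
move=> x0; rewrite !cpow_real ?invr_gt0// lnV ?posrE//.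
by rewrite rmorphN mulNr mulrN.
Qed.
Lemma cpow_neq0 z w : cpow z w != 0. Proof. exact: cexp_neq0. Qed.
Lemma cpowN z w : cpow z (- w) = (cpow z w)^-1.
Proof. by rewrite /cpow mulNr cexpN. Qed.
Lemma cnorm_cpow z x : z != 0 -> cnorm (cpow z x%:C) = powR (cnorm z) x.
Proof.
move=> z0; rewrite /cpow cnorm_cexp Re_mulr /= /powR gt_eqF//.
exact: cnorm_gt0.
Qed.

Lemma carg_imag x : 0 < x -> carg ('i%C * x%:C) = pi / 2.
Proof. by move=> x0; rewrite /carg Re_mul Im_mul /= !(mul0r, mulr0, subr0, addr0, add0r, oppr0, mul1r) ltW// acos0. Qed.

(** On the positive imaginary axis the arguments pi / 2 and 0 of the factors add up without leaving
    the principal branch. *)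
Lemma cpow_imag x z : 0 < x -> cpow ('i%C * x%:C) z = cpow 'i z * cpow x%:C z.
Proof.
move=> x0; have i1 : cnorm ('i : R[i]) = 1 by rewrite cnormE /= expr0n add0r expr1n sqrtr1.
rewrite (cpow_real _ x0) /cpow -cexpD; congr cexp.
rewrite [(ln x)%:C * z]mulrC -mulrDr; congr (_ * _).
have := @carg_imag 1 ltr01; rewrite mulr1 => ci.
apply: eq_ReIm; last by rewrite Im_add /= carg_imag// addr0; exact/esym/ci.
by rewrite Re_add /clog cnormM i1 cnorm_real gtr0_norm// mul1r /= ln1 add0r.
Qed.

Lemma normr_sin_le x : `|sin x| <= `|x|.
Proof.
wlog x0 : x / 0 <= x.
  move=> H; have [/H//|/ltW x0] := leP 0 x.
  by rewrite -normrN -sinN -[leRHS]normrN H// oppr_ge0.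
have [c|c] := @MVT_segment _ (@sin R) cos _ _ x0 (fun t _ => is_derive_sin t).
  by apply: continuous_subspaceT => y; exact: continuous_sin.
rewrite sin0 !subr0 => _ ->; rewrite normrM ler_piMl//.
exact: cos_max.
Qed.

Lemma cos_halfE x : 1 - cos x = 2 * sin (x / 2) ^+ 2.
Proof.
have -> : cos x = cos (x / 2 + x / 2) by congr cos; lra.
rewrite cosD; have := cos2Dsin2 (x / 2); lra.
Qed.

Lemma norm_cosB1_le x : `|cos x - 1| <= x ^+ 2.
Proof.
have := cos_halfE x; have := sqr_ge0 (sin (x / 2)) => s0 ch.
rewrite distrC ger0_norm; last by lra.
have : sin (x / 2) ^+ 2 <= (x / 2) ^+ 2.
  by rewrite -ler_sqrt ?sqr_ge0// !sqrtr_sqr normr_sin_le.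
have := sqr_ge0 x; rewrite exprMn; lra.
Qed.

(** The derivative of sin t - t is cos t - 1, so this linear bound gives the quadratic one of
    [norm_sinBx_le] by the mean value theorem. *)
Lemma norm_cosB1_le1 x : `|cos x - 1| <= `|x|.
Proof.
have := cos_halfE x; have := sqr_ge0 (sin (x / 2)) => s0 ch.
rewrite distrC ger0_norm; last by lra.
rewrite ch -real_normK ?num_real// expr2.
have := normr_sin_le (x / 2); have := sin_max (x / 2).
rewrite normrM [`|2^-1|]ger0_norm//.
have := normr_ge0 (sin (x / 2)); nra.
Qed.

Lemma norm_sinBx_le x : `|sin x - x| <= x ^+ 2.
Proof.
wlog x0 : x / 0 <= x.
  move=> H; have [/H//|/ltW x0] := leP 0 x.
  have := H (- x); rewrite oppr_ge0 sqrrN sinN => /(_ x0).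
  by rewrite -opprD normrN.
have dh (t : R) : is_derive t 1 (fun t => sin t - t : R^o) (cos t - 1).
  by apply: is_deriveB.
have [c|c] := @MVT_segment _ (fun t => sin t - t) (fun t => cos t - 1) _ _ x0 (fun t _ => dh t).
  apply: continuous_subspaceT => y; apply: cvgB; [exact: continuous_sin|exact: cvg_id].
rewrite in_itv/= => /andP[c0 cx].
rewrite sin0 !subr0 => ->; rewrite normrM (ger0_norm x0) expr2 ler_wpM2r//.
by rewrite (le_trans (norm_cosB1_le1 _))// ger0_norm.
Qed.

(** Only 1 + x <= exp x enters, at x and at -x. *)
Lemma norm_expRB1_le x : `|expR x - 1| <= `|x| * expR `|x|.
Proof.
have h1 := expR_ge1Dx x; have h2 := expR_ge1Dx (- x).
have e0 := expR_gt0 x; have ee : expR x * expR (- x) = 1 by rewrite -expRD subrr expR0.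
have [x0|x0] := leP 0 x.
  rewrite !ger0_norm//; nra.
rewrite !ltr0_norm; nra.
Qed.

Lemma norm_expRB1x_le x : `|expR x - 1 - x| <= x ^+ 2 * expR `|x|.
Proof.
have h1 := expR_ge1Dx x; have h2 := expR_ge1Dx (- x).
have e0 := expR_gt0 x; have ee : expR x * expR (- x) = 1 by rewrite -expRD subrr expR0.
rewrite ger0_norm; last by lra.
have [x0|x0] := leP 0 x.
  have h3 : expR x - 1 <= x * expR x by nra.
  by rewrite (ger0_norm x0); nra.
rewrite !ltr0_norm//; have : 1 <= expR (- x) by lra.
move=> h3; have : expR x <= 1 by nra.
move=> h4; have h5 : expR x - 1 <= x * expR x by nra.
have h6 : x * (expR x - 1) <= x * x by nra.
have h7 : expR x - 1 - x <= x * x by nra.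
by rewrite (le_trans h7)// expr2 ler_peMr// nmulr_rge0// ltW.
Qed.

(** Real and imaginary part split into four summands, each at most |z|^2 exp |z|. The estimate
    serves to differentiate a Mellin transform under the integral sign. *)
Lemma cexp_taylor2 z :
  cnorm (cexp z - 1 - z) <= 5 * cnorm z ^+ 2 * expR (cnorm z).
Proof.
apply: le_trans (cnorm_le_ReIm _) _.
have ha := Re_le_cnorm z; have hb := Im_le_cnorm z.
have h0 := cnorm_ge0 z.
set a := Re z in ha *; set b := Im z in hb *; set r := cnorm z in ha hb h0 *.
have -> : Re (cexp z - 1 - z) = (expR a - 1 - a) + expR a * (cos b - 1).
  by rewrite !Re_sub /= -/a -/b; ring.
have -> : Im (cexp z - 1 - z) = expR a * (sin b - b) + (expR a - 1) * b.
  by rewrite !Im_sub /= -/a -/b; ring.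
have a2 : a ^+ 2 <= r ^+ 2 by rewrite -real_normK ?num_real// lerXn2r ?nnegrE.
have b2 : b ^+ 2 <= r ^+ 2 by rewrite -real_normK ?num_real// lerXn2r ?nnegrE.
have ea : expR `|a| <= expR r by rewrite ler_expR.
have ea' : expR a <= expR r by rewrite ler_expR (le_trans (ler_norm _)).
have e0 := expR_gt0 a; have e0' := expR_gt0 `|a|; have er0 := expR_gt0 r.
have r2 := sqr_ge0 r.
have A1 : `|expR a - 1 - a| <= r ^+ 2 * expR r.
  by rewrite (le_trans (norm_expRB1x_le _))// ler_pM ?sqr_ge0 ?expR_ge0.
have A2 : `|expR a * (cos b - 1)| <= r ^+ 2 * expR r.
  rewrite normrM mulrC ler_pM// ?(gtr0_norm e0)//.
  by rewrite (le_trans (norm_cosB1_le _)).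
have A3 : `|expR a * (sin b - b)| <= r ^+ 2 * expR r.
  rewrite normrM mulrC ler_pM// ?(gtr0_norm e0)//.
  by rewrite (le_trans (norm_sinBx_le _)).
have A4 : `|(expR a - 1) * b| <= r ^+ 2 * expR r.
  rewrite normrM expr2 mulrAC ler_pM//.
  by rewrite (le_trans (norm_expRB1_le _))// ler_pM ?expR_ge0.
have := ler_normD (expR a - 1 - a) (expR a * (cos b - 1)).
have := ler_normD (expR a * (sin b - b)) ((expR a - 1) * b).
have : 0 <= r ^+ 2 * expR r by rewrite mulr_ge0// ltW.
rewrite -[5 * _ * _]mulrA; lra.
Qed.

End ComplexBasics.

(** * Piecewise smooth functions *)

Section IteratedDerivatives.
Context {R : realType}.
Implicit Types (f g : R -> R) (c d x : R).

(** The recursion passes to the first derivative of f, so that sums, products and compositions are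
    handled by induction on n through a formula for that derivative; [derivable_uptoP] translates
    back to [derive1n]. *)
Fixpoint derivable_upto n c d f : Prop :=
  (forall x, c < x < d -> derivable f x 1) /\
  (if n is p.+1 then derivable_upto p c d (derive1 f) else True).

Lemma derivable_uptoP c d f : (forall n, derivable_upto n c d f) <->
  (forall n x, c < x < d -> derivable (derive1n n f) x 1).
Proof.
split=> [+ n|].
  elim: n f => [|n IH] f H x cxd; first by have [/(_ x cxd)] := H 0%N.
  by rewrite derive1Sn; apply: IH => // p; have [] := H p.+1.
move=> + n; elim: n f => [|n IH] f H; first by split=> // x; exact: (H 0%N).
split; first exact: (H 0%N).
by apply: IH => p x cxd; rewrite -derive1Sn; exact: H.
Qed.

Lemma near_itvoo (P : R -> Prop) c d x : c < x < d ->
  (forall y, c < y < d -> P y) -> \forall y \near x, P y.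
Proof.
move=> cxd H; have : x \in `]c, d[ by rewrite in_itv.
by move=> /near_in_itvoo; apply: filterS => y; rewrite in_itv/=; exact: H.
Qed.

(** The interval is open, so functions that agree on it agree near each of its points and have the
    same derivatives. This allows a derivative to be replaced by a formula valid on ]c, d[ only. *)
Lemma derivable_upto_ext n c d f g : (forall x, c < x < d -> f x = g x) ->
  derivable_upto n c d f -> derivable_upto n c d g.
Proof.
elim: n f g => [|n IH] f g fg [df Hf]; split.
- move=> x cxd; apply: (@near_eq_derivable _ _ _ f); last exact: df.
  exact: near_itvoo cxd fg.
- exact: I.
- move=> x cxd; apply: (@near_eq_derivable _ _ _ f); last exact: df.
  exact: near_itvoo cxd fg.
- apply: IH Hf => x cxd; rewrite !derive1E; apply: near_eq_derive.
  exact: near_itvoo cxd fg.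
Qed.

Lemma derivable_uptoW n c d f :
  derivable_upto n.+1 c d f -> derivable_upto n c d f.
Proof.
by elim: n f => [|n IH] f [df Hf]; split; [exact: df|exact: I|exact: df|exact: IH].
Qed.

Lemma derivable_uptoD n c d f g : derivable_upto n c d f ->
  derivable_upto n c d g -> derivable_upto n c d (fun x => f x + g x).
Proof.
elim: n f g => [|n IH] f g [df Hf] [dg Hg].
  by split=> [x cxd|]; [apply: derivableD; [exact: df|exact: dg]|exact: I].
split; first by move=> x cxd; apply: derivableD; [exact: df|exact: dg].
apply: derivable_upto_ext (IH _ _ Hf Hg) => x cxd.
by rewrite !derive1E deriveD//; [exact: df|exact: dg].
Qed.

Lemma derivable_uptoM n c d f g : derivable_upto n c d f ->
  derivable_upto n c d g -> derivable_upto n c d (fun x => f x * g x).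
Proof.
elim: n f g => [|n IH] f g Hf Hg.
  have [df _] := Hf; have [dg _] := Hg.
  by split=> [x cxd|]; [apply: derivableM; [exact: df|exact: dg]|exact: I].
have Hf' := derivable_uptoW Hf; have Hg' := derivable_uptoW Hg.
have [df Hf1] := Hf; have [dg Hg1] := Hg.
split; first by move=> x cxd; apply: derivableM; [exact: df|exact: dg].
apply: derivable_upto_ext (derivable_uptoD (IH _ _ Hf' Hg1) (IH _ _ Hg' Hf1)) => x cxd.
by rewrite !derive1E deriveM//; [exact: df|exact: dg].
Qed.

Lemma derivable_upto_cst n c d a : derivable_upto n c d (fun=> a).
Proof.
elim: n a => [|n IH] a; split => [x cxd|].
- exact: derivable_cst.
- exact: I.
- exact: derivable_cst.
- by apply: derivable_upto_ext (IH 0) => x _; rewrite derive1_cst.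
Qed.

(** The real part of x^(a + i t) is the case (al, be) = (1, 0) and the imaginary part the case (0,
    1). The family is closed under differentiation, which lowers a by 1 and transforms (al, be)
    linearly, so smoothness of complex powers is a single induction. *)
Let wave a t al be x :=
  expR (a * ln x) * (al * cos (t * ln x) + be * sin (t * ln x)).

Let is_derive_wave a t al be x : 0 < x ->
  is_derive x 1 (wave a t al be)
   (wave (a - 1) t (a * al + t * be) (a * be - t * al) x).
Proof.
move=> x0; have dl := is_derive1_ln x0.
have dm b : is_derive x 1 (fun y => b * ln y) (b * x^-1).
  have := @is_deriveZ R R R _ b x 1 _ dl; exact.
have de : is_derive x 1 (fun y => expR (a * ln y)) (a * x^-1 * expR (a * ln x)).
  have := @is_derive1_comp _ expR (fun y => a * ln y) _ _ _ (is_derive_expR _) (dm a).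
  by move=> H; apply: is_derive_eq H _; rewrite mulrC.
have dc : is_derive x 1 (fun y => cos (t * ln y)) (- (t * x^-1 * sin (t * ln x))).
  have := @is_derive1_comp _ cos (fun y => t * ln y) _ _ _ (is_derive_cos _) (dm t).
  by move=> H; apply: is_derive_eq H _; rewrite mulNr mulrC.
have ds : is_derive x 1 (fun y => sin (t * ln y)) (t * x^-1 * cos (t * ln x)).
  have := @is_derive1_comp _ sin (fun y => t * ln y) _ _ _ (is_derive_sin _) (dm t).
  by move=> H; apply: is_derive_eq H _; rewrite mulrC.
have := is_deriveM de (is_deriveD (is_deriveZ al dc) (is_deriveZ be ds)).
move=> H; apply: is_derive_eq H _.
rewrite /wave mulrBl mul1r expRB lnK ?posrE// /GRing.scale /=.
rewrite -[X in _ + X]/((al * cos (t * ln x) + be * sin (t * ln x)) * (a / x * expR (a * ln x))).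
ring.
Qed.

Let derivable_upto_wave n a t al be c d : 0 <= c ->
  derivable_upto n c d (wave a t al be).
Proof.
move=> c0; elim: n a al be => [|n IH] a al be.
  split; last exact: I.
  by move=> x /andP[cx _]; apply: ex_derive; exact/is_derive_wave/(le_lt_trans c0).
split=> [x /andP[cx _]|].
  apply: ex_derive; exact/is_derive_wave/(le_lt_trans c0).
apply: derivable_upto_ext (IH (a - 1) (a * al + t * be) (a * be - t * al)) => x /andP[cx _].
by rewrite derive1E (derive_val (is_derive := is_derive_wave _ _ _ _ (le_lt_trans c0 cx))).
Qed.

Lemma derivable_upto_Re_cpow n (s : R[i]) c d : 0 <= c ->
  derivable_upto n c d (fun x => Re (cpow x%:C s)).
Proof.
move=> c0; apply: derivable_upto_ext (derivable_upto_wave n (Re s) (Im s) 1 0 d c0).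
move=> x /andP[cx _]; rewrite cpow_real ?(le_lt_trans c0)// /cexp Re_mulr Im_mulr /=.
by rewrite /wave mul0r addr0 mul1r ![ln x * _]mulrC.
Qed.

Lemma derivable_upto_Im_cpow n (s : R[i]) c d : 0 <= c ->
  derivable_upto n c d (fun x => Im (cpow x%:C s)).
Proof.
move=> c0; apply: derivable_upto_ext (derivable_upto_wave n (Re s) (Im s) 0 1 d c0).
move=> x /andP[cx _]; rewrite cpow_real ?(le_lt_trans c0)// /cexp Re_mulr Im_mulr /=.
by rewrite /wave mul0r add0r mul1r ![ln x * _]mulrC.
Qed.

(** The derivative of f(1/x) is f'(1/x) times -x^-2: the first factor falls under the induction
    hypothesis, and the second is smooth as a real power of x. *)
Lemma derivable_upto_compV n c d f : 0 < c -> c < d ->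
  derivable_upto n c d f -> derivable_upto n d^-1 c^-1 (fun x => f x^-1).
Proof.
move=> c0 cd; have d0 := lt_trans c0 cd.
have dpos x : d^-1 < x < c^-1 -> 0 < x.
  by move=> /andP[+ _]; apply: lt_trans; rewrite invr_gt0.
have cdx x : d^-1 < x < c^-1 -> c < x^-1 < d.
  move=> H; have x0 := dpos _ H; move: H => /andP[dx xc].
  by rewrite -[c]invrK -[d]invrK !ltf_pV2 ?posrE ?invr_gt0// dx xc.
have dinv x : d^-1 < x < c^-1 -> is_derive x 1 (fun y : R => y^-1) (- x ^- 2).
  move=> H; have x0 := dpos _ H.
  have := @is_deriveV R id x 1 1 _ (is_derive_id x 1).
  rewrite gt_eqF// => /(_ isT) K; apply: is_derive_eq K _.
  by rewrite /GRing.scale /= mulr1.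
have dinvn p : derivable_upto p d^-1 c^-1 (fun x : R => - x ^- 2).
  apply: derivable_upto_ext (derivable_uptoM (derivable_upto_cst p _ _ (-1))
    (derivable_upto_Re_cpow p (- 2 : R)%:C (c^-1) _)); last by rewrite invr_ge0 ltW.
  move=> x H; have x0 := dpos _ H.
  by rewrite cpow_real_real//= powRN -powR_mulrn ?ltW// mulN1r.
elim: n f => [|n IH] f Hf.
  have [df _] := Hf; split; last exact: I.
  move=> x H.
  apply: ex_derive; apply: is_derive1_comp (dinv _ H).
  by apply/derivableP/df/cdx.
have Hf' := derivable_uptoW Hf; have [df Hf1] := Hf.
have Dx x : d^-1 < x < c^-1 ->
    is_derive x 1 (fun x => f x^-1) (derive1 f x^-1 * - x ^- 2).
  move=> H; apply: is_derive1_comp (dinv _ H).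
  by rewrite derive1E; apply/derivableP/df/cdx.
split=> [x /Dx H|]; first exact: ex_derive.
apply: derivable_upto_ext (derivable_uptoM (IH _ Hf1) (dinvn n)) => x /Dx H.
by rewrite [RHS]derive1E (derive_val (is_derive := H)).
Qed.

End IteratedDerivatives.

(** * Closure, local boundedness and measurability of piecewise smooth functions *)

Section PiecewiseSmooth.
Context {R : realType}.
Implicit Types (phi g h : R -> R[i]) (c d x : R).

Lemma smooth_onP c d g : smooth_on c d g <->
  (forall n, derivable_upto n c d (fun t => Re (g t))) /\
  (forall n, derivable_upto n c d (fun t => Im (g t))).
Proof.
split=> [H|[/derivable_uptoP H1 /derivable_uptoP H2]].
  by split; apply/derivable_uptoP => n x /(H n x) [].
by move=> n x cxd; split; [exact: H1|exact: H2].
Qed.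

Lemma smooth_on_sub c d c' d' g : c <= c' -> d' <= d ->
  smooth_on c d g -> smooth_on c' d' g.
Proof.
move=> cc dd H n x /andP[cx xd]; apply: H.
by rewrite (le_lt_trans cc cx) (lt_le_trans xd dd).
Qed.

Lemma smooth_onM c d g h : smooth_on c d g -> smooth_on c d h ->
  smooth_on c d (fun x => g x * h x).
Proof.
move=> /smooth_onP[g1 g2] /smooth_onP[h1 h2]; apply/smooth_onP; split=> n.
  apply: derivable_upto_ext (derivable_uptoD (derivable_uptoM (g1 n) (h1 n))
    (derivable_uptoM (derivable_upto_cst n c d (-1)) (derivable_uptoM (g2 n) (h2 n)))).
  by move=> x _; rewrite Re_mul mulN1r.
apply: derivable_upto_ext (derivable_uptoD (derivable_uptoM (g1 n) (h2 n))
  (derivable_uptoM (g2 n) (h1 n))).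
by move=> x _; rewrite Im_mul.
Qed.

Lemma smooth_on_cst c d (a : R[i]) : smooth_on c d (fun=> a).
Proof. by apply/smooth_onP; split=> n; exact: derivable_upto_cst. Qed.

Lemma smooth_on_cpow c d (s : R[i]) : 0 <= c ->
  smooth_on c d (fun x => cpow x%:C s).
Proof.
move=> c0; apply/smooth_onP; split=> n.
  exact: derivable_upto_Re_cpow.
exact: derivable_upto_Im_cpow.
Qed.

Lemma piecewise_smoothM phi h :
  (forall c d, 0 <= c -> smooth_on c d h) -> piecewise_smooth phi ->
  piecewise_smooth (fun x => phi x * h x).
Proof.
move=> hs [E [fE H]]; exists E; split=> // p q p0 pq Epq.
have [g [c [d [cp qd sg phig]]]] := H p q p0 pq Epq.
(* The neighbourhood of [p, q] is cut off at 0, since h is known to be smooth only to the right of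
   0; as p > 0 it remains a neighbourhood. *)
exists (fun x => g x * h x), (Num.max c 0), d; split=> //.
- by rewrite gt_max cp p0.
- apply: smooth_onM; last by apply: hs; rewrite le_max lexx orbT.
  by apply: smooth_on_sub sg => //; rewrite le_max lexx.
- by move=> x /phig ->.
Qed.

Lemma piecewise_smooth_compV phi : piecewise_smooth phi ->
  piecewise_smooth (fun x => phi x^-1).
Proof.
move=> [E [fE H]]; exists (GRing.inv @^-1` E); split.
  move=> a b a0; have [b0|b0] := leP b 0.
    rewrite (_ : _ `&` _ = set0); first exact: finite_set0.
    apply/seteqP; split=> // x /= [_]; rewrite in_itv/= => /andP[ax xb].
    by have := lt_le_trans a0 (le_trans ax (le_trans xb b0)); rewrite ltxx.
  have b'0 : 0 < b^-1 by rewrite invr_gt0.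
  have /(finite_image GRing.inv) := fE b^-1 a^-1 b'0.
  apply: sub_finite_set => x /= [Ex]; rewrite in_itv/= => /andP[ax xb].
  have x0 := lt_le_trans a0 ax.
  exists x^-1; last by rewrite invrK.
  by split=> //=; rewrite in_itv/= !lef_pV2 ?posrE// ax xb.
move=> p q p0 pq Epq; have q0 := lt_trans p0 pq.
have [] := H q^-1 p^-1; rewrite ?invr_gt0// ?ltf_pV2 ?posrE//.
  apply/seteqP; split=> // x /= [Ex]; rewrite in_itv/= => /andP[qx xp].
  have x0 : 0 < x by apply: lt_trans qx; rewrite invr_gt0.
  have : (GRing.inv @^-1` E `&` `]p, q[) x^-1.
    split; rewrite /= ?invrK// in_itv/= -[p]invrK -[q]invrK.
    by rewrite !ltf_pV2 ?posrE ?invr_gt0// xp qx.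
  by rewrite Epq.
move=> g [c [d [cq pd sg phig]]].
(* The left end is made positive so that it can be inverted, and stays below 1/q. *)
pose c' := Num.max c (q^-1 / 2).
have c'0 : 0 < c' by rewrite lt_max divr_gt0 ?orbT ?invr_gt0.
have c'q : c' < q^-1.
  by rewrite gt_max cq /= ltr_pdivrMr// ltr_pMr ?invr_gt0// ltr1n.
have d0 : 0 < d by apply: lt_trans pd; rewrite invr_gt0.
have c'd : c' < d by rewrite (lt_trans c'q)// (lt_trans _ pd)// ltf_pV2.
exists (fun x => g x^-1), d^-1, c'^-1; split.
- by rewrite -[p]invrK ltf_pV2 ?posrE ?invr_gt0.
- by rewrite -[q]invrK ltf_pV2 ?posrE ?invr_gt0.
- have cc' : c <= c' by rewrite le_max lexx.
  have /smooth_onP[s1 s2] := smooth_on_sub cc' (lexx d) sg.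
  apply/smooth_onP; split=> n.
    exact: (derivable_upto_compV c'0 c'd (s1 n)).
  exact: (derivable_upto_compV c'0 c'd (s2 n)).
- move=> x /andP[px xq]; apply: phig; have x0 := lt_trans p0 px.
  by rewrite !ltf_pV2 ?posrE// px xq.
Qed.

Lemma finite_set_isolated (S : set R) x : finite_set S ->
  exists2 e, 0 < e & forall y, S y -> y != x -> e <= `|y - x|.
Proof.
move=> /finite_seqP[s ->]; elim: s => [|a s [e e0 IH]]; first by exists 1.
have [->|ax] := eqVneq a x.
  exists e => // y /=; rewrite inE => /orP[/eqP ->|ys yx]; first by rewrite eqxx.
  exact: IH.
exists (Num.min e `|a - x|); first by rewrite lt_min e0 normr_gt0 subr_eq0.
move=> y /=; rewrite inE => /orP[/eqP ->|ys] yx.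
  by rewrite ge_min lexx orbT.
by rewrite ge_min IH.
Qed.

Lemma break_points_isolated (E : set R) x : 0 < x ->
  (forall a b, 0 < a -> finite_set (E `&` `[a, b])) ->
  exists p q, [/\ 0 < p, p < x, x < q &
    forall y, E y -> p < y < q -> y = x].
Proof.
move=> x0 /(_ (x / 2) (2 * x)); rewrite divr_gt0// => /(_ isT).
move=> /(finite_set_isolated x) [e e0 He].
exists (Num.max (x / 2) (x - e)), (Num.min (2 * x) (x + e)); split.
- by rewrite lt_max divr_gt0.
- by rewrite gt_max ltr_pdivrMr// ltr_pMr ?ltr1n//= ltrBlDr ltrDl.
- by rewrite lt_min ltr_pMl ?ltr1n//= ltrDl.
move=> y Ey; rewrite gt_max lt_min => /andP[/andP[y1 y2] /andP[y3 y4]].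
apply/eqP; apply: contraT => yx.
have := He y; rewrite leNgt ltr_distl y2 y4 => /(_ _ yx); apply.
by split => //=; rewrite in_itv/= !ltW.
Qed.

Lemma smooth_on_continuous c d g x : smooth_on c d g -> c < x < d ->
  {for x, continuous (fun t => Re (g t))} /\ {for x, continuous (fun t => Im (g t))}.
Proof.
move=> sg /(sg 0%N) [d1 d2].
by split; apply: differentiable_continuous; exact/derivable1_diffP.
Qed.

Lemma continuous_near_bounded (h : R -> R) x : {for x, continuous h} ->
  \forall y \near x, `|h y| <= `|h x| + 1.
Proof.
move=> /cvgrPdist_le /(_ 1 ltr01); apply: filterS => y.
rewrite distrC => H; rewrite -[h y](subrK (h x)) addrC (le_trans (ler_normD _ _))//.
by rewrite lerD2l.
Qed.

(** On either side of x the function agrees with one that is smooth across x, hence bounded near x.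
    The unconstrained value at x itself is added to the bound. *)
Lemma piecewise_smooth_near_bounded phi x : piecewise_smooth phi -> 0 < x ->
  exists M, \forall y \near x, cnorm (phi y) <= M.
Proof.
move=> [E [fE H]] x0.
have [p [q [p0 px xq pq]]] := break_points_isolated x0 fE.
have [|g1 [c1 [d1 [cp1 qd1 /smooth_on_continuous s1 e1]]]] := H p x p0 px.
  apply/seteqP; split=> // y /= [Ey]; rewrite in_itv/= => /andP[y1 y2].
  by have := pq y Ey; rewrite y1 (lt_trans y2 xq) => /(_ isT) yx; move: y2; rewrite yx ltxx.
have [|g2 [c2 [d2 [cp2 qd2 /smooth_on_continuous s2 e2]]]] := H x q x0 xq.
  apply/seteqP; split=> // y /= [Ey]; rewrite in_itv/= => /andP[y1 y2].
  by have := pq y Ey; rewrite y2 (lt_trans px y1) => /(_ isT) yx; move: y1; rewrite yx ltxx.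
have [a1 b1] : _ /\ _ := s1 x (introT andP (conj (lt_trans cp1 px) qd1)).
have [a2 b2] : _ /\ _ := s2 x (introT andP (conj cp2 (lt_trans xq qd2))).
exists ((`|Re (g1 x)| + 1 + (`|Im (g1 x)| + 1)) + (`|Re (g2 x)| + 1 + (`|Im (g2 x)| + 1))
  + cnorm (phi x)).
have nx : \forall y \near x, p < y < q by apply: (near_itvoo (c := p) (d := q)) => //; rewrite px xq.
have F := nbhs_filter x.
have N1 := @filterI _ _ F _ _ (continuous_near_bounded a1) (continuous_near_bounded b1).
have N2 := @filterI _ _ F _ _ (continuous_near_bounded a2) (continuous_near_bounded b2).
move: N1 N2 nx; apply: filterS3 => y [A1 B1] [A2 B2] /andP[py yq].
have cx := cnorm_ge0 (phi x).
have pos z : 0 <= `|Re (z : R[i])| + 1 + (`|Im z| + 1) by rewrite !addr_ge0.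
have [yx|yx|->] := ltgtP y x; last by rewrite lerDr addr_ge0 ?pos.
  rewrite e1 ?py// (le_trans (cnorm_le_ReIm _))//.
  by have := pos (g2 x); move: A1 B1; lra.
rewrite e2 ?yx// (le_trans (cnorm_le_ReIm _))//.
by have := pos (g1 x); move: A2 B2; lra.
Qed.

Lemma piecewise_smooth_bounded phi a b : piecewise_smooth phi -> 0 < a ->
  exists M, forall x, a <= x <= b -> cnorm (phi x) <= M.
Proof.
move=> sphi a0.
(* Compactness in the form of near coverings: with the bound M tending to +oo, local boundedness
   becomes uniform on [a, b]. *)
have /compact_near_coveringP/(_ R (pinfty_nbhs R) (fun M x => cnorm (phi x) <= M) _) :=
  @segment_compact R a b.
case.
  move=> x; rewrite /= in_itv/= => /andP[ax xb].
  have [M HM] := piecewise_smooth_near_bounded sphi (lt_le_trans a0 ax).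
  exists ([set y | cnorm (phi y) <= M], [set N | M < N]).
    by split=> //=; exists M; split => //; exact: num_real.
  by case=> y N /= [yM /ltW]; exact: le_trans.
move=> M [_ HM]; exists (M + 1) => x abx; by apply: HM; rewrite ?ltrDl.
Qed.

(** The break points in ]0, +oo[ form a countable set, on which every function is measurable; its
    complement in ]0, +oo[ is open and phi is continuous there. *)
Lemma piecewise_smooth_measurable phi : piecewise_smooth phi ->
  measurable_fun (`]0, +oo[ : set R) (fun x => Re (phi x)) /\
  measurable_fun (`]0, +oo[ : set R) (fun x => Im (phi x)).
Proof.
move=> [E [fE H]]; set P : set R := `]0, +oo[%classic.
have mP : measurable P by exact: measurable_itv.
have cE : countable (P `&` E).
  (* The half-line is exhausted by the intervals [1 / (n + 1), n + 1], each of which contains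
     finitely many break points. *)
  have -> : P `&` E = \bigcup_n (E `&` `[n.+1%:R^-1, n.+1%:R]).
    apply/seteqP; split=> [x [Px Ex]|x [n _ [Ex]]]; last first.
      rewrite /= in_itv/= => /andP[nx _]; split => //.
      by rewrite /P/= in_itv/= andbT (lt_le_trans _ nx).
    move: Px; rewrite /P/= in_itv/= andbT => x0.
    exists (Num.truncn (x + x^-1)) => //; split => //=; rewrite in_itv/=.
    have := Num.Theory.truncnS_gt (x + x^-1).
    have x'0 : 0 < x^-1 by rewrite invr_gt0.
    move=> /ltW xn; apply/andP; split; last by rewrite (le_trans _ xn)// lerDl ltW.
    by rewrite -[leRHS]invrK lef_pV2 ?posrE// (le_trans _ xn)// lerDr ltW.
  by apply: bigcup_countable => // n _; apply/finite_set_countable/fE.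
have mE : measurable (P `&` E).
  exact: (@countable_measurable _ (measurableTypeR R)).
have mO : measurable (P `\` E).
  have -> : P `\` E = P `\` (P `&` E) by rewrite setDIr setDv set0U.
  exact: measurableD.
have near_smooth x : (P `\` E) x -> exists2 g, (\forall y \near x, (P `\` E) y /\ phi y = g y) &
    {for x, continuous (fun t => Re (g t))} /\ {for x, continuous (fun t => Im (g t))}.
  move=> [+ nEx]; rewrite /P/= in_itv/= andbT => x0.
  have [p [q [p0 px xq pq]]] := break_points_isolated x0 fE.
  have nE y : p < y < q -> ~ E y.
    by move=> pyq Ey; have := pq y Ey pyq => yx; apply: nEx; rewrite -yx.
  have [|g [c [d [cp qd sg e]]]] := H p q p0 (lt_trans px xq).
    by apply/seteqP; split=> // y /= [Ey]; rewrite in_itv/= => /nE.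
  exists g.
    apply: (near_itvoo (c := p) (d := q)); first by rewrite px xq.
    move=> y pyq; split; last exact: e.
    by split; [rewrite /= in_itv/= andbT (lt_trans p0)//; case/andP: pyq|exact: nE].
  apply: smooth_on_continuous sg _.
  by rewrite (lt_trans cp px) (lt_trans xq qd).
have oO : open (P `\` E).
  rewrite openE => x /near_smooth[g + _]; rewrite /interior; apply: filterS => y [].
  by [].
have PE : P = (P `\` E) `|` (P `&` E) by rewrite setUC setUIDK.
have mfE (f : R -> R) : measurable_fun (P `&` E) f.
  move=> _ Y mY; apply: (@countable_measurable _ (measurableTypeR R)) => //.
  by apply: sub_countable cE; apply: subset_card_le => x [].
have key (F : R[i] -> R) : (forall x g, (\forall y \near x, (P `\` E) y /\ phi y = g y) ->
    {for x, continuous (fun t => F (g t))} -> {for x, continuous (fun t => F (phi t))}).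
  move=> x g H1 H2; apply: cvg_trans; first apply: near_eq_cvg.
    by apply: filterS H1 => y [_ ->].
  by rewrite -/(phi x) (nbhs_singleton H1).2; exact: H2.
split; rewrite PE; apply/measurable_funU => //; split => //.
  apply: open_continuous_measurable_fun => // x; rewrite inE => /near_smooth[g H1 [H2 _]].
  exact: key H1 H2.
apply: open_continuous_measurable_fun => // x; rewrite inE => /near_smooth[g H1 [_ H2]].
exact: key H1 H2.
Qed.

End PiecewiseSmooth.

(** * Sums and integrals of complex functions *)

Section Sums.
Context {R : realType}.

Section General.
Variables (I : choiceType) (D : set I).
Implicit Types (a b p q : I -> R) (z w : I -> R[i]).

(** [rsum] is defined by positive and negative parts, but additivity and the exchange with an
    integral produce other nonnegative families p and q with difference a; the value does not depend
    on that choice. *)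
Lemma rsum_decomposition a p q :
  (forall n, D n -> 0 <= p n) -> (forall n, D n -> 0 <= q n) ->
  (forall n, D n -> a n = p n - q n) ->
  (\esum_(n in D) (p n)%:E < +oo)%E -> (\esum_(n in D) (q n)%:E < +oo)%E ->
  rsum D a = fine (\esum_(n in D) (p n)%:E) - fine (\esum_(n in D) (q n)%:E).
Proof.
move=> p0 q0 apq sp sq.
have fp : (\esum_(n in D) (p n)%:E)%E \is a fin_num.
  by rewrite ge0_fin_numE// esum_ge0// => n /p0; rewrite lee_fin.
have fq : (\esum_(n in D) (q n)%:E)%E \is a fin_num.
  by rewrite ge0_fin_numE// esum_ge0// => n /q0; rewrite lee_fin.
have abs_p : summable D (EFin \o p).
  rewrite /summable (@eq_esum _ _ _ _ (EFin \o p))// => n Dn /=.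
  by rewrite ger0_norm ?p0.
have abs_q : summable D (EFin \o q).
  rewrite /summable (@eq_esum _ _ _ _ (EFin \o q))// => n Dn /=.
  by rewrite ger0_norm ?q0.
have := @esumB _ _ D _ _ abs_p abs_q (fun n Dn => p0 n Dn : (0 <= (p n)%:E)%E)
  (fun n Dn => q0 n Dn : (0 <= (q n)%:E)%E).
have E1 : (\esum_(n in D) ((EFin \o p) \- (EFin \o q))^\+ n =
    \esum_(n in D) (Num.max (a n) 0)%:E)%E.
  by apply: eq_esum => n Dn; rewrite funeposE /= apq// -EFinB EFin_max.
have E2 : (\esum_(n in D) ((EFin \o p) \- (EFin \o q))^\- n =
    \esum_(n in D) (Num.max (- a n) 0)%:E)%E.
  by apply: eq_esum => n Dn; rewrite funenegE /= apq// EFin_max.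
rewrite E1 E2 /rsum => E.
have F1 : (\esum_(n in D) (Num.max (a n) 0)%:E)%E \is a fin_num.
  rewrite ge0_fin_numE; last by apply: esum_ge0 => n _; rewrite lee_fin le_max lexx orbT.
  apply: le_lt_trans sp; apply: le_esum => n Dn; rewrite lee_fin apq//.
  by rewrite ge_max p0// andbT lerBlDr lerDl q0.
have F2 : (\esum_(n in D) (Num.max (- a n) 0)%:E)%E \is a fin_num.
  rewrite ge0_fin_numE; last by apply: esum_ge0 => n _; rewrite lee_fin le_max lexx orbT.
  apply: le_lt_trans sq; apply: le_esum => n Dn; rewrite lee_fin apq//.
  by rewrite ge_max q0// andbT opprB lerBlDr lerDl p0.
by rewrite -!fineB// E.
Qed.

Lemma esum_fin_num (h : I -> R) : (forall n, D n -> 0 <= h n) ->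
  (\esum_(n in D) (h n)%:E < +oo)%E -> (\esum_(n in D) (h n)%:E)%E \is a fin_num.
Proof. by move=> h0 ?; rewrite ge0_fin_numE// esum_ge0// => n /h0; rewrite lee_fin. Qed.

Lemma esum_ltyW (h g : I -> R) : (forall n, D n -> h n <= g n) ->
  (\esum_(n in D) (g n)%:E < +oo)%E -> (\esum_(n in D) (h n)%:E < +oo)%E.
Proof. by move=> hg; apply: le_lt_trans; apply: le_esum => n Dn; rewrite lee_fin hg. Qed.

Lemma maxr_id0 (x : R) : x = Num.max x 0 - Num.max (- x) 0.
Proof.
have [x0|x0] := leP 0 x; rewrite /Num.max !oppr_lt0; first by case: ltgtP x0 => //; lra.
by case: ltgtP x0 => //; lra.
Qed.

Lemma max0_ge0 (x : R) : 0 <= Num.max x 0.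
Proof. by rewrite le_max lexx orbT. Qed.

Lemma max0_le_norm (x : R) : Num.max x 0 <= `|x|.
Proof. by rewrite ge_max ler_norm normr_ge0. Qed.

Lemma rsumD a b :
  (\esum_(n in D) (`|a n|)%:E < +oo)%E -> (\esum_(n in D) (`|b n|)%:E < +oo)%E ->
  rsum D (fun n => a n + b n) = rsum D a + rsum D b.
Proof.
move=> sa sb.
have sp (c : I -> R) : (\esum_(n in D) (`|c n|)%:E < +oo)%E ->
    (\esum_(n in D) (Num.max (c n) 0)%:E < +oo)%E.
  by apply: esum_ltyW => n _; exact: max0_le_norm.
have sn (c : I -> R) : (\esum_(n in D) (`|c n|)%:E < +oo)%E ->
    (\esum_(n in D) (Num.max (- c n) 0)%:E < +oo)%E.
  by apply: esum_ltyW => n _; rewrite -normrN max0_le_norm.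
have EP : (\esum_(n in D) (Num.max (a n) 0 + Num.max (b n) 0)%:E =
   \esum_(n in D) (Num.max (a n) 0)%:E + \esum_(n in D) (Num.max (b n) 0)%:E)%E.
  by rewrite -esumD// => n _; rewrite lee_fin max0_ge0.
have EQ : (\esum_(n in D) (Num.max (- a n) 0 + Num.max (- b n) 0)%:E =
   \esum_(n in D) (Num.max (- a n) 0)%:E + \esum_(n in D) (Num.max (- b n) 0)%:E)%E.
  by rewrite -esumD// => n _; rewrite lee_fin max0_ge0.
rewrite (@rsum_decomposition _ (fun n => Num.max (a n) 0 + Num.max (b n) 0)
  (fun n => Num.max (- a n) 0 + Num.max (- b n) 0)).
- rewrite EP EQ !fineD; first by rewrite /rsum; lra.
  - by apply: esum_fin_num => [n _|]; [exact: max0_ge0|exact: sn].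
  - by apply: esum_fin_num => [n _|]; [exact: max0_ge0|exact: sn].
  - by apply: esum_fin_num => [n _|]; [exact: max0_ge0|exact: sp].
  - by apply: esum_fin_num => [n _|]; [exact: max0_ge0|exact: sp].
- by move=> n _; rewrite addr_ge0// max0_ge0.
- by move=> n _; rewrite addr_ge0// max0_ge0.
- by move=> n _; rewrite {1}(maxr_id0 (a n)) {1}(maxr_id0 (b n)); lra.
- by rewrite EP lte_add_pinfty// sp.
- by rewrite EQ lte_add_pinfty// sn.
Qed.

Lemma norm_rsum_le a : (\esum_(n in D) (`|a n|)%:E < +oo)%E ->
  `|rsum D a| <= fine (\esum_(n in D) (`|a n|)%:E).
Proof.
move=> sa; rewrite /rsum.
have A : fine (\esum_(n in D) (Num.max (a n) 0)%:E) <= fine (\esum_(n in D) (`|a n|)%:E).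
  rewrite fine_le ?esum_fin_num//; first by move=> n _; exact: max0_ge0.
    by apply: esum_ltyW sa => n _; exact: max0_le_norm.
  by apply: le_esum => n _; rewrite lee_fin max0_le_norm.
have B : fine (\esum_(n in D) (Num.max (- a n) 0)%:E) <= fine (\esum_(n in D) (`|a n|)%:E).
  rewrite fine_le ?esum_fin_num//; first by move=> n _; exact: max0_ge0.
    by apply: esum_ltyW sa => n _; rewrite -normrN max0_le_norm.
  by apply: le_esum => n _; rewrite lee_fin -normrN max0_le_norm.
have A0 : 0 <= fine (\esum_(n in D) (Num.max (a n) 0)%:E).
  by apply/fine_ge0/esum_ge0 => n _; rewrite lee_fin max0_ge0.
have B0 : 0 <= fine (\esum_(n in D) (Num.max (- a n) 0)%:E).
  by apply/fine_ge0/esum_ge0 => n _; rewrite lee_fin max0_ge0.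
by rewrite ler_norml; lra.
Qed.

Lemma csummable_Re z : csummable D z -> (\esum_(n in D) (`|Re (z n)|)%:E < +oo)%E.
Proof. by apply: esum_ltyW => n _; exact: Re_le_cnorm. Qed.

Lemma csummable_Im z : csummable D z -> (\esum_(n in D) (`|Im (z n)|)%:E < +oo)%E.
Proof. by apply: esum_ltyW => n _; exact: Im_le_cnorm. Qed.

Lemma csummableW z w : (forall n, D n -> cnorm (z n) <= cnorm (w n)) ->
  csummable D w -> csummable D z.
Proof. exact: esum_ltyW. Qed.

Lemma csummableD z w : csummable D z -> csummable D w ->
  csummable D (fun n => z n + w n).
Proof.
move=> sz sw; have : (\esum_(n in D) (cnorm (z n) + cnorm (w n))%:E < +oo)%E.
  rewrite (eq_esum (b := fun n => (cnorm (z n))%:E + (cnorm (w n))%:E)%E)//.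
  by rewrite esumD ?lte_add_pinfty// => n _; rewrite lee_fin cnorm_ge0.
by apply: esum_ltyW => n _; exact: cnormD.
Qed.

Lemma csumD z w : csummable D z -> csummable D w ->
  csum D (fun n => z n + w n) = csum D z + csum D w.
Proof.
move=> sz sw; apply: eq_ReIm.
  rewrite Re_add /= -rsumD ?csummable_Re//.
  by congr (rsum D _); apply/funext => n; rewrite Re_add.
rewrite Im_add /= -rsumD ?csummable_Im//.
by congr (rsum D _); apply/funext => n; rewrite Im_add.
Qed.

(** Real and imaginary parts are estimated separately, hence the factor 2. *)
Lemma cnorm_csum_le z : csummable D z ->
  cnorm (csum D z) <= 2 * fine (\esum_(n in D) (cnorm (z n))%:E).
Proof.
move=> sz; apply: le_trans (cnorm_le_ReIm _) _; rewrite /=.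
have := norm_rsum_le (csummable_Re sz); have := norm_rsum_le (csummable_Im sz).
have A : fine (\esum_(n in D) (`|Re (z n)|)%:E) <= fine (\esum_(n in D) (cnorm (z n))%:E).
  rewrite fine_le ?esum_fin_num ?csummable_Re// => [n _|]; first exact: cnorm_ge0.
  by apply: le_esum => n _; rewrite lee_fin Re_le_cnorm.
have B : fine (\esum_(n in D) (`|Im (z n)|)%:E) <= fine (\esum_(n in D) (cnorm (z n))%:E).
  rewrite fine_le ?esum_fin_num ?csummable_Im// => [n _|]; first exact: cnorm_ge0.
  by apply: le_esum => n _; rewrite lee_fin Im_le_cnorm.
move: A B; lra.
Qed.

Lemma eq_rsum a b : (forall n, D n -> a n = b n) -> rsum D a = rsum D b.
Proof.
move=> ab; rewrite /rsum; congr (fine _ - fine _); apply: eq_esum => n Dn;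
by rewrite ab.
Qed.

Lemma eq_csum z w : (forall n, D n -> z n = w n) -> csum D z = csum D w.
Proof. by move=> zw; rewrite /csum; congr (_ +i* _); apply: eq_rsum => n /zw ->. Qed.

End General.

(** The enumeration 0, -1, 1, -2, 2, ..., which turns sums over the integers into series over
    nat. *)
Definition int_of_nat (n : nat) : int := if odd n then Negz n./2 else Posz n./2.

Lemma int_of_nat_bij : set_bij [set: nat] [set: int] int_of_nat.
Proof.
split=> //.
  move=> m n _ _; rewrite /int_of_nat.
  have := odd_double_half m; have := odd_double_half n.
  by case: (odd m); case: (odd n) => // Em En [E]; rewrite -Em -En E.
move=> [n|n] _.
  by exists n.*2 => //; rewrite /int_of_nat odd_double doubleK.
by exists n.*2.+1 => //; rewrite /int_of_nat /= odd_double /= uphalf_double.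
Qed.

(** The absolute value grows linearly along the enumeration; this makes exp(-x |n|) a geometric
    series in the index. *)
Lemma int_of_nat_ge n : (n <= 2 * `|int_of_nat n| + 1)%N.
Proof.
rewrite /int_of_nat -{1}(odd_double_half n); case: (odd n) => /=.
  by rewrite -muln2; lia.
by rewrite -muln2; lia.
Qed.

Definition nat_family (D : set int) (z : int -> R[i]) (n : nat) : R[i] :=
  if int_of_nat n \in D then z (int_of_nat n) else 0.

Lemma esum_int_nat (D : set int) (h : int -> \bar R) :
  \esum_(n in D) h n =
  (\esum_(n in [set: nat]) (if int_of_nat n \in D then h (int_of_nat n) else 0))%E.
Proof. by rewrite esum_mkcond (reindex_esum _ _ _ _ int_of_nat_bij). Qed.

Lemma rsum_int_nat (D : set int) (a : int -> R) :
  rsum D a = rsum setT (fun n => if int_of_nat n \in D then a (int_of_nat n) else 0).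
Proof.
rewrite /rsum !esum_int_nat; congr (fine _ - fine _); apply: eq_esum => n _.
  by case: ifP => //; rewrite maxxx.
by case: ifP => //; rewrite oppr0 maxxx.
Qed.

Lemma csum_int_nat (D : set int) (z : int -> R[i]) :
  csum D z = csum setT (nat_family D z).
Proof.
rewrite /csum !rsum_int_nat; congr (_ +i* _); apply: eq_rsum => n _;
by rewrite /nat_family; case: ifP.
Qed.

Lemma csummable_int_nat (D : set int) (z : int -> R[i]) :
  csummable D z <-> csummable setT (nat_family D z).
Proof.
rewrite /csummable esum_int_nat; suff -> : (\esum_(n in [set: nat])
  (if int_of_nat n \in D then (cnorm (z (int_of_nat n)))%:E else 0) =
  \esum_(n in [set: nat]) (cnorm (nat_family D z n))%:E)%E by [].
by apply: eq_esum => n _; rewrite /nat_family; case: ifP; rewrite ?cnorm0.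
Qed.

Lemma csum_single (N : nat) (c : R[i]) :
  csum [set: nat] (fun n => if n == N then c else 0) = c.
Proof.
have H (x : R) : rsum [set: nat] (fun n => if n == N then x else 0) = x.
  have E (y : R) : 0 <= y -> (\esum_(n in [set: nat]) (if n == N then y else 0)%:E = y%:E)%E.
    move=> y0; rewrite -[RHS](@esum_set1 _ _ N (fun=> y%:E))//.
    rewrite [RHS]esum_mkcond; apply: eq_esum => n _.
    by case: eqVneq => [->|nN]; [rewrite mem_set|rewrite memNset//; exact/eqP].
  rewrite /rsum (eq_esum (b := fun n => (if n == N then Num.max x 0 else 0)%:E)); last first.
    by move=> n _; case: ifP; rewrite ?maxxx.
  rewrite (eq_esum (a := fun n => (Num.max (- _) 0)%:E)
    (b := fun n => (if n == N then Num.max (- x) 0 else 0)%:E)); last first.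
    by move=> n _; case: ifP; rewrite ?oppr0 ?maxxx.
  by rewrite !E ?max0_ge0//= -maxr_id0.
by apply: eq_ReIm => /=; rewrite -[RHS]H; apply: eq_rsum => n _; case: ifP.
Qed.

Lemma csum_split (z : nat -> R[i]) N : csummable setT z ->
  csum setT z = \sum_(i < N) z i + csum setT (fun n => if (n < N)%N then 0 else z n).
Proof.
move=> sz; elim: N => [|N ->]; first by rewrite big_ord0 add0r.
rewrite big_ord_recr/= -addrA; congr (_ + _).
rewrite -{1}(csum_single N (z N)) -csumD.
- apply: eq_csum => n _; rewrite ltnS.
  case: (ltngtP n N) => [nN|nN|->]; rewrite ?addr0 ?add0r//.
- apply: csummableW sz => n _; case: eqP => [->//|_]; by rewrite cnorm0 cnorm_ge0.
- by apply: csummableW sz => n _; case: ifP => // _; rewrite cnorm0 cnorm_ge0.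
Qed.

(** One [N0] serves all families dominated by z. In [coef_le] these are the Fourier series at all
    abscissas u, for which the truncation has to be uniform. *)
Lemma csum_tail (z : nat -> R[i]) (e : R) : csummable setT z -> 0 < e ->
  exists N0, forall N, (N0 <= N)%N -> forall w : nat -> R[i],
    (forall n, cnorm (w n) <= cnorm (z n)) ->
    cnorm (csum setT w - \sum_(i < N) w i) <= e.
Proof.
move=> sz e0; pose h n := (cnorm (z n))%:E.
have h0 n : (0 <= h n)%E by rewrite lee_fin cnorm_ge0.
have /nneseries_tail_cvg : (\sum_(n <oo) h n < +oo)%E by rewrite nneseries_esumT.
move=> /(_ (fun n _ => h0 n)) /fine_cvgP[/= _].
(* Half of e compensates the factor 2 of [cnorm_csum_le]. *)
move=> /cvgrPdist_le /(_ (e / 2)); rewrite divr_gt0// => /(_ isT).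
move=> [N0 _ HN]; exists N0 => N N0N w wz.
have sw : csummable setT w by apply: csummableW sz => n _; exact: wz.
rewrite (csum_split N sw) addrC addKr.
have sw' : csummable setT (fun n => if (n < N)%N then 0 else w n).
  by apply: csummableW sw => n _; case: ifP => // _; rewrite cnorm0 cnorm_ge0.
apply: le_trans (cnorm_csum_le sw') _.
rewrite mulrC -ler_pdivlMr//; have /= := HN N N0N.
rewrite sub0r normrN; apply: le_trans; apply: le_trans (ler_norm _).
have E : (\esum_(n in [set: nat]) (cnorm (if (n < N)%N then 0 else z n))%:E =
    \sum_(N <= n <oo) h n)%E.
  rewrite -nneseries_esumT; last by move=> n; rewrite lee_fin cnorm_ge0.
  rewrite (nneseries_split 0 N); last by move=> n _; rewrite lee_fin cnorm_ge0.
  rewrite big_mkord big1 ?add0e ?add0n; last first.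
    by move=> n _; rewrite ltn_ord cnorm0.
  apply: congr_lim; apply/funext => M; apply: eq_big_nat => n /andP[Nn _].
  by rewrite ltnNge Nn.
rewrite -E fine_le//.
- by rewrite esum_fin_num// => n _; exact: cnorm_ge0.
- rewrite esum_fin_num// => [n _|]; first exact: cnorm_ge0.
  by apply: csummableW sz => n _; case: ifP => // _; rewrite cnorm0 cnorm_ge0.
- by apply: le_esum => n _; rewrite lee_fin; case: ifP.
Qed.

End Sums.

(** * Lebesgue integrals of complex functions and their exchange with sums *)

Section ComplexIntegral.
Context {R : realType}.
Local Notation mu := (@lebesgue_measure R).
Variables (D : set R) (mD : measurable D).
Implicit Types (g h : R -> R[i]).

Definition cmeasurable g : Prop :=
  measurable_fun D (fun x => Re (g x)) /\ measurable_fun D (fun x => Im (g x)).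

Lemma cmeasurableM g h : cmeasurable g -> cmeasurable h ->
  cmeasurable (fun x => g x * h x).
Proof.
move=> [g1 g2] [h1 h2]; split.
  under eq_fun do rewrite Re_mul.
  by apply: measurable_funB; apply: measurable_funM.
under eq_fun do rewrite Im_mul.
by apply: measurable_funD; apply: measurable_funM.
Qed.

Lemma cmeasurable_cst (c : R[i]) : cmeasurable (fun=> c).
Proof. by split; exact: measurable_cst. Qed.

Lemma eq_cmeasurable g h : (forall x, D x -> g x = h x) ->
  cmeasurable g -> cmeasurable h.
Proof.
move=> gh [g1 g2]; split; [apply: eq_measurable_fun g1|apply: eq_measurable_fun g2];
by move=> x; rewrite inE => /gh ->.
Qed.

Lemma measurable_fun_norm (f : R -> R) : measurable_fun D f ->
  measurable_fun D (fun x => `|f x|).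
Proof. exact: (measurableT_comp (@normr_measurable R setT)). Qed.

Lemma cmeasurable_cnorm g : cmeasurable g -> measurable_fun D (fun x => cnorm (g x)).
Proof.
move=> [g1 g2]; under eq_fun do rewrite cnormE.
apply: (measurableT_comp (continuous_measurable_fun (@sqrt_continuous R))).
by apply: measurable_funD; apply: measurable_funX.
Qed.

Lemma cintegrable_dominated g (H : R -> R) : cmeasurable g ->
  (forall x, D x -> cnorm (g x) <= H x) -> mu.-integrable D (EFin \o H) ->
  cintegrable D g.
Proof.
move=> [g1 g2] gH iH; split.
  apply: le_integrable iH => //; first exact/measurable_EFinP.
  move=> x Dx /=; rewrite lee_fin (le_trans (Re_le_cnorm _))//.
  by rewrite (le_trans (gH x Dx))// ler_norm.
apply: le_integrable iH => //; first exact/measurable_EFinP.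
move=> x Dx /=; rewrite lee_fin (le_trans (Im_le_cnorm _))//.
by rewrite (le_trans (gH x Dx))// ler_norm.
Qed.

Lemma eq_cintegral g h : (forall x, D x -> g x = h x) ->
  cintegral D g = cintegral D h.
Proof.
by move=> gh; rewrite /cintegral; congr (_ +i* _); apply: eq_Rintegral => x;
rewrite inE => /gh ->.
Qed.

Lemma eq_cintegrable g h : (forall x, D x -> g x = h x) ->
  cintegrable D g -> cintegrable D h.
Proof.
move=> gh [g1 g2]; split; [apply: eq_integrable g1|apply: eq_integrable g2] => //;
by move=> x; rewrite inE => /gh ->.
Qed.

Lemma cintegralD g h : cintegrable D g -> cintegrable D h ->
  cintegral D (fun x => g x + h x) = cintegral D g + cintegral D h.
Proof.
move=> [g1 g2] [h1 h2]; apply: eq_ReIm.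
  rewrite Re_add /= -RintegralD//; apply: eq_Rintegral => x _; exact: Re_add.
rewrite Im_add /= -RintegralD//; apply: eq_Rintegral => x _; exact: Im_add.
Qed.

Lemma cintegrableD g h : cintegrable D g -> cintegrable D h ->
  cintegrable D (fun x => g x + h x).
Proof.
move=> [g1 g2] [h1 h2]; split.
  rewrite (_ : (fun x => _) = (fun x => (Re (g x))%:E + (Re (h x))%:E)%E).
    exact: integrableD.
  by apply/funext => x; rewrite Re_add.
rewrite (_ : (fun x => _) = (fun x => (Im (g x))%:E + (Im (h x))%:E)%E).
  exact: integrableD.
by apply/funext => x; rewrite Im_add.
Qed.

Lemma cintegrableZl (c : R[i]) g : cintegrable D g -> cintegrable D (fun x => c * g x).
Proof.
move=> [g1 g2]; split.
  under eq_fun do rewrite Re_mul EFinB !EFinM.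
  by apply: integrableB => //; apply: integrableZl.
under eq_fun do rewrite Im_mul EFinD !EFinM.
by apply: integrableD => //; apply: integrableZl.
Qed.

Lemma cintegralZl (c : R[i]) g : cintegrable D g ->
  cintegral D (fun x => c * g x) = c * cintegral D g.
Proof.
move=> [g1 g2].
have Z (r : R) (f : R -> R) : mu.-integrable D (EFin \o f) ->
    mu.-integrable D (EFin \o (fun x => r * f x)).
  by move=> fi; rewrite (_ : _ \o _ = (fun x => r%:E * (EFin \o f) x)%E)//; exact: integrableZl.
apply: eq_ReIm.
  rewrite Re_mul /= -!RintegralZl// -RintegralB//; try exact: Z.
  by apply: eq_Rintegral => x _; exact: Re_mul.
rewrite Im_mul /= -!RintegralZl// -RintegralD//; try exact: Z.
by apply: eq_Rintegral => x _; exact: Im_mul.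
Qed.

Lemma cnorm_cintegral_le g (H : R -> R) : cintegrable D g ->
  (forall x, D x -> cnorm (g x) <= H x) -> mu.-integrable D (EFin \o H) ->
  cnorm (cintegral D g) <= 2 * \int[mu]_(x in D) H x.
Proof.
move=> [g1 g2] gH iH; apply: le_trans (cnorm_le_ReIm _) _ => /=.
have K (f : R -> R) : mu.-integrable D (EFin \o f) ->
    (forall x, D x -> `|f x| <= H x) ->
    `|\int[mu]_(x in D) f x| <= \int[mu]_(x in D) H x.
  move=> fi fH; rewrite (le_trans (le_normr_Rintegral _ fi))//.
  apply: le_Rintegral => //.
  by rewrite (_ : _ \o _ = abse \o (EFin \o f))//; exact: integrable_abse.
rewrite mulr2n mulrDl !mul1r lerD// K// => x Dx.
  by rewrite (le_trans (Re_le_cnorm _))// gH.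
by rewrite (le_trans (Im_le_cnorm _))// gH.
Qed.

Lemma rsum_Rintegral (r : nat -> R -> R) :
  (forall n, measurable_fun D (r n)) ->
  (forall x, D x -> \esum_(n in [set: nat]) (`|r n x|)%:E < +oo)%E ->
  (\esum_(n in [set: nat]) \int[mu]_(x in D) (`|r n x|)%:E < +oo)%E ->
  mu.-integrable D (fun x => (rsum setT (r ^~ x))%:E) /\
  \int[mu]_(x in D) rsum setT (r ^~ x) =
    rsum setT (fun n => \int[mu]_(x in D) r n x).
Proof.
move=> mr fr ir.
(* Monotone convergence for a nonnegative family below |r n|. It is used for the positive and for
   the negative parts, and [rsum_decomposition] puts the two results together. *)
have half (s : nat -> R -> R) : (forall n, measurable_fun D (s n)) ->
  (forall n x, D x -> 0 <= s n x <= `|r n x|) ->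
  [/\ mu.-integrable D (fun x => (fine (\esum_(n in [set: nat]) (s n x)%:E))%:E),
   (\esum_(n in [set: nat]) (\int[mu]_(x in D) s n x)%:E < +oo)%E,
   (forall n, mu.-integrable D (EFin \o s n)) &
   \int[mu]_(x in D) fine (\esum_(n in [set: nat]) (s n x)%:E) =
   fine (\esum_(n in [set: nat]) (\int[mu]_(x in D) s n x)%:E)].
  move=> ms sr.
  have s0 n x : D x -> (0 <= (s n x)%:E)%E by move=> /(sr n)/andP[]; rewrite lee_fin.
  have mse n : measurable_fun D (EFin \o s n) by exact/measurable_EFinP.
  have le1 n : (\int[mu]_(x in D) (s n x)%:E <= \int[mu]_(x in D) (`|r n x|)%:E)%E.
    apply: ge0_le_integral => //.
    - by move=> x; exact: s0.
    - exact: mse.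
    - by apply/measurable_EFinP; exact: measurable_fun_norm.
    - by move=> x /(sr n)/andP[_]; rewrite lee_fin.
  have sumfin : (\esum_(n in [set: nat]) \int[mu]_(x in D) (s n x)%:E < +oo)%E.
    by apply: le_lt_trans ir; apply: le_esum => n _; exact: le1.
  have int0 n : (0 <= \int[mu]_(x in D) (s n x)%:E)%E.
    by apply: integral_ge0 => x; exact: s0.
  have sfin n : (\int[mu]_(x in D) (s n x)%:E)%E \is a fin_num.
    rewrite ge0_fin_numE// (le_lt_trans _ sumfin)//.
    rewrite (esumID [set n])//= ?setTI.
    by rewrite esum_set1// leeDl// esum_ge0// => k _; exact: int0.
  have sE : (\esum_(n in [set: nat]) (\int[mu]_(x in D) s n x)%:E =
     \esum_(n in [set: nat]) \int[mu]_(x in D) (s n x)%:E)%E.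
    by apply: eq_esum => n _; rewrite /Rintegral fineK.
  have iE : (\int[mu]_(x in D) (\esum_(n in [set: nat]) (s n x)%:E) =
     \esum_(n in [set: nat]) \int[mu]_(x in D) (s n x)%:E)%E.
    rewrite -nneseries_esumT// -integral_nneseries//.
    by apply: eq_integral => x; rewrite inE => Dx; rewrite nneseries_esumT// => n; exact: s0.
  have pfin x : D x -> (\esum_(n in [set: nat]) (s n x)%:E)%E \is a fin_num.
    move=> Dx; apply: esum_fin_num => [n _|]; first by case/andP: (sr n x Dx).
    by apply: esum_ltyW (fr x Dx) => n _; case/andP: (sr n x Dx).
  have fE x : D x -> ((fine (\esum_(n in [set: nat]) (s n x)%:E))%:E =
     \esum_(n in [set: nat]) (s n x)%:E)%E by move=> Dx; rewrite fineK// pfin.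
  have mS : measurable_fun D (fun x => (\esum_(n in [set: nat]) (s n x)%:E)%E).
    apply: (eq_measurable_fun (fun x => (\sum_(n <oo) (s n x)%:E)%E)).
      by move=> x; rewrite inE => Dx; rewrite nneseries_esumT// => n; exact: s0.
    apply: (ge0_emeasurable_sum (h := fun n x => (s n x)%:E)); first by move=> n x Dx _; exact: s0.
    by move=> n _; exact: mse.
  split.
  - suff : mu.-integrable D (fun x => (\esum_(n in [set: nat]) (s n x)%:E)%E).
      by apply: eq_integrable => // x; rewrite inE => /fE ->.
    apply/integrableP; split=> //.
    suff -> : (\int[mu]_(x in D) `|\esum_(n in [set: nat]) (s n x)%:E| =
      \int[mu]_(x in D) (\esum_(n in [set: nat]) (s n x)%:E))%E by rewrite iE.
    apply: eq_integral => x; rewrite inE => Dx; rewrite gee0_abs// esum_ge0// => n _.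
    exact: s0.
  - by rewrite sE.
  - move=> n; apply/integrableP; split; first exact: mse.
    suff -> : (\int[mu]_(x in D) `|(EFin \o s n) x| =
      \int[mu]_(x in D) (s n x)%:E)%E by rewrite ltey_eq sfin.
    by apply: eq_integral => x; rewrite inE => Dx; rewrite gee0_abs// s0.
  - rewrite sE -iE /Rintegral; congr fine.
    by apply: eq_integral => x; rewrite inE => /fE ->.
have mpos (f : R -> R) : measurable_fun D f -> measurable_fun D (fun x => Num.max (f x) 0).
  by move=> mf; apply: measurable_maxr => //; exact: measurable_cst.
have [p1 p2 p3 p4] := half (fun n x => Num.max (r n x) 0) (fun n => mpos _ (mr n))
  (fun n x _ => introT andP (conj (max0_ge0 _) (max0_le_norm _))).
have [|n x _|q1 q2 q3 q4] := half (fun n x => Num.max (- r n x) 0).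
- by move=> n; apply: mpos; exact: measurableT_comp.
- by rewrite max0_ge0 -normrN max0_le_norm.
split.
  have := integrableB _ p1 q1; apply; exact: mD.
rewrite (@rsum_decomposition _ _ _ _ (fun n => \int[mu]_(x in D) Num.max (r n x) 0)
  (fun n => \int[mu]_(x in D) Num.max (- r n x) 0)) //.
- by rewrite -p4 -q4 -RintegralB.
- by move=> n _; apply: Rintegral_ge0 => x _; exact: max0_ge0.
- by move=> n _; apply: Rintegral_ge0 => x _; exact: max0_ge0.
- move=> n _; rewrite -RintegralB//.
  by apply: eq_Rintegral => x _; exact: maxr_id0.
Qed.

Lemma csum_cintegral (g : nat -> R -> R[i]) :
  (forall n, cmeasurable (g n)) ->
  (forall x, D x -> csummable setT (g ^~ x)) ->
  (\esum_(n in [set: nat]) \int[mu]_(x in D) (cnorm (g n x))%:E < +oo)%E ->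
  cintegrable D (fun x => csum setT (g ^~ x)) /\
  cintegral D (fun x => csum setT (g ^~ x)) =
    csum setT (fun n => cintegral D (g n)).
Proof.
move=> mg fg ig.
have W (F : R[i] -> R) : (forall n, measurable_fun D (fun x => F (g n x))) ->
    (forall z, `|F z| <= cnorm z) ->
    (\esum_(n in [set: nat]) \int[mu]_(x in D) (`|F (g n x)|)%:E < +oo)%E.
  move=> mF HF; apply: le_lt_trans ig; apply: le_esum => n _.
  apply: ge0_le_integral => //.
  - by apply/measurable_EFinP; exact: measurable_fun_norm.
  - by apply/measurable_EFinP; exact: (cmeasurable_cnorm (mg n)).
  - by move=> x _; rewrite lee_fin.
have [|||r1 r2] := @rsum_Rintegral (fun n x => Re (g n x)).
- by move=> n; case: (mg n).
- by move=> x /fg /csummable_Re.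
- by apply: (W (@Re R)) => [n|]; [case: (mg n)|exact: Re_le_cnorm].
have [|||i1 i2] := @rsum_Rintegral (fun n x => Im (g n x)).
- by move=> n; case: (mg n).
- by move=> x /fg /csummable_Im.
- by apply: (W (@Im R)) => [n|]; [case: (mg n)|exact: Im_le_cnorm].
by split=> //; rewrite /cintegral /csum /= r2 i2.
Qed.

End ComplexIntegral.

(** * Affine substitutions, and the invariant measure dx/x on the positive half-line *)

Section ChangeOfVariables.
Context {R : realType}.
Local Notation mu := (@lebesgue_measure R).
Local Open Scope ereal_scope.

Let affine (a b : R) (x : measurableTypeR R) : measurableTypeR R := (a * x + b)%R.

Let measurable_affine a b : measurable_fun setT (affine a b).
Proof.
apply: measurable_funD => //; apply: measurable_funM => //.
Qed.

Let pushforward_affine (a b : R) : {measure set (measurableTypeR R) -> \bar R}.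
Proof.
pose m : {measure set (measurableTypeR R) -> \bar R} := pushforward mu (affine a b).
exact: (m (measurable_affine a b)).
Defined.

Let affine_measure (a b : R) (a0 : (0 <= a)%R) : {measure set (measurableTypeR R) -> \bar R} :=
  mscale (NngNum a0) (pushforward_affine a b).

(** The rescaled image measure agrees with [mu] on the intervals ]c, d], and these determine
    Lebesgue measure. *)
Lemma lebesgue_measure_affine (a b : R) (a0 : (0 < a)%R) (A : set R) : measurable A ->
  mu A = a%:E * mu [set x | A (a * x + b)%R].
Proof.
move=> mA.
rewrite -[RHS]/(affine_measure b (ltW a0) A).
apply: lebesgue_measure_unique => // _ [[c d]] _ <-.
rewrite -[RHS]/(a%:E * mu (affine a b @^-1` `]c, d]%classic)).
have -> : affine a b @^-1` `]c, d]%classic = `]((c - b) / a)%R, ((d - b) / a)%R]%classic.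
  apply/seteqP; split=> x /=; rewrite /affine !in_itv/=.
    by rewrite ltr_pdivrMr// ler_pdivlMr// ltrBlDr lerBrDr mulrC.
  by rewrite ltr_pdivrMr// ler_pdivlMr// ltrBlDr lerBrDr mulrC.
rewrite !lebesgue_measure_itv/= !lte_fin ltr_pM2r ?invr_gt0// ltrD2r.
case: ifPn => _; last by rewrite mule0.
by rewrite -!EFinB -EFinM -mulrBl mulrCA divff ?gt_eqF// mulr1; congr (_%:E); lra.
Qed.

Lemma measurable_funV : measurable_fun [set: R] (@GRing.inv R).
Proof.
rewrite -(setvU [set 0%R]); apply/measurable_funU => //; first exact: measurableC.
split; last exact: measurable_fun_set1.
apply: open_continuous_measurable_fun.
  exact/closed_openC/accessible_closed_set1/hausdorff_accessible/Rhausdorff.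
by move=> x; rewrite inE/= => /eqP x0; exact: inv_continuous.
Qed.

Lemma ge0_integral_affine (a b : R) (D : set R) (f : R -> \bar R) : (0 < a)%R ->
  measurable D -> measurable_fun D f -> (forall x, D x -> 0 <= f x) ->
  \int[mu]_(x in D) f x =
  a%:E * \int[mu]_(x in [set x | D (a * x + b)%R]) f (a * x + b)%R.
Proof.
move=> a0 mD mf f0.
transitivity (\int[affine_measure b (ltW a0)]_(x in D) f x).
  apply: eq_measure_integral => A mA _.
  exact: (lebesgue_measure_affine b a0 mA).
rewrite ge0_integral_mscale//=; congr (_ * _).
rewrite (@ge0_integral_pushforward _ _ _ _ _ (affine a b))//.
by move=> x; rewrite inE => /f0.
Qed.

Lemma ge0_integral_scale (c : R) (f : R -> \bar R) : (0 < c)%R ->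
  measurable_fun (`]0%R, +oo[ : set R) f -> (forall x, (0 < x)%R -> 0 <= f x) ->
  \int[mu]_(x in `]0%R, +oo[) f x = c%:E * \int[mu]_(x in `]0%R, +oo[) f (c * x)%R.
Proof.
move=> c0 mf f0; rewrite (@ge0_integral_affine c 0 _ _ c0)//; last first.
  by move=> x; rewrite /= in_itv/= andbT; exact: f0.
congr (_ * _).
have -> : [set x : R | [set` `]0%R, +oo[%R] (c * x + 0)%R] = `]0%R, +oo[%classic.
  by apply/seteqP; split=> x; rewrite /= !in_itv/= !andbT addr0 pmulr_rgt0.
by apply: eq_integral => x _; rewrite addr0.
Qed.

Lemma ge0_integral_haar_scale (c : R) (f : R -> \bar R) : (0 < c)%R ->
  measurable_fun [set: R] f -> (forall x, (0 < x)%R -> 0 <= f x) ->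
  \int[mu]_(x in `]0%R, +oo[) (f (c * x)%R * (x^-1)%:E) =
  \int[mu]_(x in `]0%R, +oo[) (f x * (x^-1)%:E).
Proof.
move=> c0 mf f0; rewrite [RHS](@ge0_integral_scale c)//; last first.
- by move=> x x0; rewrite mule_ge0 ?f0// lee_fin invr_ge0 ltW.
- apply: measurable_funTS; apply: emeasurable_funM => //; apply/measurable_EFinP.
  exact: measurable_funV.
have m1 : measurable_fun (`]0%R, +oo[ : set R)
    (fun x => f (c * x)%R * ((c * x)^-1)%:E).
  apply: measurable_funTS; apply: emeasurable_funM.
    by apply: (measurableT_comp mf); exact: measurable_funM.
  apply/measurable_EFinP; apply: (measurableT_comp measurable_funV).
  exact: measurable_funM.
rewrite -ge0_integralZl//; last 2 first.
- move=> x; rewrite /= in_itv/= andbT => x0.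
  by rewrite mule_ge0 ?f0 ?mulr_gt0// lee_fin invr_ge0 mulr_ge0// ltW.
- by rewrite lee_fin ltW.
apply: eq_integral => x; rewrite inE/= in_itv/= andbT => x0.
by rewrite muleCA -EFinM invfM mulrA divff ?gt_eqF// mul1r.
Qed.

(** Multiplication by the indicator of the open quadrant reduces this to Tonelli on the whole
    plane. *)
Lemma ge0_tonelli_pos (h : R * R -> \bar R) :
  measurable_fun setT h -> (forall x, 0 <= h x) ->
  \int[mu]_(x in `]0%R, +oo[) \int[mu]_(y in `]0%R, +oo[) h (x, y) =
  \int[mu]_(y in `]0%R, +oo[) \int[mu]_(x in `]0%R, +oo[) h (x, y).
Proof.
move=> mh h0; set P : set R := `]0%R, +oo[%classic.
have mP : measurable P by exact: measurable_itv.
pose k (z : R * R) := h z * ((\1_P z.1) * (\1_P z.2))%:E.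
have k0 z : 0 <= k z by rewrite mule_ge0// lee_fin mulr_ge0.
have mk : measurable_fun setT k.
  apply: emeasurable_funM => //; apply/measurable_EFinP; apply: measurable_funM.
    exact: (measurableT_comp (measurable_indic mP) measurable_fst).
  exact: (measurableT_comp (measurable_indic mP) measurable_snd).
have := @fubini_tonelli _ _ _ _ _ mu mu k mk k0.
have E1 : \int[mu]_x \int[mu]_y k (x, y) =
    \int[mu]_(x in P) \int[mu]_(y in P) h (x, y).
  rewrite [RHS]integral_mkcond; apply: eq_integral => x _; rewrite patchE.
  rewrite /k /= indicE; case: ifPn => xP.
    rewrite [RHS]integral_mkcond; apply: eq_integral => y _; rewrite patchE indicE.
    by case: ifPn; rewrite ?mulr1 ?mulr0 ?mule1 ?mule0.
  by under eq_integral do rewrite mul0r mule0; rewrite integral0.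
have E2 : \int[mu]_y \int[mu]_x k (x, y) =
    \int[mu]_(y in P) \int[mu]_(x in P) h (x, y).
  rewrite [RHS]integral_mkcond; apply: eq_integral => y _; rewrite patchE.
  have ky x : k (x, y) = h (x, y) * ((\1_P x) * (y \in P)%:R)%:E.
    by rewrite /k /= [\1_P y]indicE.
  under eq_integral do rewrite ky.
  case: ifPn => yP.
    rewrite [RHS]integral_mkcond; apply: eq_integral => x _; rewrite patchE indicE.
    by case: ifPn; rewrite ?mulr1 ?mul0r ?mule1 ?mule0.
  by under eq_integral do rewrite mulr0 mule0; rewrite integral0.
by rewrite E1 E2.
Qed.

Lemma integral_expR (c : R) : (0 < c)%R ->
  \int[mu]_(x in `]0%R, +oo[) (expR (- c * x))%:E = (c^-1)%:E.
Proof.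
move=> c0.
have mE : measurable_fun [set: R] (fun x => expR (- c * x)).
  by apply: (measurableT_comp (@measurable_expR R)); exact: measurable_funM.
have E0 x : 0 <= (expR (- c * x))%:E by rewrite lee_fin expR_ge0.
rewrite integral_itv_obnd_cbnd; last exact/measurable_funTS/measurable_EFinP.
have : c%:E * \int[mu]_(x in `[0%R, +oo[) (expR (- c * x))%:E = 1.
  rewrite -(integral_exponential_pdf c0) -ge0_integralZl//; last 2 first.
  - exact/measurable_funTS/measurable_EFinP.
  - by rewrite lee_fin ltW.
  rewrite [LHS]integral_mkcond; apply: eq_integral => x _.
  by rewrite /exponential_pdf !patchE; case: ifP.
move=> /(congr1 (fun x => (c^-1)%:E * x)).
by rewrite muleA -EFinM mulVf ?gt_eqF// mul1e mule1.
Qed.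

(* Uniqueness of Haar measure on ]0, +oo[: multiply by the integral 1 of exp(-x) and use
   Tonelli together with the invariance of dx/x under scaling. *)
Lemma ge0_integral_haar_inv (g : R -> \bar R) :
  measurable_fun [set: R] g -> (forall x, 0 <= g x) ->
  \int[mu]_(x in `]0%R, +oo[) (g x^-1%R * (x^-1)%:E) =
  \int[mu]_(x in `]0%R, +oo[) (g x * (x^-1)%:E).
Proof.
move=> mg g0; set P : set R := `]0%R, +oo[%classic.
have mP : measurable P by exact: measurable_itv.
have Pgt x : P x -> (0 < x)%R by rewrite /P/= in_itv/= andbT.
(* On ]0, +oo[ the measure h(x) dx/x is exp(-x) dx, of total mass c = 1; the absolute value keeps h
   nonnegative on the whole line. *)
pose h x := (`|x| * expR (- x))%:E : \bar R.
have h0 x : 0 <= h x by rewrite lee_fin mulr_ge0 ?expR_ge0.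
have mh : measurable_fun [set: R] h.
  apply/measurable_EFinP; apply: measurable_funM; first exact: normr_measurable.
  by apply: (measurableT_comp (@measurable_expR R)); exact: oppr_measurable.
have mV := measurable_funV.
have mVe : measurable_fun [set: R] (fun x : R => (x^-1)%:E) by exact/measurable_EFinP.
have mgV : measurable_fun [set: R] (fun x : R => g x^-1%R) by exact: (measurableT_comp mg mV).
pose c := \int[mu]_(x in P) (h x * (x^-1)%:E).
have c1 : c = 1.
  have -> : c = \int[mu]_(x in P) (expR (- 1 * x))%:E.
    apply: eq_integral => x; rewrite inE => /Pgt x0.
    rewrite /h -EFinM gtr0_norm// mulrAC divff ?gt_eqF// mul1r mulN1r//.
  by rewrite integral_expR// invr1.
have iV (x : R) : (0 < x)%R -> 0 <= (x^-1)%:E by move=> x0; rewrite lee_fin invr_ge0 ltW.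
have m2 (f : R -> R -> \bar R) : measurable_fun setT (fun z : R * R => f z.1 z.2) ->
  (forall x y, 0 <= f x y) ->
  \int[mu]_(x in P) \int[mu]_(y in P) (f x y * (`|x|^-1)%:E * (`|y|^-1)%:E) =
  \int[mu]_(y in P) \int[mu]_(x in P) (f x y * (`|x|^-1)%:E * (`|y|^-1)%:E).
  move=> mf f0.
  have := @ge0_tonelli_pos (fun z => f z.1 z.2 * (`|z.1|^-1)%:E * (`|z.2|^-1)%:E).
  apply.
    have mVn : measurable_fun [set: R] (fun x : R => (`|x|^-1)%:E).
      by apply/measurable_EFinP; apply: (measurableT_comp mV); exact: normr_measurable.
    apply: emeasurable_funM; first apply: emeasurable_funM => //.
      exact: (measurableT_comp mVn measurable_fst).
    exact: (measurableT_comp mVn measurable_snd).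
  by move=> z; rewrite !mule_ge0// lee_fin.
(* The factor c = 1 is inserted at each x as the integral of h(t x) dt/t, by scaling invariance. *)
transitivity (\int[mu]_(x in P) \int[mu]_(t in P)
    (g x^-1%R * h (t * x)%R * (`|x|^-1)%:E * (`|t|^-1)%:E)).
  apply: eq_integral => x; rewrite inE => /Pgt x0.
  rewrite -[LHS]mule1 -c1 /c -(ge0_integral_haar_scale x0 mh (fun y _ => h0 y)).
  rewrite -ge0_integralZl//; last 3 first.
  - apply: measurable_funTS; apply: emeasurable_funM => //.
    by apply: (measurableT_comp mh); exact: measurable_funM.
  - by move=> t /Pgt t0; rewrite mule_ge0// iV.
  - by rewrite mule_ge0// iV.
  apply: eq_integral => t; rewrite inE => /Pgt t0.
  by rewrite !gtr0_norm// [(t * x)%R]mulrC -!muleA; congr (_ * _); rewrite muleCA.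
rewrite m2; last 2 first.
- apply: emeasurable_funM; first exact: (measurableT_comp mgV measurable_fst).
  apply: (measurableT_comp mh); exact: measurable_funM.
- by move=> x t; rewrite mule_ge0.
have mgt (t : R) : measurable_fun [set: R] (fun x : R => g (t / x)%R * h x).
  apply: emeasurable_funM => //; apply: (measurableT_comp mg).
  exact: measurable_funM.
(* For fixed t, scaling x by t turns h(t x) into h(x) and g(1/x) into g(t/x). *)
transitivity (\int[mu]_(t in P) \int[mu]_(x in P)
    (g (t / x)%R * h x * (`|t|^-1)%:E * (`|x|^-1)%:E)).
  apply: eq_integral => t; rewrite inE => /Pgt t0.
  transitivity ((t^-1)%:E * \int[mu]_(x in P) (g (t / (t * x))%R * h (t * x)%R * (x^-1)%:E)).
    rewrite -ge0_integralZl//; last 3 first.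
    - apply: measurable_funTS; apply: emeasurable_funM => //.
      by apply: (measurableT_comp (mgt t)); exact: measurable_funM.
    - by move=> x /Pgt x0; rewrite !mule_ge0// iV.
    - exact: iV.
    apply: eq_integral => x; rewrite inE => /Pgt x0.
    rewrite !gtr0_norm// invfM mulrA divff ?gt_eqF// mul1r.
    by rewrite muleC.
  rewrite (@ge0_integral_haar_scale t (fun x => g (t / x)%R * h x))//; last first.
    by move=> x _; rewrite mule_ge0.
  rewrite -ge0_integralZl//; last 3 first.
  - exact: measurable_funTS (emeasurable_funM (mgt t) mVe).
  - by move=> x /Pgt x0; rewrite !mule_ge0// iV.
  - exact: iV.
  apply: eq_integral => x; rewrite inE => /Pgt x0.
  by rewrite !gtr0_norm// muleC -!muleA [X in _ * (_ * X)]muleC.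
rewrite (m2 (fun t x => g (t / x)%R * h x)); last 2 first.
- apply: emeasurable_funM; last exact: (measurableT_comp mh measurable_snd).
  apply: (measurableT_comp mg); apply: measurable_funM => //.
  exact: (measurableT_comp mV measurable_snd).
- by move=> x t; rewrite mule_ge0.
(* For fixed x, scaling t by x turns g(t/x) into g(t), and the integral of h(x) dx/x splits off. *)
transitivity (\int[mu]_(x in P) (\int[mu]_(t in P) (g t * (t^-1)%:E) * (h x * (x^-1)%:E))).
  apply: eq_integral => x; rewrite inE => /Pgt x0.
  rewrite -(@ge0_integral_haar_scale x^-1 g) ?invr_gt0//.
  rewrite -ge0_integralZr//; last 3 first.
  - apply: measurable_funTS; apply: emeasurable_funM => //.
    by apply: (measurableT_comp mg); exact: measurable_funM.
  - by move=> t /Pgt t0; rewrite !mule_ge0// iV.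
  - by rewrite mule_ge0// iV.
  apply: eq_integral => t; rewrite inE => /Pgt t0.
  by rewrite !gtr0_norm// [(x^-1 * t)%R]mulrC -!muleA; congr (_ * _); rewrite muleCA.
rewrite ge0_integralZl//; last 3 first.
- exact: measurable_funTS (emeasurable_funM mh mVe).
- by move=> x /Pgt x0; rewrite !mule_ge0// iV.
- by apply: integral_ge0 => x /Pgt x0; rewrite !mule_ge0// iV.
by rewrite -/c c1 mule1.
Qed.

End ChangeOfVariables.

(** * Rapidly decaying functions and Mellin transforms *)

Section RapidDecay.
Context {R : realType}.
Local Notation mu := (@lebesgue_measure R).
Local Notation posR := (`]0%R, +oo[%classic : set R).
Implicit Types (phi : R -> R[i]) (x c : R).

(** With negative c this is the growth weight of the entries of f. Growth and decay cancel through
    [decayM], and the symmetry in x and 1/x suits the functional equation. *)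
Definition decay c x : R := expR (- (c * (x + x^-1))).

Lemma decay_ge0 c x : 0 <= decay c x. Proof. exact: expR_ge0. Qed.

Lemma decayM c d x : decay c x * decay d x = decay (c + d) x.
Proof. by rewrite /decay -expRD -opprD -mulrDl. Qed.

Lemma decayV c x : decay c x^-1 = decay c x.
Proof. by rewrite /decay invrK addrC. Qed.

Lemma measurable_decay c : measurable_fun [set: R] (decay c).
Proof.
apply: (measurableT_comp (@measurable_expR R)).
apply: (measurableT_comp (@oppr_measurable R setT)).
apply: measurable_funM => //; apply: measurable_funD => //.
exact: measurable_funV.
Qed.

Lemma posRP x : posR x = (0 < x) :> Prop.
Proof. by rewrite /= in_itv/= andbT. Qed.

Lemma measurable_posR : measurable posR.
Proof. exact: measurable_itv. Qed.

Lemma integrableZ_EFin (D : set R) (r : R) (f : R -> R) : measurable D ->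
  mu.-integrable D (EFin \o f) -> mu.-integrable D (EFin \o (fun x => r * f x)).
Proof.
move=> mD fi.
by rewrite (_ : _ \o _ = (fun x => r%:E * (EFin \o f) x)%E)//; exact: integrableZl.
Qed.

Lemma integrable_expR c : 0 < c ->
  mu.-integrable posR (fun x => (expR (- c * x))%:E).
Proof.
move=> c0; apply/integrableP; split.
  apply/measurable_funTS/measurable_EFinP.
  by apply: (measurableT_comp (@measurable_expR R)); exact: measurable_funM.
under eq_integral do rewrite gee0_abs ?lee_fin ?expR_ge0//.
by rewrite integral_expR// ltry.
Qed.

Lemma integrable_decay c : 0 < c -> mu.-integrable posR (EFin \o decay c).
Proof.
move=> c0; apply: le_integrable (integrable_expR c0).
- exact: measurable_posR.
- by apply/measurable_funTS/measurable_EFinP; exact: measurable_decay.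
- move=> x; rewrite posRP => x0 /=; rewrite lee_fin !ger0_norm ?expR_ge0//.
  by rewrite ler_expR mulNr lerN2 ler_wpM2l ?(ltW c0)// lerDl invr_ge0 ltW.
Qed.

(** Apply 1 + ln t <= t to t = eta x and to t = eta / x. *)
Lemma norm_ln_le (eta x : R) : 0 < eta -> 0 < x ->
  `|ln x| <= eta * (x + x^-1) + `|ln eta|.
Proof.
move=> e0 x0; have xV : 0 < x^-1 by rewrite invr_gt0.
have H y : 0 < y -> ln y <= eta * y - ln eta.
  move=> y0; rewrite lerBrDl -lnM ?posrE//.
  have ey : 0 < eta * y by rewrite mulr_gt0.
  have := expR_ge1Dx (ln (eta * y)); rewrite lnK ?posrE//; lra.
have := H _ x0; have := H _ xV; rewrite lnV ?posrE// => h1 h2.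
have h3 := ler_norm (- ln eta); rewrite normrN in h3.
have := mulr_gt0 e0 x0; have := mulr_gt0 e0 xV => h4 h5.
by rewrite ler_norml mulrDr; lra.
Qed.

(** The left side dominates x^b for every real b with |b| <= a, so powers of x cost an arbitrarily
    small exponential rate, at +oo and at 0 alike. *)
Lemma exp_ln_le (a d : R) : 0 <= a -> 0 < d -> exists2 K, 0 < K &
  forall x, 0 < x -> expR (a * `|ln x|) <= K * decay (- d) x.
Proof.
(* This gives a * eta <= d; the 1 in the denominator covers a = 0. *)
move=> a0 d0; pose eta := d / (a + 1).
have e0 : 0 < eta by rewrite divr_gt0// ltr_wpDl.
exists (expR (a * `|ln eta|)); first exact: expR_gt0.
move=> x x0; rewrite /decay -expRD ler_expR mulNr opprK.
have := norm_ln_le e0 x0 => /(ler_wpM2l a0) /le_trans; apply.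
have aed : a * eta <= d.
  by rewrite /eta mulrA ler_pdivrMr ?ltr_wpDl// mulrC ler_wpM2l ?(ltW d0)// lerDl.
rewrite mulrDr addrC lerD2l mulrA ler_wpM2r// addr_ge0// ?invr_ge0 ltW//.
Qed.

Lemma powR_le_exp_ln x a : 0 < x -> powR x a <= expR (`|a| * `|ln x|).
Proof.
by move=> x0; rewrite /powR gt_eqF// ler_expR -normrM ler_norm.
Qed.

Definition rapid c phi := exists C, forall x, 0 < x -> cnorm (phi x) <= C * decay c x.

Lemma rapidP c phi : rapid c phi ->
  exists2 C, 0 <= C & forall x, 0 < x -> cnorm (phi x) <= C * decay c x.
Proof.
move=> [C HC]; exists `|C| => // x x0; apply: le_trans (HC x x0) _.
by rewrite ler_wpM2r ?decay_ge0// ler_norm.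
Qed.

Lemma rapid_compV c phi : rapid c phi -> rapid c (fun x => phi x^-1).
Proof.
by move=> [C HC]; exists C => x x0; rewrite -decayV HC// invr_gt0.
Qed.

Lemma rapid_cpow c d (s : R[i]) phi : d < c -> rapid c phi ->
  rapid d (fun x => phi x * cpow x%:C s).
Proof.
move=> dc /rapidP[C C0 HC].
have cd0 : 0 < c - d by rewrite subr_gt0.
have [K K0 HK] := exp_ln_le (normr_ge0 (Re s)) cd0.
exists (C * K) => x x0; rewrite cnormM cnorm_cpow_real//.
have -> : decay d x = decay c x * decay (- (c - d)) x.
  by rewrite decayM opprB addrC subrK.
rewrite mulrACA ler_pM ?cnorm_ge0 ?powR_ge0 ?HC//.
by rewrite (le_trans (powR_le_exp_ln _ x0))// HK.
Qed.

Lemma rapid_twist c d (s : R[i]) phi : d < c -> rapid c phi -> rapid d (twist phi s).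
Proof. exact: rapid_cpow. Qed.

(** The half-line is divided into x >= Z, 1/x >= Z and a compact rest on which phi is bounded. In
    the outer ranges the smaller of x and 1/x is at most 1, so replacing the one-sided exponential
    by [decay] costs only a factor exp c. *)
Lemma rapid_of_decay c phi : 0 <= c -> piecewise_smooth phi ->
  little_o_pinfty phi (fun x => expR (- (c * x))) ->
  little_o_pinfty (fun x => phi x^-1) (fun x => expR (- (c * x))) ->
  rapid c phi.
Proof.
move=> c0 sphi /(_ 1 ltr01)[X [_ HX]] /(_ 1 ltr01)[Y [_ HY]].
pose Z := `|X| + `|Y| + 1.
have Z1 : 1 <= Z by rewrite lerDr addr_ge0.
have Z0 : 0 < Z by apply: lt_le_trans Z1.
have XZ : X < Z by rewrite /Z; have := ler_norm X; have := normr_ge0 Y; lra.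
have YZ : Y < Z by rewrite /Z; have := ler_norm Y; have := normr_ge0 X; lra.
have ZV0 : 0 < Z^-1 by rewrite invr_gt0.
have [M HM] := piecewise_smooth_bounded Z sphi ZV0.
have far y (w : R[i]) : Z <= y -> cnorm w <= 1 * expR (- (c * y)) ->
    cnorm w <= expR c * decay c y.
  move=> Zy /le_trans; apply; rewrite mul1r -expRD ler_expR mulrDr.
  have y1 : y^-1 <= 1 by rewrite invf_le1 ?(lt_le_trans Z0)// (le_trans Z1).
  have : c * y^-1 <= c * 1 by rewrite ler_wpM2l.
  by lra.
exists (expR c + `|M| * expR (c * (Z + Z))) => x x0.
have xV0 : 0 < x^-1 by rewrite invr_gt0.
have pos1 : 0 <= `|M| * expR (c * (Z + Z)) * decay c x.
  by rewrite !mulr_ge0 ?expR_ge0.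
have pos2 : 0 <= expR c * decay c x by rewrite mulr_ge0 ?expR_ge0.
rewrite mulrDl.
have [Zx|xZ] := leP Z x.
  have := far x (phi x) Zx (HX x (lt_le_trans XZ Zx)); lra.
have [Zx|xZ'] := leP Z x^-1.
  have := far _ (phi x^-1^-1) Zx (HY _ (lt_le_trans YZ Zx)).
  by rewrite decayV invrK; lra.
have : cnorm (phi x) <= M.
  apply: HM; rewrite (ltW xZ) andbT -[leRHS]invrK lef_pV2 ?posrE//.
  exact: ltW.
have : `|M| <= `|M| * expR (c * (Z + Z)) * decay c x.
  rewrite -mulrA ler_peMr// -expRD -[leLHS]expR0 ler_expR.
  by rewrite -mulrBr mulr_ge0// subr_ge0 lerD// ltW.
have := ler_norm M; lra.
Qed.

Lemma rapid_cintegrable c phi : 0 < c -> cmeasurable posR phi -> rapid c phi ->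
  cintegrable posR phi.
Proof.
move=> c0 mphi [C HC].
apply: (@cintegrable_dominated _ _ _ phi (fun x => C * decay c x)) => //.
- by move=> x; rewrite posRP => /HC.
- exact/integrableZ_EFin/integrable_decay.
Qed.

Lemma piecewise_smooth_cpow (s : R[i]) : piecewise_smooth (fun x : R => cpow x%:C s).
Proof.
exists set0; split=> [a b a0|p q p0 pq _]; first by rewrite set0I.
exists (fun x : R => cpow x%:C s), 0, (q + 1); split=> //; first by rewrite ltrDl.
exact: smooth_on_cpow.
Qed.

Lemma cmeasurable_cpow (s : R[i]) : cmeasurable posR (fun x : R => cpow x%:C s).
Proof. exact/piecewise_smooth_measurable/piecewise_smooth_cpow. Qed.

(* The derivative is the Mellin transform of phi x * ln x; the remainder is controlled by
   the second-order Taylor estimate for the exponential. *)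
Lemma mellin_entire c phi : 0 < c -> cmeasurable posR phi -> rapid c phi ->
  entire (fun s => cintegral posR (twist phi s)).
Proof.
move=> c0 mphi rphi s.
have [C C0 HC] := rapidP rphi.
have c2 : 0 < c / 2 by rewrite divr_gt0.
have cc2 : c / 2 < c by lra.
have mtw (t : R[i]) : cmeasurable posR (twist phi t).
  by apply: cmeasurableM => //; exact: cmeasurable_cpow.
have itw (t : R[i]) : cintegrable posR (twist phi t).
  by apply: (@rapid_cintegrable (c / 2)) => //; exact: rapid_twist rphi.
(* One unit of the 2 absorbs the powers of |ln x|, the other absorbs exp(|h| |ln x|) for |h| <=
   1. *)
pose a := `|Re (s - 1)| + 2.
have a0 : 0 <= a by rewrite addr_ge0.
have [K K0 HK] := exp_ln_le a0 c2.
have ln1 (x : R) : `|ln x| <= expR `|ln x| by have := expR_ge1Dx `|ln x|; lra.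
have ln2 (x : R) : `|ln x| ^+ 2 <= 2 * expR `|ln x|.
  have := @expR_ge1Dxn R `|ln x| 1 (normr_ge0 _); rewrite [2`!%:R](_ : _ = 2)//; lra.
have pw x : 0 < x -> cnorm (cpow x%:C (s - 1)) * expR (2 * `|ln x|) <= expR (a * `|ln x|).
  move=> x0; have -> : expR (a * `|ln x|) = expR (`|Re (s - 1)| * `|ln x|) * expR (2 * `|ln x|).
    by rewrite -expRD -mulrDl.
  rewrite cnorm_cpow_real//; apply: ler_wpM2r; first exact: expR_ge0.
  exact: powR_le_exp_ln.
have bd x : 0 < x -> cnorm (phi x) * expR (a * `|ln x|) <= C * K * decay (c / 2) x.
  move=> x0; have -> : decay (c / 2) x = decay c x * decay (- (c / 2)) x.
    by rewrite decayM (_ : c - c / 2 = c / 2)//; lra.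
  by rewrite mulrACA ler_pM ?cnorm_ge0 ?expR_ge0 ?HC ?HK.
pose psi x := twist phi s x * (ln x)%:C.
have mln : cmeasurable posR (fun x : R => (ln x)%:C).
  by split=> /=; [apply: measurable_funTS; exact: measurable_ln|exact: measurable_cst].
have mpsi : cmeasurable posR psi by exact: cmeasurableM.
have ipsi : cintegrable posR psi.
  apply: (@rapid_cintegrable (c / 2)) => //; exists (C * K) => x x0.
  apply: le_trans (bd x x0); rewrite /psi /twist !cnormM cnorm_real -mulrA.
  rewrite ler_wpM2l ?cnorm_ge0// (le_trans _ (pw x x0))// ler_wpM2l ?cnorm_ge0//.
  by rewrite (le_trans (ln1 x))// ler_expR ler_peMl// ler1n.
(* The factor 20 is 5 from [cexp_taylor2], times 2 from [ln2], times 2 from [cnorm_cintegral_le]. *)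
pose B := 20 * (C * K * \int[mu]_(x in posR) decay (c / 2) x).
have iB : mu.-integrable posR (EFin \o decay (c / 2)) by exact: integrable_decay.
have B0 : 0 <= B by rewrite !mulr_ge0 ?(ltW K0)// Rintegral_ge0// => x _; exact: decay_ge0.
have main (h : R[i]) : h != 0 -> cnorm h <= 1 ->
    cnorm (cintegral posR psi - h^-1 * (cintegral posR (twist phi (h + s)) -
      cintegral posR (twist phi s))) <= B * cnorm h.
  move=> h0 h1; have nh0 := cnorm_gt0 h0.
  pose rem x := twist phi s x * (h^-1 * (cexp ((ln x)%:C * h) - 1 - (ln x)%:C * h)).
  have remE x : 0 < x -> rem x = h^-1 * twist phi (h + s) x + (- h^-1) * twist phi s x
      + (-1) * psi x.
    move=> x0; rewrite /rem /psi /twist.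
    have -> : cpow x%:C (h + s - 1) = cexp ((ln x)%:C * h) * cpow x%:C (s - 1).
      by rewrite !cpow_real// -cexpD -mulrDr addrA.
    set u := cexp _; set p := cpow _ _.
    have -> : h^-1 * (u - 1 - (ln x)%:C * h) = h^-1 * u - h^-1 - (ln x)%:C.
      by rewrite !mulrBr mulr1 mulrCA mulVf// mulr1.
    ring.
  have i1 : cintegrable posR (fun x => h^-1 * twist phi (h + s) x).
    by apply: cintegrableZl => //; exact: itw.
  have i2 : cintegrable posR (fun x => - h^-1 * twist phi s x).
    by apply: cintegrableZl => //; exact: itw.
  have i3 : cintegrable posR (fun x => -1 * psi x) by exact: cintegrableZl.
  have i12 : cintegrable posR (fun x => h^-1 * twist phi (h + s) x + - h^-1 * twist phi s x).
    exact: cintegrableD.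
  have E : cintegral posR psi - h^-1 * (cintegral posR (twist phi (h + s)) -
      cintegral posR (twist phi s)) = - cintegral posR rem.
    have -> : cintegral posR rem = cintegral posR (fun x => (h^-1 * twist phi (h + s) x +
        - h^-1 * twist phi s x) + -1 * psi x).
      by apply: eq_cintegral => x; rewrite posRP => /remE.
    rewrite cintegralD// cintegralD// !cintegralZl//; try exact: itw.
    ring.
  rewrite E cnormN.
  have dom x : posR x -> cnorm (rem x) <= 10 * cnorm h * (C * K) * decay (c / 2) x.
    rewrite posRP => x0; rewrite /rem /twist !cnormM -!mulrA.
    have nn := cnorm_ge0 h.
    set w := (ln x)%:C * h.
    have nw : cnorm w = `|ln x| * cnorm h by rewrite cnormM cnorm_real.
    have q1 : cnorm (cexp w - 1 - w) <= 10 * cnorm h * cnorm h * expR (2 * `|ln x|).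
      apply: le_trans (cexp_taylor2 w) _; rewrite nw exprMn.
      have e1 : expR (`|ln x| * cnorm h) <= expR `|ln x| by rewrite ler_expR ler_piMr.
      have -> : 2 * `|ln x| = `|ln x| + `|ln x| by lra.
      rewrite expRD.
      have -> : 10 * cnorm h * cnorm h * (expR `|ln x| * expR `|ln x|) =
        5 * (2 * expR `|ln x| * cnorm h ^+ 2) * expR `|ln x| by ring.
      have hh : 0 <= cnorm h ^+ 2 by exact: sqr_ge0.
      have ll : 0 <= `|ln x| ^+ 2 by exact: sqr_ge0.
      apply: ler_pM => //; first by rewrite mulr_ge0// mulr_ge0.
      by rewrite ler_wpM2l// ler_wpM2r.
    have q2 : cnorm h^-1 * cnorm (cexp w - 1 - w) <= 10 * cnorm h * expR (2 * `|ln x|).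
      rewrite cnormV mulrC ler_pdivrMr//; apply: le_trans q1 _.
      by rewrite -!mulrA [cnorm h * expR _]mulrC.
    apply: (@le_trans _ _ (cnorm (phi x) * (cnorm (cpow x%:C (s - 1)) *
        (10 * cnorm h * expR (2 * `|ln x|))))).
      by rewrite ler_wpM2l ?cnorm_ge0// ler_wpM2l ?cnorm_ge0.
    have -> : cnorm (phi x) * (cnorm (cpow x%:C (s - 1)) * (10 * cnorm h * expR (2 * `|ln x|)))
      = 10 * (cnorm h * (cnorm (phi x) * (cnorm (cpow x%:C (s - 1)) * expR (2 * `|ln x|)))) by ring.
    rewrite [C * (K * _)]mulrA; apply: ler_wpM2l => //; apply: ler_wpM2l => //.
    apply: le_trans (bd x x0).
    by rewrite ler_wpM2l ?cnorm_ge0// pw.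
  have irem : cintegrable posR rem.
    apply: (@eq_cintegrable _ _ measurable_posR (fun x => (h^-1 * twist phi (h + s) x +
      - h^-1 * twist phi s x) + -1 * psi x)); first by move=> x; rewrite posRP => /remE ->.
    exact: cintegrableD.
  apply: le_trans (cnorm_cintegral_le measurable_posR irem dom _) _.
    exact: integrableZ_EFin.
  rewrite RintegralZl//.
  rewrite (_ : B * cnorm h =
    2 * (10 * cnorm h * (C * K) * \int[mu]_(x in posR) decay (c / 2) x))//.
  by rewrite /B; ring.
apply/cvg_ex; exists (cintegral posR psi : R[i]); apply/cvgrPdist_le => e e0.
(* The radius e is a positive element of R[i], hence real. *)
have [er ee] : exists er : R, e = er%:C.
  by exists (Re e); case: e e0 => er ei /=; rewrite ltcE /= => /andP[/eqP -> _].
rewrite ee ltcR in e0.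
near=> h.
rewrite /= [h%:A]mulr1 -[_ *: _]/(_ * _) normcC ee lecR.
have h0 : h != 0 by near: h; exact: nbhs_dnbhs_neq.
have hlt : cnorm h <= Num.min 1 (er / (B + 1)).
  rewrite -lecR -normcC; near: h; apply: dnbhs0_le.
  by rewrite ltcR lt_min ltr01 divr_gt0// ltr_wpDl.
move: hlt; rewrite le_min => /andP[h1 h2].
apply: le_trans (main h h0 h1) _.
move: h2; rewrite ler_pdivlMr ?ltr_wpDl// => /(le_trans _); apply.
by rewrite mulrC ler_wpM2l ?cnorm_ge0// lerDl.
Unshelve. all: by end_near.
Qed.

End RapidDecay.

(** * The incomplete gamma function *)

Section IncompleteGamma.
Context {R : realType}.
Local Notation mu := (@lebesgue_measure R).
Local Notation posR := (`]0%R, +oo[%classic : set R).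
Variable k : R.
Implicit Types (b t w y : R).

Lemma ge0_integralZ_posR (c : R) (f : R -> R) : 0 <= c ->
  measurable_fun [set: R] f -> (forall t, 0 < t -> 0 <= f t) ->
  (c%:E * \int[mu]_(t in posR) (f t)%:E = \int[mu]_(t in posR) (c * f t)%:E)%E.
Proof.
move=> c0 mf f0; under [RHS]eq_integral do rewrite EFinM.
rewrite ge0_integralZl//.
- exact/measurable_funTS/measurable_EFinP.
- by move=> t; rewrite posRP => /f0; rewrite lee_fin.
Qed.

(** For b = 4 pi |n + kappa_j| x this is the integrand in t that L_f pairs with phi(x) x^(1-k). *)
Definition gamma_kernel b t : R := expR (- (b / 2 * (2 * t + 1))) * (powR (1 + t) k)^-1.

Definition gamma_tail b : R := \int[mu]_(t in posR) gamma_kernel b t.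

Lemma gamma_kernel_ge0 b t : 0 <= gamma_kernel b t.
Proof. by rewrite mulr_ge0 ?expR_ge0// invr_ge0 powR_ge0. Qed.

Lemma measurable_powRV : measurable_fun [set: R] (fun t => (powR (1 + t) k)^-1).
Proof.
apply: (measurableT_comp (@measurable_funV R)).
apply: (measurableT_comp (@measurable_powR R k)).
exact: measurable_funD.
Qed.

Lemma measurable_gamma_kernel b : measurable_fun [set: R] (gamma_kernel b).
Proof.
apply: measurable_funM; last exact: measurable_powRV.
apply: (measurableT_comp (@measurable_expR R)).
apply: (measurableT_comp (@oppr_measurable R setT)).
by apply: measurable_funM => //; apply: measurable_funD => //; exact: measurable_funM.
Qed.

Lemma gamma_kernel_le b : 0 < b ->
  exists2 K, 0 <= K & forall t, 0 < t -> gamma_kernel b t <= K * expR (- (b / 2) * t).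
Proof.
(* The exponent decreases at rate b in t; half of this rate absorbs the power of 1 + t. *)
move=> b0; pose eta := b / 2 / (`|k| + 1).
have kp : 0 < `|k| + 1 by rewrite ltr_wpDl.
have e0 : 0 < eta by rewrite !divr_gt0.
exists (expR (`|k| * `|ln eta|)); first exact: expR_ge0.
move=> t t0; have t1 : 0 < 1 + t by rewrite addr_gt0.
rewrite /gamma_kernel -powRN -expRD.
have h1 : powR (1 + t) (- k) <= expR (`|k| * ln (1 + t)).
  apply: le_trans (powR_le_exp_ln _ t1) _; rewrite normrN (@ger0_norm _ (ln _))//.
  by rewrite ln_ge0// lerDl ltW.
have h2 : ln (1 + t) <= eta * (1 + t) + `|ln eta|.
  have et : 0 < eta * (1 + t) by rewrite mulr_gt0.
  have := expR_ge1Dx (ln (eta * (1 + t))); rewrite lnK ?posrE// lnM ?posrE//.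
  by have := ler_norm (- ln eta); rewrite normrN; lra.
have h3 : `|k| * eta <= b / 2.
  rewrite /eta mulrA ler_pdivrMr// mulrC ler_wpM2l ?lerDl//.
  by rewrite divr_ge0// ltW.
apply: (@le_trans _ _ (expR (- (b / 2 * (2 * t + 1))) * expR (`|k| * ln (1 + t)))).
  by rewrite ler_wpM2l ?expR_ge0.
rewrite -expRD ler_expR.
have h4 : `|k| * ln (1 + t) <= b / 2 * (1 + t) + `|k| * `|ln eta|.
  apply: le_trans (ler_wpM2l (normr_ge0 k) h2) _.
  by rewrite mulrDr mulrA lerD2r ler_wpM2r// ltW.
nra.
Qed.

Lemma integrable_gamma_kernel b : 0 < b ->
  mu.-integrable posR (EFin \o gamma_kernel b).
Proof.
move=> b0; have [K K0 HK] := gamma_kernel_le b0.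
have b2 : 0 < b / 2 by rewrite divr_gt0.
have := integrableZ_EFin K measurable_posR (integrable_expR b2).
apply: le_integrable.
- exact: measurable_posR.
- by apply/measurable_funTS/measurable_EFinP; exact: measurable_gamma_kernel.
- move=> t; rewrite posRP => t0 /=; rewrite lee_fin !ger0_norm.
    exact: HK.
  by rewrite mulr_ge0// expR_ge0.
exact: gamma_kernel_ge0.
Qed.

Lemma gamma_tail_ge0 b : 0 <= gamma_tail b.
Proof. by apply: Rintegral_ge0 => t _; exact: gamma_kernel_ge0. Qed.

(** Since 2 t + 1 >= 1, passing from b to c gains at least exp(-(c - b) / 2) under the integral. *)
Lemma gamma_tail_le b c : 0 < b -> b <= c ->
  gamma_tail c <= expR (- ((c - b) / 2)) * gamma_tail b.
Proof.
move=> b0 bc; have c0 := lt_le_trans b0 bc.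
rewrite -RintegralZl; [|exact: measurable_posR|exact: integrable_gamma_kernel].
apply: le_Rintegral.
- exact: measurable_posR.
- exact: integrable_gamma_kernel.
- by apply: integrableZ_EFin; [exact: measurable_posR|exact: integrable_gamma_kernel].
move=> t; rewrite posRP => t0; rewrite /gamma_kernel mulrA ler_wpM2r ?invr_ge0 ?powR_ge0//.
rewrite -expRD ler_expR; nra.
Qed.

Lemma EFin_gamma_tail b : 0 < b -> (gamma_tail b)%:E = (\int[mu]_(t in posR) (gamma_kernel b t)%:E)%E.
Proof.
move=> b0; rewrite /gamma_tail /Rintegral fineK//.
exact: integrable_fin_num (integrable_gamma_kernel b0).
Qed.

(* Substitution of w (1 + t) for the variable of integration. *)
Lemma inc_gammaE w : 0 < w ->
  inc_gamma (1 - k) w * expR (w / 2) = powR w (1 - k) * gamma_tail w.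
Proof.
move=> w0; rewrite /inc_gamma.
have mpow : measurable_fun [set: R] (fun t => powR t (1 - k - 1) * expR (- t)).
  apply: measurable_funM; first exact: measurable_powR.
  by apply: (measurableT_comp (@measurable_expR R)); exact: oppr_measurable.
have E : (\int[mu]_(t in `[w, +oo[) (powR t (1 - k - 1) * expR (- t))%:E =
    (powR w (1 - k) * expR (- (w / 2)))%:E * (gamma_tail w)%:E)%E.
  rewrite (@ge0_integral_affine _ w w)//; last 2 first.
  - exact/measurable_funTS/measurable_EFinP.
  - by move=> t _; rewrite lee_fin mulr_ge0 ?powR_ge0 ?expR_ge0.
  have -> : [set x | [set` `[w, +oo[] (w * x + w)] = `[0, +oo[%classic.
    by apply/seteqP; split=> x; rewrite /= !in_itv/= !andbT lerDr pmulr_rge0.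
  have ma : measurable_fun [set: R]
      (fun x => ((w * x + w) `^ (1 - k - 1) * expR (- (w * x + w)))%:E).
    apply/measurable_EFinP; apply: (measurableT_comp mpow).
    by apply: measurable_funD => //; exact: measurable_funM.
  rewrite -integral_itv_obnd_cbnd; last exact: measurable_funTS.
  rewrite EFin_gamma_tail//.
  rewrite ge0_integralZ_posR ?(ltW w0)//; last 2 first.
  - exact/measurable_EFinP.
  - by move=> t _; rewrite mulr_ge0 ?powR_ge0 ?expR_ge0.
  rewrite ge0_integralZ_posR; last 3 first.
  - by rewrite mulr_ge0 ?powR_ge0 ?expR_ge0.
  - exact: measurable_gamma_kernel.
  - by move=> t _; exact: gamma_kernel_ge0.
  apply: eq_integral => t; rewrite inE posRP => t0; congr EFin.
  have t1 : 0 < 1 + t by rewrite addr_gt0.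
  have -> : w * t + w = w * (1 + t) by ring.
  rewrite (_ : 1 - k - 1 = - k); last by ring.
  rewrite powRM ?ltW// /gamma_kernel -powRN.
  have -> : powR w (1 - k) = w * powR w (- k).
    rewrite powRD; first by rewrite powRr1 ?ltW.
    by rewrite (gt_eqF w0) implybT.
  have -> : expR (- (w * (1 + t))) = expR (- (w / 2)) * expR (- (w / 2 * (2 * t + 1))).
    by rewrite -expRD; congr expR; lra.
  ring.
rewrite /Rintegral E -EFinM /= mulrAC -[_ * expR _ * expR _]mulrA -expRD addNr expR0.
by rewrite mulr1.
Qed.

(** For a = -4 pi (n + kappa_j) this is the modulus of the n-th non-holomorphic term at height y
    without its coefficient: exp(a y / 2) is the modulus of the exponential factor. *)
Definition gamma_part a y : R := inc_gamma (1 - k) (a * y) * expR (a * y / 2).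

Lemma gamma_part_ge0 a y : 0 <= gamma_part a y.
Proof.
rewrite mulr_ge0 ?expR_ge0//; apply: Rintegral_ge0 => t _.
by rewrite mulr_ge0 ?powR_ge0 ?expR_ge0.
Qed.

Lemma gamma_partE a y : 0 < a -> 0 < y ->
  gamma_part a y = powR (a * y) (1 - k) * gamma_tail (a * y).
Proof. by move=> a0 y0; rewrite /gamma_part inc_gammaE// mulr_gt0. Qed.

(** The counterpart of the exact relation between a holomorphic term at two heights: the price is
    the power of y / y0. *)
Lemma gamma_part_le a y0 y : 0 < a -> 0 < y0 -> y0 <= y ->
  gamma_part a y <= powR (y / y0) (1 - k) * expR (- (a * (y - y0) / 2)) * gamma_part a y0.
Proof.
move=> a0 y00 yy; have yp := lt_le_trans y00 yy.
rewrite !gamma_partE//.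
have -> : powR (a * y) (1 - k) = powR (y / y0) (1 - k) * powR (a * y0) (1 - k).
  rewrite -powRM; [|by rewrite divr_ge0// ltW|by rewrite mulr_ge0// ltW].
  by congr (_ `^ _); field; rewrite gt_eqF.
have ay : 0 < a * y0 by rewrite mulr_gt0.
have := gamma_tail_le ay (_ : a * y0 <= a * y); rewrite ler_pM2l// => /(_ yy).
rewrite (_ : (a * y - a * y0) / 2 = a * (y - y0) / 2); last by ring.
move=> H; rewrite -!mulrA ler_wpM2l ?powR_ge0// mulrCA ler_wpM2l ?powR_ge0//.
by rewrite mulrA.
Qed.

End IncompleteGamma.

(** * Growth of Fourier expansions *)

Section TrigonometricSums.
Context {R : realType}.
Implicit Types (t u : R).

Definition circle t : R[i] := cexp (0 +i* (2 * pi * t)).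

Lemma circleD t u : circle (t + u) = circle t * circle u.
Proof.
by rewrite /circle -cexpD; congr cexp; apply: eq_ReIm; rewrite ?Re_add ?Im_add /= ?addr0 ?mulrDr.
Qed.

Lemma cnorm_circle t : cnorm (circle t) = 1.
Proof. by rewrite cnorm_cexp /= expR0. Qed.

Lemma circle_half : circle (2^-1) = -1.
Proof.
rewrite /circle (_ : 2 * pi * 2^-1 = pi); last by field.
by apply: eq_ReIm; rewrite /= expR0 ?cospi ?sinpi ?mul1r ?oppr0.
Qed.

Lemma circle0 : circle 0 = 1.
Proof. by rewrite /circle mulr0 cexp0. Qed.

(* Averaging P(u) and circle (- lam i0 * h) P(u + h) with h = 1 / (2 (lam l - lam i0))
   kills the frequency lam l and keeps the coefficient of lam i0. *)
Lemma trig_coef_le (I : eqType) (lam : I -> R) (s : seq I) (i0 : I) (c : I -> R[i]) (B : R) :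
  (forall i, i \in s -> lam i != lam i0) ->
  (forall u, cnorm (c i0 * circle (lam i0 * u) + \sum_(i <- s) c i * circle (lam i * u)) <= B) ->
  cnorm (c i0) <= B.
Proof.
elim: s c => [|l s IH] c hs hB.
  by have := hB 0; rewrite big_nil addr0 mulr0 circle0 mulr1.
pose h := (2 * (lam l - lam i0))^-1.
have ll0 : lam l - lam i0 != 0 by rewrite subr_eq0 hs// mem_head.
pose c' i := c i * ((1 + circle ((lam i - lam i0) * h)) / 2).
have two : (2 : R[i]) != 0 by rewrite pnatr_eq0.
have c'0 : c' i0 = c i0 by rewrite /c' subrr mul0r circle0 -(natrD _ 1 1) divff// mulr1.
have c'l : c' l = 0.
  have lh : (lam l - lam i0) * h = 2^-1 by rewrite /h invfM mulrCA divff// mulr1.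
  by rewrite /c' lh circle_half subrr mul0r mulr0.
have c'E i u : c' i * circle (lam i * u) =
    2^-1 * (c i * circle (lam i * u) + circle (- lam i0 * h) * (c i * circle (lam i * (u + h)))).
  have e1 : circle ((lam i - lam i0) * h) = circle (lam i * h) * circle (- lam i0 * h).
    by rewrite -circleD mulrBl mulNr.
  have e2 : circle (lam i * (u + h)) = circle (lam i * u) * circle (lam i * h).
    by rewrite -circleD mulrDr.
  by rewrite /c' e1 e2; ring.
rewrite -c'0; apply: IH => [i si|u]; first by apply: hs; rewrite in_cons si orbT.
have -> : c' i0 * circle (lam i0 * u) + \sum_(i <- s) c' i * circle (lam i * u) =
  2^-1 * ((c i0 * circle (lam i0 * u) + \sum_(i <- l :: s) c i * circle (lam i * u)) +
    circle (- lam i0 * h) * (c i0 * circle (lam i0 * (u + h)) +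
      \sum_(i <- l :: s) c i * circle (lam i * (u + h)))).
  transitivity (c' i0 * circle (lam i0 * u) + \sum_(i <- l :: s) c' i * circle (lam i * u)).
    by rewrite big_cons c'l mul0r add0r.
  rewrite c'E (eq_bigr _ (fun i _ => c'E i u)) -mulr_sumr big_split /= -mulr_sumr; ring.
rewrite cnormM.
have n2 : cnorm (2^-1 : R[i]) = 2^-1.
  by rewrite (_ : 2^-1 = (2^-1 : R)%:C) ?cnorm_real ?ger0_norm// fmorphV rmorph_nat.
rewrite n2 mulrC ler_pdivrMr// (le_trans (cnormD _ _))//.
have := hB u; have := hB (u + h); rewrite cnormM cnorm_circle mul1r; lra.
Qed.

End TrigonometricSums.

(** * Fourier coefficients on a horizontal line *)

Section FourierBounds.
Context {R : realType}.
Variables (m : nat) (k : R) (kappa : 'I_m -> R).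
Hypothesis hkappa : forall j, 0 <= kappa j < 1.
Variables (f : R[i] -> 'cV[R[i]]_m) (cp cm : 'I_m -> int -> R[i]).
Hypothesis hc : fourier_expansion k kappa f cp cm.
Variable j : 'I_m.
Local Notation fq := (freq kappa j).
Implicit Types (n : int) (u y : R).

Definition plus_abs y n : R := cnorm (cp j n) * expR (- (2 * pi * fq n * y)).

Definition minus_abs y n : R :=
  cnorm (cm j n) * gamma_part k (- (4 * pi * fq n)) y.

Lemma qexpE n u y : qexp kappa j n (u +i* y) =
  (expR (- (2 * pi * fq n * y)))%:C * circle (fq n * u).
Proof.
rewrite /qexp /circle -cexp_real -cexpD; congr cexp; rewrite -complexiE.
apply: eq_ReIm; rewrite ?Re_add ?Im_add ?Re_mul ?Im_mul ?Re_mul ?Im_mul /=; ring.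
Qed.

Lemma cnorm_fourier_plus u y n :
  cnorm (fourier_plus kappa cp j (u +i* y) n) = plus_abs y n.
Proof.
by rewrite /fourier_plus qexpE !cnormM cnorm_circle mulr1 cnorm_real ger0_norm// expR_ge0.
Qed.

Lemma inc_gamma_ge0 (a w : R) : 0 <= inc_gamma a w.
Proof. by apply: Rintegral_ge0 => t _; rewrite mulr_ge0 ?powR_ge0 ?expR_ge0. Qed.

Lemma cnorm_fourier_minus u y n :
  cnorm (fourier_minus k kappa cm j (u +i* y) n) = minus_abs y n.
Proof.
rewrite /fourier_minus qexpE !cnormM cnorm_circle mulr1 !cnorm_real.
rewrite !ger0_norm ?expR_ge0 ?inc_gamma_ge0// /minus_abs /gamma_part -mulrA.
congr (_ * (inc_gamma _ _ * expR _)) => /=; first by ring.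
by field.
Qed.

Lemma plus_abs_ge0 y n : 0 <= plus_abs y n.
Proof. by rewrite mulr_ge0 ?cnorm_ge0 ?expR_ge0. Qed.

Lemma minus_abs_ge0 y n : 0 <= minus_abs y n.
Proof. by rewrite mulr_ge0 ?cnorm_ge0 ?gamma_part_ge0. Qed.

Lemma plus_abs_summable y : 0 < y -> (\esum_(n in [set: int]) (plus_abs y n)%:E < +oo)%E.
Proof.
move=> y0; have [_ /(_ j (0 +i* y) y0) [+ _ _]] := hc; rewrite /csummable.
by under eq_esum do rewrite cnorm_fourier_plus.
Qed.

Lemma minus_abs_summable y : 0 < y ->
  (\esum_(n in neg_freq kappa j) (minus_abs y n)%:E < +oo)%E.
Proof.
move=> y0; have [_ /(_ j (0 +i* y) y0) [_ + _]] := hc; rewrite /csummable.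
by under eq_esum do rewrite cnorm_fourier_minus.
Qed.

(** The total coefficient of exp(2 pi i (n + kappa_j) u) at height y, as a function of u. *)
Definition coef y n : R[i] :=
  cp j n * (expR (- (2 * pi * fq n * y)))%:C +
  (if n \in neg_freq kappa j then cm j n * (gamma_part k (- (4 * pi * fq n)) y)%:C else 0).

Lemma fourier_minusE u y n : fourier_minus k kappa cm j (u +i* y) n =
  cm j n * (gamma_part k (- (4 * pi * fq n)) y)%:C * circle (fq n * u).
Proof.
rewrite /fourier_minus qexpE /gamma_part rmorphM -!mulrA; congr (_ * (_ * (_ * _))) => /=.
  by congr (inc_gamma _ _)%:C; ring.
by congr (expR _)%:C; field.
Qed.

(** Both sums are merged into one series in which every frequency occurs once, since [trig_coef_le]
    requires the chosen frequency to differ from all others. *)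
Lemma fourier_sumE u y : 0 < y ->
  csummable [set: nat] (fun i => coef y (int_of_nat i) * circle (fq (int_of_nat i) * u)) /\
  f (u +i* y) j 0 = csum setT (fun i => coef y (int_of_nat i) * circle (fq (int_of_nat i) * u)).
Proof.
move=> y0; have [_ /(_ j (u +i* y) y0) [sp sm ->]] := hc.
have E : (fun i => coef y (int_of_nat i) * circle (fq (int_of_nat i) * u)) =
  (fun i => nat_family setT (fourier_plus kappa cp j (u +i* y)) i +
     nat_family (neg_freq kappa j) (fourier_minus k kappa cm j (u +i* y)) i).
  apply/funext => i; rewrite /nat_family in_setT /coef mulrDl /fourier_plus qexpE mulrA.
  by congr (_ + _); case: ifP; rewrite ?mul0r ?fourier_minusE.
move/csummable_int_nat: sp => sp; move/csummable_int_nat: sm => sm.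
by rewrite E; split; [exact: csummableD|rewrite csumD// -!csum_int_nat].
Qed.

Lemma freq_inj : injective fq.
Proof. by move=> a b /addIr /intr_inj. Qed.

(** The series is truncated with an error e uniform in u. The partial sums are then bounded by B +
    e, and [trig_coef_le] reads off the coefficient without integration over a period. *)
Lemma coef_le y B : 0 < y -> (forall u, cnorm (f (u +i* y) j 0) <= B) ->
  forall n, cnorm (coef y n) <= B.
Proof.
move=> y0 hB n; apply/ler_addgt0Pr => e e0.
have [_ bi _] := int_of_nat_bij.
have [i0 _ i0n] : exists2 i, True & int_of_nat i = n.
  by have [_ _ /(_ n I)[i _ <-]] := int_of_nat_bij; exists i.
have [s0 _] := fourier_sumE 0 y0.
have [N0 HN] := csum_tail s0 e0.
pose N := maxn N0 i0.+1.
pose s := [seq i <- iota 0 N | i != i0].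
rewrite -i0n; apply: (@trig_coef_le R _ (fun i => fq (int_of_nat i)) s i0
  (fun i => coef y (int_of_nat i))).
  move=> i; rewrite mem_filter => /andP[ii0 _]; apply: contra ii0.
  by move=> /eqP/freq_inj/(bi _ _ (mem_set I) (mem_set I)) ->.
move=> u.
have -> : coef y (int_of_nat i0) * circle (fq (int_of_nat i0) * u) +
    \sum_(i <- s) coef y (int_of_nat i) * circle (fq (int_of_nat i) * u) =
    \sum_(i < N) coef y (int_of_nat i) * circle (fq (int_of_nat i) * u).
  rewrite -(big_mkord xpredT (fun i => coef y (int_of_nat i) * circle (fq (int_of_nat i) * u))).
  rewrite /s big_filter [RHS](bigD1_seq i0)//=; last exact: iota_uniq.
    by rewrite /index_iota subn0.
  by rewrite mem_index_iota /= /N leq_max leqnn orbT.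
have [_ fE] := fourier_sumE u y0.
have := HN N (leq_maxl _ _) (fun i => coef y (int_of_nat i) * circle (fq (int_of_nat i) * u)).
rewrite -fE => H.
set S := \sum_(i < N) _ in H *.
have -> : S = f (u +i* y) j 0 - (f (u +i* y) j 0 - S) by rewrite subKr.
rewrite (le_trans (cnormB _ _))// lerD// H// => i.
by rewrite !cnormM !cnorm_circle.
Qed.

Definition plus_sum y := fine (\esum_(n in [set: int]) (plus_abs y n)%:E).
Definition minus_sum y := fine (\esum_(n in neg_freq kappa j) (minus_abs y n)%:E).

Lemma cnorm_f_le u y : 0 < y ->
  cnorm (f (u +i* y) j 0) <= 2 * (plus_sum y + minus_sum y).
Proof.
move=> y0; have [_ /(_ j (u +i* y) y0) [sp sm ->]] := hc.
rewrite mulrDr (le_trans (cnormD _ _))// lerD//.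
  apply: le_trans (cnorm_csum_le sp) _; rewrite /plus_sum.
  by under eq_esum do rewrite cnorm_fourier_plus.
apply: le_trans (cnorm_csum_le sm) _; rewrite /minus_sum.
by under eq_esum do rewrite cnorm_fourier_minus.
Qed.

Lemma esumZl_int (D : set int) (c : R) (a : int -> R) : 0 <= c ->
  (forall n, 0 <= a n) ->
  (\esum_(n in D) (c * a n)%:E = c%:E * \esum_(n in D) (a n)%:E)%E.
Proof.
move=> c0 a0; rewrite !esum_int_nat -!nneseries_esumT.
- rewrite -nneseriesZl//; last by move=> i _; case: ifP => // _; rewrite lee_fin.
  by apply: eq_eseriesr => i _; case: ifP; rewrite ?mule0.
- by move=> i; case: ifP => // _; rewrite lee_fin.
- by move=> i; case: ifP => // _; rewrite lee_fin mulr_ge0.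
Qed.

Lemma fine_esum_le_int (D : set int) (c : R) (a b : int -> R) : 0 <= c ->
  (forall n, 0 <= a n) -> (forall n, 0 <= b n) ->
  (forall n, D n -> a n <= c * b n) -> (\esum_(n in D) (b n)%:E < +oo)%E ->
  fine (\esum_(n in D) (a n)%:E) <= c * fine (\esum_(n in D) (b n)%:E).
Proof.
move=> c0 a0 b0 ab sb.
have fb : (\esum_(n in D) (b n)%:E)%E \is a fin_num by apply: esum_fin_num.
have le1 : (\esum_(n in D) (a n)%:E <= c%:E * \esum_(n in D) (b n)%:E)%E.
  by rewrite -esumZl_int//; apply: le_esum => n Dn; rewrite lee_fin ab.
have -> : c * fine (\esum_(n in D) (b n)%:E) = fine (c%:E * \esum_(n in D) (b n)%:E)%E.
  by rewrite fineM.
have fcb : (c%:E * \esum_(n in D) (b n)%:E)%E \is a fin_num by rewrite fin_numM.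
rewrite fine_le// ge0_fin_numE; last by apply: esum_ge0 => n _; rewrite lee_fin.
by rewrite (le_lt_trans le1)// ltey_eq fcb.
Qed.

Lemma plus_abs_shift y0 y n :
  plus_abs y n = expR (- (2 * pi * fq n * (y - y0))) * plus_abs y0 n.
Proof. by rewrite /plus_abs mulrCA -expRD; congr (_ * expR _); ring. Qed.

Lemma minus_abs_le y0 y n : 0 < y0 -> y0 <= y -> fq n < 0 ->
  minus_abs y n <= powR (y / y0) (1 - k) * expR (2 * pi * fq n * (y - y0)) * minus_abs y0 n.
Proof.
move=> y00 yy n0; have a0 : 0 < - (4 * pi * fq n).
  by rewrite oppr_gt0 pmulr_rlt0// mulr_gt0// pi_gt0.
have := gamma_part_le k a0 y00 yy.
rewrite (_ : - (- (4 * pi * fq n) * (y - y0) / 2) = 2 * pi * fq n * (y - y0)); last by field.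
move=> H; rewrite /minus_abs [X in _ <= X]mulrCA ler_wpM2l ?cnorm_ge0//.
Qed.

Lemma freq_ge n : n%:~R <= fq n.
Proof. by rewrite lerDl; have /andP[] := hkappa j. Qed.

Lemma freq_lt n : fq n < n%:~R + 1.
Proof. by rewrite ltrD2l; have /andP[] := hkappa j. Qed.

(** The hypothesis on n0 concerns large heights only; between y0 and V every term is compared with
    its value at y0. *)
Lemma strip_bound y0 V : 0 < y0 -> exists K, forall u y, y0 <= y <= V ->
  cnorm (f (u +i* y) j 0) <= K.
Proof.
move=> y00; have [[n1 hn1] _] := hc.
(* A holomorphic term grows with y only for a negative frequency, which is at least n1 when the
   coefficient is not 0; this gives [C1]. A gamma term gains at most the power (y / y0)^(1-k), which
   gives [C2]. *)
pose C1 := expR (2 * pi * `|n1%:~R| * `|V|).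
pose C2 := expR (`|1 - k| * ln (`|V| / y0)).
exists (2 * (C1 * plus_sum y0 + C2 * minus_sum y0)) => u y /andP[yy yV].
have yp := lt_le_trans y00 yy.
have Vp := lt_le_trans yp yV.
apply: le_trans (cnorm_f_le u yp) _; rewrite ler_wpM2l// lerD//.
  apply: fine_esum_le_int.
  - exact: expR_ge0.
  - exact: plus_abs_ge0.
  - exact: plus_abs_ge0.
  - move=> n _; rewrite (plus_abs_shift y0); have [nn1|nn1] := ltP n n1.
      by rewrite /plus_abs hn1// cnorm0 mul0r !mulr0.
    rewrite ler_wpM2r ?plus_abs_ge0// ler_expR -mulNr -mulrN -!mulrA.
    rewrite ler_wpM2l// ler_wpM2l ?pi_ge0//.
    have h1 : - fq n <= `|n1%:~R|.
      have := freq_ge n; have : (n1%:~R : R) <= n%:~R by rewrite ler_int.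
      by have := ler_norm (- (n1%:~R : R)); rewrite normrN; lra.
    rewrite (ger0_norm (ltW Vp)).
    apply: (@le_trans _ _ (`|n1%:~R| * (y - y0))); first by rewrite ler_wpM2r// subr_ge0.
    by rewrite ler_wpM2l//; lra.
  - exact: plus_abs_summable.
apply: fine_esum_le_int.
- exact: expR_ge0.
- exact: minus_abs_ge0.
- exact: minus_abs_ge0.
- move=> n nn; apply: le_trans (minus_abs_le y00 yy nn) _.
  rewrite ler_wpM2r ?minus_abs_ge0//.
  have q1 : expR (2 * pi * fq n * (y - y0)) <= 1.
    have pf : 2 * pi * fq n <= 0 by rewrite pmulr_rle0 ?(ltW nn)// mulr_gt0// pi_gt0.
    by rewrite expR_le1 mulr_le0_ge0// subr_ge0.
  have q2 : powR (y / y0) (1 - k) <= C2.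
    have yy0 : 1 <= y / y0 by rewrite ler_pdivlMr// mul1r.
    have yy1 : 0 < y / y0 by rewrite divr_gt0.
    apply: le_trans (powR_le_exp_ln _ yy1) _; rewrite ler_expR ler_wpM2l//.
    rewrite ger0_norm ?ln_ge0// ler_ln ?posrE ?divr_gt0 ?normr_gt0 ?gt_eqF//.
    by rewrite ler_pM2r ?invr_gt0// (le_trans yV)// ler_norm.
  by rewrite -[leRHS]mulr1 ler_pM ?powR_ge0 ?expR_ge0.
- exact: minus_abs_summable.
Qed.

End FourierBounds.

(** * Moving a point of small height upwards by a matrix of determinant 1 *)

Section Reduction.
Context {R : realType}.

(** Pigeonhole: the N + 1 fractional parts of 0, u, ..., N u lie in N intervals of length 1/N. *)
Lemma dirichlet_approximation (u : R) (N : nat) : (0 < N)%N ->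
  exists (c : nat) (d : int), (0 < c <= N)%N /\ `|c%:R * u + d%:~R| <= N%:R^-1.
Proof.
move=> N0; pose fl (i : nat) : int := Num.floor (i%:R * u).
pose a (i : nat) : R := i%:R * u - (fl i)%:~R.
have N0R : 0 < (N%:R : R) by rewrite ltr0n.
have a0 i : 0 <= a i by rewrite subr_ge0 floor_le_tmp.
have a1 i : a i < 1 by rewrite /a ltrBlDr addrC -intrD1 floorD1_gt.
have Na0 i : 0 <= N%:R * a i by rewrite mulr_ge0.
have bP (i : nat) : (Num.truncn (N%:R * a i) < N)%N.
  rewrite truncn_lt_nat//. 
  by rewrite -[ltRHS]mulr1 ltr_pM2l.
pose b (i : 'I_N.+1) : 'I_N := Ordinal (bP i).
have : ~~ injectiveb b.
  apply/negP => /injectiveP/leq_card; by rewrite !card_ord ltnn.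
move=> /injectivePn[i [i' ii' bb]].
wlog ltii : i i' ii' bb / (i < i')%N.
  move=> H; have [l|l|/val_inj e] := ltngtP i i'; first exact: (H i i').
    by apply: (H i' i) => //; rewrite eq_sym.
  by move: ii'; rewrite e eqxx.
exists (i' - i)%N, (fl i - fl i'); split.
  by rewrite subn_gt0 ltii leq_subLR (leq_trans (leq_ord i'))// leq_addl.
have -> : (i' - i)%:R * u + (fl i - fl i')%:~R = a i' - a i.
  by rewrite natrB ?(ltnW ltii)// rmorphB /= /a; ring.
have /(congr1 val) /= bb' := bb.
have /andP[t1 t2] := truncn_itv (Na0 i); have /andP[t3 t4] := truncn_itv (Na0 i').
rewrite bb' in t1 t2.
rewrite -(ler_pM2l N0R) divff ?gt_eqF// -{1}(ger0_norm (ltW N0R)) -normrM mulrBr ler_norml.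
move: t1 t2 t3 t4; rewrite -natr1; lra.
Qed.

Lemma det_2x2 (A : comNzRingType) (g : 'M[A]_2) :
  \det g = g 0 0 * g 1 1 - g 0 1 * g 1 0.
Proof.
rewrite (expand_det_row _ 0) !big_ord_recl big_ord0 addr0 /cofactor !det_mx11 !mxE /=.
rewrite expr0 mul1r expr1 mulN1r mulrN.
by congr (g _ _ * g _ _ - g _ _ * g _ _); apply: val_inj.
Qed.

Lemma mulrz_complex (n : int) : (n%:~R : R[i]) = (n%:~R : R)%:C.
Proof. by rewrite rmorph_int. Qed.

Lemma autjE (g : 'M[int]_2) (u y : R) : autj g (u +i* y) =
  ((g 1 0)%:~R * u + (g 1 1)%:~R) +i* ((g 1 0)%:~R * y).
Proof.
rewrite /autj !mulrz_complex; apply: eq_ReIm; rewrite ?Re_add ?Im_add ?Re_mul ?Im_mul /=; ring.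
Qed.

Lemma Im_mobius (g : 'M[int]_2) (u y : R) : SL2Z g -> 0 < y ->
  autj g (u +i* y) != 0 ->
  Im (mobius g (u +i* y)) = y / cnorm (autj g (u +i* y)) ^+ 2.
Proof.
move=> + y0 j0; rewrite /SL2Z det_2x2 => detg.
rewrite /mobius -/(autj g (u +i* y)) cnormE sqr_sqrtr ?addr_ge0 ?sqr_ge0//.
have n2 : Re (autj g (u +i* y)) ^+ 2 + Im (autj g (u +i* y)) ^+ 2 != 0.
  have := cnorm_gt0 j0; rewrite cnormE sqrtr_gt0 => h; by rewrite gt_eqF.
move: n2; rewrite autjE /= => n2.
rewrite !mulrz_complex Im_mul ?Re_add ?Im_add ?Re_mul ?Im_mul /=.
have dR : ((g 0 0)%:~R * (g 1 1)%:~R - (g 0 1)%:~R * (g 1 0)%:~R : R) = 1.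
  by rewrite -!intrM -intrB detg.
set A := (g 0 0)%:~R in dR *; set B := (g 0 1)%:~R in dR *.
set C := (g 1 0)%:~R in dR n2 *; set D := (g 1 1)%:~R in dR n2 *.
rewrite (_ : y / _ = (A * D - B * C) * y / ((C * u + D) ^+ 2 + (C * y) ^+ 2)); last by rewrite dR mul1r.
by field.
Qed.

(* The bottom row (c, d) is a Dirichlet approximation of order about 1 / sqrt y. *)
Lemma sl2_reduction (u y : R) : 0 < y -> y < 1 ->
  exists g, [/\ SL2Z g, autj g (u +i* y) != 0, y <= cnorm (autj g (u +i* y)) &
    cnorm (autj g (u +i* y)) ^+ 2 <= 5 * y].
Proof.
move=> y0 y1; pose N := Num.truncn (Num.sqrt y)^-1.
have sy0 : 0 < Num.sqrt y by rewrite sqrtr_gt0.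
have sy1 : Num.sqrt y < 1 by rewrite -sqrtr1 ltr_sqrt.
have sV : 1 < (Num.sqrt y)^-1 by rewrite invf_gt1.
have syy : Num.sqrt y ^+ 2 = y by rewrite sqr_sqrtr// ltW.
have sV0 : 0 <= (Num.sqrt y)^-1 by rewrite invr_ge0 ltW.
have /andP[N1 N2] := truncn_itv sV0; rewrite -/N in N1 N2.
have N0 : (0 < N)%N by rewrite /N truncn_gt0 ltW.
have N0R : 1 <= (N%:R : R) by rewrite ler1n.
have [c [d [/andP[c0 cN] cd]]] := dirichlet_approximation u N0.
(* Division by the gcd makes the row primitive, so that Bezout completes it to a matrix of
   determinant 1, and it decreases both c and |c u + d|. *)
pose e := gcdn c `|d|; pose c' := (c %/ e)%N; pose d' := (d %/ e)%Z.
have e0 : (0 < e)%N by rewrite gcdn_gt0 c0.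
have ce : c = (c' * e)%N by rewrite divnK ?dvdn_gcdl.
have de : d = d' * e by rewrite divzK// /e dvdzE dvdn_gcdr.
have c'0 : (0 < c')%N by rewrite divn_gt0// dvdn_leq// dvdn_gcdl.
have [p [q pq0]] := Bezoutz c d.
have pq : p * c'%:Z + q * d' = 1.
  have eZ : (e%:Z : int) != 0 by rewrite eqz_nat -lt0n.
  apply: (mulIf eZ); rewrite mul1r mulrDl -!mulrA -de -PoszM -ce pq0.
  by rewrite /gcdz absz_nat.
pose g : 'M[int]_2 := \matrix_(i, j) (if i == 0 then (if j == 0 then q else - p)
  else (if j == 0 then c'%:Z else d')).
have gE : [/\ g 0 0 = q, g 0 1 = - p, g 1 0 = c' & g 1 1 = d'] by rewrite !mxE.
have [g00 g01 g10 g11] := gE.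
have sg : SL2Z g by rewrite /SL2Z det_2x2 g00 g01 g10 g11 -pq; ring.
have c'R : 1 <= (c'%:R : R) by rewrite ler1n.
have eR : 1 <= (e%:R : R) by rewrite ler1n.
have aE : autj g (u +i* y) = (c'%:R * u + d'%:~R) +i* (c'%:R * y).
  by rewrite autjE g10 g11 -pmulrn.
have ylow : y <= cnorm (autj g (u +i* y)).
  apply: le_trans (Im_le_cnorm _); rewrite aE /= ger0_norm; last by rewrite mulr_ge0// ltW.
  by rewrite ler_peMl// ltW.
exists g; split=> //.
  by apply/eqP => H; move: ylow; rewrite H cnorm0 leNgt y0.
rewrite cnormE sqr_sqrtr ?addr_ge0 ?sqr_ge0// aE /=.
(* The 5 is 4 + 1. As N >= 1 and N + 1 > 1 / sqrt y, one has 1/N <= 2 sqrt y, so the real part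
   contributes at most 4 y; as c <= N <= 1 / sqrt y, the imaginary part contributes at most y. *)
have h1 : (c'%:R * u + d'%:~R) ^+ 2 <= (N%:R^-1) ^+ 2 :> R.
  rewrite -real_normK ?num_real// lerXn2r ?nnegrE ?invr_ge0//.
  have E : c%:R * u + d%:~R = (c'%:R * u + d'%:~R) * e%:R :> R.
    by rewrite [in LHS]ce [in LHS]de natrM intrM -pmulrn; ring.
  apply: le_trans cd; rewrite E normrM ler_peMr//.
  by rewrite ger0_norm// ler0n.
have h2 : (c'%:R * y) ^+ 2 <= (N%:R * y) ^+ 2 :> R.
  rewrite lerXn2r ?nnegrE ?mulr_ge0 ?(ltW y0)// ler_pM2r// ler_nat (leq_trans _ cN)//.
  by rewrite ce leq_pmulr.
have h3 : (N%:R * y) ^+ 2 <= y.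
  have -> : (N%:R * y) ^+ 2 = (N%:R * Num.sqrt y) ^+ 2 * y by rewrite !exprMn syy; ring.
  rewrite ler_piMl ?(ltW y0)// exprn_ile1// ?mulr_ge0 ?sqrtr_ge0//.
  by rewrite -ler_pdivlMr// div1r.
have h4 : (N%:R^-1) ^+ 2 <= 4 * y :> R.
  have : N%:R^-1 <= 2 * Num.sqrt y.
    rewrite invf_ple ?posrE ?mulr_gt0 ?ltr0n// invfM.
    have : (Num.sqrt y)^-1 < N%:R + 1 by rewrite natr1.
    lra.
  move=> h; rewrite -syy (_ : 4 * _ = (2 * Num.sqrt y) ^+ 2); last by ring.
  by rewrite lerXn2r ?nnegrE ?invr_ge0 ?mulr_ge0 ?sqrtr_ge0.
lra.
Qed.

End Reduction.

(** * Growth of f on the whole upper half-plane *)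

Section ModularGrowth.
Context {R : realType}.
Variables (m : nat) (k : R) (chi : 'M[int]_2 -> R[i]).
Hypothesis hchi : unitary_multiplier_system k chi.
Variables (rho : 'M[int]_2 -> 'M[R[i]]_m).
Hypothesis hrho : unitary_representation rho.
Variables (kappa : 'I_m -> R).
Hypothesis hkappa : forall j, 0 <= kappa j < 1.
Variables (f : R[i] -> 'cV[R[i]]_m) (cp cm : 'I_m -> int -> R[i]).
Hypothesis hslash : forall g tau, SL2Z g -> 0 < Im tau -> slash k chi rho f g tau = f tau.
Hypothesis hc : fourier_expansion k kappa f cp cm.
Variable n0 : nat.
Hypothesis hn0 : forall j, exists M : R, \forall v \near +oo, forall u : R,
  cnorm (f (u +i* v) j 0) <= M * expR (2 * pi * n0%:R * v).

Lemma unitarymx_entry_le (n : nat) (M : 'M[R[i]]_n) (i l : 'I_n) :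
  M \is unitarymx -> cnorm (M i l) <= 1.
Proof.
move=> /unitarymxP /matrixP /(_ i i); rewrite !mxE eqxx /= => E.
have E2 : \sum_(l < n) `|M i l| ^+ 2 = 1 :> R[i].
  by rewrite -[RHS]E; apply: eq_bigr => r _; rewrite !mxE normCK.
have : `|M i l| ^+ 2 <= 1.
  rewrite -E2 (bigD1 l)//= lerDl; apply: sumr_ge0 => r _.
  exact: exprn_ge0.
rewrite normcC -rmorphXn -[1]/(1%:C) lecR.
by rewrite expr_le1// cnorm_ge0.
Qed.

Lemma cnorm_slash_le (g : 'M[int]_2) (tau : R[i]) (j : 'I_m) : SL2Z g -> 0 < Im tau ->
  autj g tau != 0 ->
  cnorm (f tau j 0) <= powR (cnorm (autj g tau)) (- k) *
    \sum_(i < m) cnorm (f (mobius g tau) i 0).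
Proof.
move=> sg t0 j0; rewrite -(hslash sg t0) /slash !mxE !cnormM.
have [u1 _] := hrho; have [c1 _] := hchi.
rewrite -rmorphN cnorm_cpow// cnormV c1// invr1 mulr1 ler_wpM2l ?powR_ge0//.
apply: le_trans (cnorm_sum _ _ _) _; apply: ler_sum => i _.
rewrite cnormM ler_piMl ?cnorm_ge0//.
by rewrite unitarymx_entry_le// invmx_unitary ?u1// trmxC_unitary u1.
Qed.

Lemma upper_bound (y0 : R) : 0 < y0 -> exists2 K, 0 <= K & forall (j : 'I_m) u y, y0 <= y ->
  cnorm (f (u +i* y) j 0) <= K * expR (2 * pi * n0%:R * y).
Proof.
move=> y00.
have H j : exists K, forall u y, y0 <= y ->
    cnorm (f (u +i* y) j 0) <= K * expR (2 * pi * n0%:R * y).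
  have [M [V [_ HV]]] := hn0 j.
  have [K HK] := strip_bound hkappa hc j (V + 1) y00.
  exists (`|M| + `|K|) => u y yy; have yp := lt_le_trans y00 yy.
  have e1 : 1 <= expR (2 * pi * n0%:R * y).
    by rewrite -expR0 ler_expR !mulr_ge0// ?pi_ge0// ltW.
  have e0 := lt_le_trans ltr01 e1.
  have [yV|yV] := leP y (V + 1).
    apply: le_trans (HK u y _) _; first by rewrite yy yV.
    have := ler_norm K; have := normr_ge0 M; have := normr_ge0 K; nra.
  have : V < y by lra.
  move=> /HV /(_ u) /le_trans; apply; rewrite ler_wpM2r ?expR_ge0//.
  have := ler_norm M; have := normr_ge0 K; lra.
have [F HF] := choice H.
exists (\sum_(j < m) `|F j|); first by rewrite sumr_ge0.
move=> j u y yy; apply: le_trans (HF j u y yy) _; rewrite ler_wpM2r ?expR_ge0//.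
by rewrite (bigD1 j)//= (le_trans (ler_norm _))// lerDl sumr_ge0.
Qed.

Lemma modular_growth (d : R) : 0 < d -> exists2 B, 0 <= B & forall (j : 'I_m) u y, 0 < y ->
  cnorm (f (u +i* y) j 0) <= B * decay (- (2 * pi * (n0%:R + d))) y.
Proof.
move=> d0; have p0 := @pi_gt0 R.
(* The height reached by [sl2_reduction]: y / r^2 >= 1/5 when r^2 <= 5 y. *)
have f5 : 0 < (5^-1 : R) by rewrite invr_gt0.
have [K K0 HK] := upper_bound f5.
have pd0 : 0 < 2 * pi * d :> R by rewrite !mulr_gt0.
have [K2 K20 HK2] := exp_ln_le (normr_ge0 k) pd0.
have pn0 : 0 <= 2 * pi * n0%:R :> R by rewrite !mulr_ge0// ltW.
have dE y : decay (- (2 * pi * (n0%:R + d))) y =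
    decay (- (2 * pi * d)) y * decay (- (2 * pi * n0%:R)) y.
  by rewrite decayM -opprD -mulrDr addrC.
have pos1 y : 0 < y -> 1 <= decay (- (2 * pi * d)) y.
  move=> y0; rewrite /decay mulNr opprK -[leLHS]expR0 ler_expR mulr_ge0 ?(ltW pd0)//.
  by rewrite addr_ge0 ?invr_ge0// ltW.
have K2mK : 0 <= K2 * (m%:R * K) by rewrite !mulr_ge0// ltW.
exists (K + K2 * (m%:R * K)); first by rewrite addr_ge0.
move=> j u y y0; have yV : 0 < y^-1 by rewrite invr_gt0.
rewrite mulrDl; have [y5|y5] := leP (5^-1) y.
  apply: le_trans (HK j u y y5) _; rewrite -[leLHS]addr0 lerD//; last first.
    by rewrite mulr_ge0 ?decay_ge0.
  rewrite ler_wpM2l// dE -[leLHS]mul1r ler_pM ?expR_ge0 ?pos1//.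
  by rewrite /decay mulNr opprK ler_expR ler_wpM2l// lerDl ltW.
have y1 : y < 1 by lra.
have [g [sg a0 ylow yup]] := sl2_reduction u y0 y1.
set r := cnorm (autj g (u +i* y)) in ylow yup.
have r0 : 0 < r by apply: lt_le_trans ylow.
(* Here y < 1/5, so r^2 <= 5 y < 1. Together with y <= r this gives |ln r| <= |ln y|, which bounds
   r^(-k) for either sign of k. *)
have r1 : r < 1.
  have : r ^+ 2 < 1 by lra.
  by rewrite -{1}(expr1n _ 2) ltr_pXn2r// nnegrE ltW.
have Imt : 0 < Im (u +i* y) by [].
apply: le_trans (cnorm_slash_le j sg Imt a0) _; rewrite -/r.
pose v := Im (mobius g (u +i* y)).
have vE : v = y / r ^+ 2 by rewrite /v Im_mobius.
have v5 : 5^-1 <= v.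
  by rewrite vE ler_pdivlMr ?exprn_gt0// mulrC -ler_pdivlMr ?invr_gt0// invrK mulrC.
(* The lower bound r >= y limits the new height to 1/y; this is the source of the term 1/y in the
   growth weight. *)
have vy : v <= y^-1.
  rewrite vE ler_pdivrMr ?exprn_gt0// -ler_pdivrMl ?invr_gt0// invrK.
  by rewrite -expr2 lerXn2r// nnegrE ltW.
have tE : mobius g (u +i* y) = Re (mobius g (u +i* y)) +i* v by rewrite /v; case: (mobius _ _).
have S : \sum_(i < m) cnorm (f (mobius g (u +i* y)) i 0) <=
    m%:R * K * decay (- (2 * pi * n0%:R)) y.
  rewrite -mulrA mulr_natl -[X in _ *+ X]card_ord -sumr_const; apply: ler_sum => i _.
  rewrite tE; apply: le_trans (HK i _ v v5) _; rewrite ler_wpM2l//.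
  rewrite /decay mulNr opprK ler_expR ler_wpM2l//.
  by rewrite (le_trans vy)// lerDr ltW.
have P : powR r (- k) <= K2 * decay (- (2 * pi * d)) y.
  apply: le_trans (powR_le_exp_ln _ r0) _; rewrite normrN.
  apply: le_trans (HK2 y y0); rewrite ler_expR ler_wpM2l//.
  have l1 : ln y <= ln r by rewrite ler_ln.
  have l2 : ln r < 0 by rewrite ln_lt0// r0.
  by rewrite !ltr0_norm//; lra.
apply: (@le_trans _ _ (K2 * decay (- (2 * pi * d)) y * (m%:R * K * decay (- (2 * pi * n0%:R)) y))).
  by rewrite ler_pM ?powR_ge0// sumr_ge0// => i _; exact: cnorm_ge0.
rewrite dE mulrACA -[leLHS]add0r lerD// mulr_ge0// mulr_ge0 ?decay_ge0//.
Qed.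

End ModularGrowth.

(** * Elementary estimates for exponentials and geometric series *)

Section ExponentialSums.
Context {R : realType}.

Lemma le0_of_exp (x C eta : R) : 0 < eta ->
  (forall y, 1 <= y -> x <= C * expR (- (eta * y))) -> x <= 0.
Proof.
move=> e0 H; rewrite leNgt; apply/negP => x0.
(* At this height x * (eta y) >= |C|, which contradicts the hypothesis because exp(eta y) >= 1 + eta
   y. *)
pose y := Num.max 1 (`|C| / (x * eta)).
have y1 : 1 <= y by rewrite le_max lexx.
have := H y y1; rewrite expRN ler_pdivlMr ?expR_gt0// => h.
have h2 : `|C| <= x * (eta * y).
  by rewrite mulrA -ler_pdivrMl ?mulr_gt0// mulrC le_max lexx orbT.
have := expR_ge1Dx (eta * y); have := ler_norm C; nra.
Qed.

Lemma geometric_sum_le (q : R) N : 0 <= q -> q < 1 ->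
  \sum_(i < N) q ^+ i <= (1 - q)^-1.
Proof.
move=> q0 q1; have p : 0 < 1 - q by rewrite subr_gt0.
elim: N => [|N IH]; first by rewrite big_ord0 invr_ge0 ltW.
rewrite big_ord_recl expr0.
under eq_bigr do rewrite lift0 exprS.
rewrite -mulr_sumr; have := ler_wpM2l q0 IH.
have : (1 - q)^-1 = 1 + q * (1 - q)^-1 by field; rewrite gt_eqF.
lra.
Qed.

(** In the enumeration [int_of_nat] the index i is at most 2 |n| + 1, so the i-th term is at most
    exp(x / 2) q^i with q = exp(-x / 2), and q (1 + x / 2) <= 1 gives 1 / (1 - q) <= 1 + 2 / x. *)
Lemma esum_int_exp_le (x : R) : 0 < x ->
  (\esum_(n in [set: int]) (expR (- (x * `|n|%N%:R)))%:E <=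
    (expR (x / 2) * (1 + 2 / x))%:E)%E.
Proof.
move=> x0; rewrite esum_int_nat -nneseries_esumT; last first.
  by move=> i; rewrite in_setT lee_fin expR_ge0.
pose q := expR (- (x / 2)).
have q0 : 0 <= q by exact: expR_ge0.
have x2 : 0 < x / 2 by rewrite divr_gt0.
have q1 : q < 1 by rewrite expR_lt1 oppr_lt0.
have qV : (1 - q)^-1 <= 1 + 2 / x.
  have h : q * (1 + x / 2) <= 1.
    rewrite /q expRN mulrC ler_pdivrMr ?expR_gt0// mul1r; exact: expR_ge1Dx.
  have p : 0 < 1 - q by rewrite subr_gt0.
  rewrite -[leLHS]div1r ler_pdivrMr//.
  have -> : (1 + 2 / x) * (1 - q) = (1 - q) * (x + 2) / x by field; rewrite gt_eqF.
  by rewrite ler_pdivlMr// mul1r; nra.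
apply: lime_le; first by apply: is_cvg_nneseries => i _ _; rewrite in_setT lee_fin expR_ge0.
apply: nearW => N; rewrite big_mkord.
apply: (@le_trans _ _ (\sum_(i < N) (expR (x / 2) * q ^+ i)%:E)%E).
  apply: lee_sum => i _; rewrite in_setT lee_fin /q -expRM_natl -expRD ler_expR.
  have := int_of_nat_ge i; rewrite -(@ler_nat R) natrD natrM; nra.
rewrite sumEFin lee_fin -mulr_sumr ler_wpM2l ?expR_ge0//.
exact: le_trans (geometric_sum_le N q0 q1) qV.
Qed.

End ExponentialSums.

(** * Separating holomorphic from gamma terms, and summing their absolute values *)

Section CoefficientGrowth.
Context {R : realType}.
Variables (m : nat) (k : R) (kappa : 'I_m -> R).
Hypothesis hkappa : forall j, 0 <= kappa j < 1.
Variables (f : R[i] -> 'cV[R[i]]_m) (cp cm : 'I_m -> int -> R[i]).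
Hypothesis hc : fourier_expansion k kappa f cp cm.
Variables (j : 'I_m) (n0 : nat).
Hypothesis hgrow : forall d : R, 0 < d -> exists2 B : R, 0 <= B & forall u y : R, 0 < y ->
  cnorm (f (u +i* y) j 0) <= B * decay (- (2 * pi * (n0%:R + d))) y.
Local Notation fq := (freq kappa j).
Local Notation wt d y := (decay (- (2 * pi * (n0%:R + d))) y).

Lemma coef_growth d : 0 < d -> exists2 B : R, 0 <= B & forall n (y : R), 0 < y ->
  cnorm (coef k kappa cp cm j y n) <= B * wt d y.
Proof.
move=> /hgrow[B B0 HB]; exists B => // n y y0.
by apply: (coef_le hc y0) => u; exact: HB.
Qed.

Lemma le_plus_coef y n : plus_abs kappa cp j y n <=
  cnorm (coef k kappa cp cm j y n) + (if n \in neg_freq kappa j then minus_abs k kappa cm j y n else 0).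
Proof.
have -> : plus_abs kappa cp j y n = cnorm (cp j n * (expR (- (2 * pi * fq n * y)))%:C).
  by rewrite cnormM cnorm_real ger0_norm ?expR_ge0.
rewrite /coef; case: ifP => _; last by rewrite !addr0.
set a := cp j n * _; set b := cm j n * _.
have -> : minus_abs k kappa cm j y n = cnorm b.
  by rewrite cnormM cnorm_real ger0_norm ?gamma_part_ge0.
by rewrite -{1}(addrK b a) (le_trans (cnormB _ _)).
Qed.

Lemma le_minus_coef y n : n \in neg_freq kappa j -> minus_abs k kappa cm j y n <=
  cnorm (coef k kappa cp cm j y n) + plus_abs kappa cp j y n.
Proof.
move=> nn; have -> : plus_abs kappa cp j y n = cnorm (cp j n * (expR (- (2 * pi * fq n * y)))%:C).
  by rewrite cnormM cnorm_real ger0_norm ?expR_ge0.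
rewrite /coef nn; set a := cp j n * _; set b := cm j n * _.
have -> : minus_abs k kappa cm j y n = cnorm b.
  by rewrite cnormM cnorm_real ger0_norm ?gamma_part_ge0.
by rewrite -{1}(addKr a b) addrC (le_trans (cnormB _ _)).
Qed.

Lemma wt_ge_exp (d y : R) : 0 < d -> 0 < y -> expR (2 * pi * n0%:R * y) <= wt d y.
Proof.
move=> d0 y0; rewrite /decay mulNr opprK ler_expR.
have p0 := @pi_gt0 R.
have h1 : 0 <= y^-1 by rewrite invr_ge0 ltW.
have h2 : 0 <= (n0%:R : R) by [].
have h3 : n0%:R * y <= (n0%:R + d) * (y + y^-1).
  have : 0 <= n0%:R * y^-1 :> R by rewrite mulr_ge0.
  have : 0 <= d * y by rewrite mulr_ge0 ?(ltW d0) ?(ltW y0).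
  have : 0 <= d * y^-1 by rewrite mulr_ge0 ?(ltW d0).
  by move=> a1 a2 a3; rewrite mulrDl !mulrDr; lra.
by rewrite -!mulrA ler_wpM2l// ler_wpM2l ?(ltW p0).
Qed.

(** As y grows, the total coefficient has rate at most slightly above n0 and the gamma term decays
    up to a power of y, whereas a non-zero holomorphic term would grow at rate -(n + kappa_j) >
    n0. *)
Lemma cp_eq0 n : fq n < - n0%:R -> cp j n = 0.
Proof.
move=> nn; have p0 := @pi_gt0 R.
(* The excess of the rate over n0. Spending D / 4 on the growth bound, and also on the power of y in
   the gamma term, leaves decay at rate 2 pi (3 D / 4). *)
pose D := - fq n - n0%:R; have D0 : 0 < D by rewrite /D; lra.
have d0 : 0 < D / 4 by rewrite divr_gt0.
have [B B0 HB] := coef_growth d0.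
have pd0 : 0 < 2 * pi * (D / 4) by rewrite !mulr_gt0.
have [K K0 HK] := exp_ln_le (normr_ge0 (1 - k)) pd0.
have fn0 : fq n < 0 by have := ler0n R n0; lra.
have nneg : n \in neg_freq kappa j by rewrite inE.
pose M1 := minus_abs k kappa cm j 1 n.
have M10 : 0 <= M1 by exact: minus_abs_ge0.
apply: cnorm_eq0; apply/eqP; rewrite eq_le cnorm_ge0 andbT.
apply: (@le0_of_exp _ _ ((B + K * M1) * expR (2 * pi * (n0%:R + D / 4))) (2 * pi * (D * 3 / 4))).
  by rewrite !mulr_gt0// invr_gt0.
move=> y y1; have y0 : 0 < y by lra.
have W1 : wt (D / 4) y <= expR (2 * pi * (n0%:R + D / 4) * (y + 1)).
  rewrite /decay mulNr opprK ler_expR ler_wpM2l//.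
    by rewrite !mulr_ge0 ?(ltW p0)// addr_ge0// ltW.
  by rewrite lerD2l invf_le1.
have m1 : minus_abs k kappa cm j y n <= K * M1 * wt (D / 4) y.
  apply: le_trans (minus_abs_le k cm ltr01 y1 fn0) _.
  have -> : K * M1 * wt (D / 4) y = K * wt (D / 4) y * M1 by ring.
  rewrite -/M1 ler_wpM2r// divr1.
  have e1 : expR (2 * pi * fq n * (y - 1)) <= 1.
    have pf : 2 * pi * fq n <= 0 by rewrite pmulr_rle0 ?(ltW fn0)// mulr_gt0.
    by rewrite expR_le1 mulr_le0_ge0// subr_ge0.
  rewrite -[leRHS]mulr1 ler_pM ?powR_ge0 ?expR_ge0//.
  apply: le_trans (powR_le_exp_ln _ y0) _; apply: le_trans (HK y y0) _.
  rewrite ler_wpM2l ?(ltW K0)// /decay ler_expR lerN2 ler_wpM2r ?addr_ge0 ?invr_ge0 ?(ltW y0)//.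
  by rewrite lerN2 ler_wpM2l ?mulr_ge0 ?(ltW p0)// lerDr.
have pl : plus_abs kappa cp j y n <= (B + K * M1) * expR (2 * pi * (n0%:R + D / 4) * (y + 1)).
  apply: le_trans (le_plus_coef y n) _; rewrite nneg.
  apply: (@le_trans _ _ ((B + K * M1) * wt (D / 4) y)).
    by rewrite mulrDl lerD// HB.
  by rewrite ler_wpM2l// addr_ge0// mulr_ge0// ltW.
have -> : cnorm (cp j n) = plus_abs kappa cp j y n * expR (2 * pi * fq n * y).
  by rewrite /plus_abs -mulrA -expRD addNr expR0 mulr1.
have := ler_wpM2r (expR_ge0 (2 * pi * fq n * y)) pl => /le_trans; apply.
have BK0 : 0 <= B + K * M1 by rewrite addr_ge0// mulr_ge0// ltW.
rewrite -[leLHS]mulrA -[leRHS]mulrA ler_wpM2l// -!expRD ler_expR.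
have -> : fq n = - D - n0%:R by rewrite /D; lra.
by rewrite le_eqVlt; apply/orP; left; apply/eqP; field.
Qed.

(** For n + kappa_j >= 0 the total coefficient is the holomorphic term. For n + kappa_j < 0 the
    holomorphic term is bounded first, by finiteness and [cp_eq0], and the gamma term then by
    difference. *)
Lemma term_growth (d : R) : 0 < d -> exists2 B : R, 0 <= B & forall n (y : R), 0 < y ->
  plus_abs kappa cp j y n <= B * wt d y /\
  (fq n < 0 -> minus_abs k kappa cm j y n <= B * wt d y).
Proof.
move=> d0; have [B B0 HB] := coef_growth d0.
have [[n1 hn1] _] := hc.
have p0 := @pi_gt0 R.
(* [Negz i] is -(i + 1), so the sum covers every n with n1 <= n < 0. *)
pose C0 := \sum_(i < `|n1|%N) cnorm (cp j (Negz i)).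
have C00 : 0 <= C0 by apply: sumr_ge0 => i _; exact: cnorm_ge0.
have neg n y : 0 < y -> fq n < 0 -> plus_abs kappa cp j y n <= C0 * wt d y.
  move=> y0 fn; have [fn0|fn0] := ltP (fq n) (- n0%:R).
    by rewrite /plus_abs cp_eq0// cnorm0 mul0r mulr_ge0// expR_ge0.
  have [nn1|nn1] := ltP n n1.
    by rewrite /plus_abs hn1// cnorm0 mul0r mulr_ge0// expR_ge0.
  rewrite ler_pM ?cnorm_ge0 ?expR_ge0//.
    have nlt0 : n < 0 by rewrite -(@ltrz0 R); apply: le_lt_trans fn; exact: freq_ge.
    case: n nlt0 nn1 {fn fn0} => // i _ nn1.
    have ii : (i < `|n1|)%N by lia.
    rewrite /C0 (bigD1 (Ordinal ii))//= lerDl.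
    by apply: sumr_ge0 => l _; exact: cnorm_ge0.
  apply: le_trans (wt_ge_exp d0 y0); rewrite ler_expR -mulNr ler_wpM2r ?(ltW y0)//.
  by rewrite -mulrN ler_wpM2l ?mulr_ge0 ?(ltW p0)//; lra.
exists (B + C0); first exact: addr_ge0.
move=> n y y0; have W0 : 0 <= wt d y by exact: expR_ge0.
have [fn|fn] := ltP (fq n) 0.
  have h := neg n y y0 fn; split.
    by apply: le_trans h _; rewrite ler_wpM2r// lerDr.
  move=> _; rewrite mulrDl; apply: le_trans (le_minus_coef y _) _; first by rewrite inE.
  by rewrite lerD// HB.
split=> //; apply: le_trans (le_plus_coef y n) _.
rewrite ifF; last by apply/negbTE; rewrite notin_setE /= /neg_freq /=; apply/negP; rewrite -leNgt.
by rewrite addr0; apply: le_trans (HB n y y0) _; rewrite ler_wpM2r// lerDl.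
Qed.

(** Passing to height (1 - q) y enlarges 1/y, and summing over n brings the factors exp(2 pi q y (2
    n0 + 1)) and, from the geometric series, a factor of order 1 + 1/y for small y. With d = 4 d1
    the weight at y has room for all of them. *)
Lemma weight_shift (d d1 q : R) : 0 < d -> d1 = d / 4 -> q = d1 / (2 * n0%:R + 3 + 2 * d1) ->
  exists2 K : R, 0 <= K & forall y : R, 0 < y ->
    wt d1 ((1 - q) * y) * (expR (2 * pi * q * y * (2 * n0%:R + 1)) *
      (expR (2 * pi * q * y / 2) * (1 + 2 / (2 * pi * q * y)))) <= K * wt d y.
Proof.
move=> d0 d1E qE; have p0 := @pi_gt0 R; have nn : 0 <= n0%:R :> R by [].
have d10 : 0 < d1 by rewrite d1E divr_gt0.
(* The relation q N = d1 serves three times: it gives q < 1, it bounds q (2 n0 + 3/2) by d1, and it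
   gives (n0 + d1) / (1 - q) <= n0 + 2 d1. *)
pose N := 2 * n0%:R + 3 + 2 * d1; have N0 : 0 < N by rewrite /N; lra.
have qN : q * N = d1 by rewrite qE divfK// gt_eqF.
have q0 : 0 < q by rewrite qE divr_gt0.
have q1 : q < 1 by rewrite -(ltr_pM2r N0) qN mul1r /N; lra.
pose K := 1 + (pi * q * (2 * pi * d1))^-1.
have K0 : 0 <= K by rewrite addr_ge0// invr_ge0 !mulr_ge0 ?ltW.
exists K => // y y0.
have t0 : 0 < 1 - q by rewrite subr_gt0.
have yV : 0 < y^-1 by rewrite invr_gt0.
have pd0 : 0 < 2 * pi * d1 by rewrite !mulr_gt0.
have e1 : 1 + 2 / (2 * pi * q * y) <= K * expR (2 * pi * d1 * y^-1).
  have h1 : 2 * pi * d1 * y^-1 <= expR (2 * pi * d1 * y^-1).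
    by have := expR_ge1Dx (2 * pi * d1 * y^-1); lra.
  have h2 : 1 <= expR (2 * pi * d1 * y^-1).
    by rewrite -[leLHS]expR0 ler_expR mulr_ge0 ?(ltW pd0) ?(ltW yV).
  rewrite [leRHS](mulrDl 1) mul1r lerD//.
  have -> : 2 / (2 * pi * q * y) = (pi * q * (2 * pi * d1))^-1 * (2 * pi * d1 * y^-1).
    have [p1 q2 d2 y2] : [/\ pi != 0 :> R, q != 0, d1 != 0 & y != 0] by split; rewrite gt_eqF.
    by move: (@pi R) p1 => p p1; field; rewrite y2 d2 p1.
  by rewrite ler_wpM2l// invr_ge0 !mulr_ge0 ?ltW.
apply: (@le_trans _ _ (wt d1 ((1 - q) * y) * (expR (2 * pi * q * y * (2 * n0%:R + 1)) *
      (expR (2 * pi * q * y / 2) * (K * expR (2 * pi * d1 * y^-1)))))).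
  by do 3 (rewrite ler_wpM2l ?expR_ge0//).
have -> a b c e : a * (b * (c * (K * e))) = K * (a * b * c * e) :> R by ring.
rewrite ler_wpM2l// /decay -!expRD ler_expR !mulNr !opprK.
have h1 : (n0%:R + d1) * ((1 - q) * y) + q * y * (2 * n0%:R + 3 / 2) <= (n0%:R + d) * y.
  have -> : (n0%:R + d1) * ((1 - q) * y) + q * y * (2 * n0%:R + 3 / 2) =
    (n0%:R + d1 + q * N - q * (n0%:R + 3 / 2 + 3 * d1)) * y by rewrite /N; field.
  rewrite ler_wpM2r ?(ltW y0)// qN.
  have : 0 <= q * (n0%:R + 3 / 2 + 3 * d1) by rewrite mulr_ge0 ?(ltW q0)//; lra.
  by move: d1E; lra.
have h2 : (n0%:R + d1) * ((1 - q) * y)^-1 + d1 * y^-1 <= (n0%:R + d) * y^-1.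
  have : (n0%:R + d1) / (1 - q) <= n0%:R + 2 * d1.
    rewrite ler_pdivrMr// mulrBr mulr1 lerBrDr.
    have : (n0%:R + 2 * d1) * q <= d1.
      by rewrite -[leRHS]qN mulrC ler_wpM2l ?(ltW q0)// /N; lra.
    lra.
  move=> /(ler_wpM2r (ltW yV)) h3.
  have -> : (n0%:R + d1) * ((1 - q) * y)^-1 = (n0%:R + d1) / (1 - q) * y^-1.
    by field; rewrite !gt_eqF.
  have -> : n0%:R + d = n0%:R + 2 * d1 + d1 + d1 by move: d1E; lra.
  have : 0 <= d1 * y^-1 by rewrite mulr_ge0 ?ltW.
  by rewrite !mulrDl; move: h3; rewrite !mulrDl; lra.
have -> : 2 * pi * (n0%:R + d1) * ((1 - q) * y + ((1 - q) * y)^-1) +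
    2 * pi * q * y * (2 * n0%:R + 1) + 2 * pi * q * y / 2 + 2 * pi * d1 * y^-1 =
    2 * pi * (((n0%:R + d1) * ((1 - q) * y) + q * y * (2 * n0%:R + 3 / 2)) +
     ((n0%:R + d1) * ((1 - q) * y)^-1 + d1 * y^-1)) by field; rewrite !gt_eqF.
rewrite -[leRHS]mulrA ler_wpM2l//; first by rewrite mulr_ge0// ltW.
by rewrite [leRHS]mulrDr lerD.
Qed.

Lemma esum_int_geometric_le (D : set int) (x c : R) (a : int -> R) : 0 < x -> 0 <= c ->
  (forall n, D n -> a n <= c * expR (- (x * `|n|%N%:R))) ->
  (\esum_(n in D) (a n)%:E <= (c * (expR (x / 2) * (1 + 2 / x)))%:E)%E.
Proof.
move=> x0 c0 h.
apply: (@le_trans _ _ (\esum_(n in D) (c * expR (- (x * `|n|%N%:R)))%:E)%E).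
  by apply: le_esum => n Dn; rewrite lee_fin h.
rewrite esumZl_int//.
rewrite EFinM lee_wpmul2l ?lee_fin//; apply: le_trans (esum_int_exp_le x0).
rewrite [leLHS]esum_mkcond; apply: le_esum => n _; case: ifP => // _.
Qed.

(* Comparing the terms at y and (1 - q) y produces a geometric factor in n. *)
Lemma sum_growth (d : R) : 0 < d -> exists2 B : R, 0 <= B & forall y : R, 0 < y ->
  (\esum_(n in [set: int]) (plus_abs kappa cp j y n)%:E <= (B * wt d y)%:E)%E /\
  (\esum_(n in neg_freq kappa j) (minus_abs k kappa cm j y n)%:E <= (B * wt d y)%:E)%E.
Proof.
move=> d0; pose d1 := d / 4; pose q := d1 / (2 * n0%:R + 3 + 2 * d1).
have p0 := @pi_gt0 R; have nn : 0 <= n0%:R :> R by [].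
have d10 : 0 < d1 by rewrite divr_gt0.
pose N := 2 * n0%:R + 3 + 2 * d1; have N0 : 0 < N by rewrite /N; lra.
have q0 : 0 < q by rewrite divr_gt0.
have q1 : q < 1 by rewrite ltr_pdivrMr// mul1r /N; lra.
have [K K0 HK] := @weight_shift d d1 q d0 erefl erefl.
have [B B0 HB] := term_growth d10.
clearbody q.
have t0 : 0 < 1 - q by rewrite subr_gt0.
(* One constant for both kinds of terms: the power is the loss of a gamma term between the two
   heights, and the 1 suffices for a holomorphic term. *)
pose P := 1 + powR (1 - q)^-1 (1 - k).
have P1 : 1 <= P by rewrite lerDl powR_ge0.
have P0 : 0 <= P by lra.
exists (P * B * K); first by rewrite !mulr_ge0.
move=> y y0; set x := 2 * pi * q * y.
have x0 : 0 < x by rewrite /x !mulr_gt0.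
have y'0 : 0 < (1 - q) * y by rewrite mulr_gt0.
have yy' : (1 - q) * y <= y by rewrite ger_pMl// gerBl ltW.
have W0 : 0 <= wt d1 ((1 - q) * y) by exact: expR_ge0.
pose c := P * B * wt d1 ((1 - q) * y) * expR (x * (2 * n0%:R + 1)).
have c0 : 0 <= c by rewrite !mulr_ge0// expR_ge0.
have fin : ((c * (expR (x / 2) * (1 + 2 / x)))%:E <= (P * B * K * wt d y)%:E)%E.
  rewrite lee_fin /c -!mulrA ler_wpM2l// ler_wpM2l//; have := HK y y0.
  by rewrite -/x -!mulrA.
have xE n : 2 * pi * fq n * (y - (1 - q) * y) = x * fq n by rewrite /x; ring.
have gen n e t : t <= B * wt d1 ((1 - q) * y) -> 0 <= t -> 0 <= e -> e <= P * (expR (x * (2 * n0%:R + 1)) * expR (- (x * `|n|%N%:R))) ->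
    e * t <= c * expR (- (x * `|n|%N%:R)).
  move=> h1 h2 h3 h4; apply: le_trans (ler_pM h3 h2 h4 h1) _.
  by rewrite /c le_eqVlt; apply/orP; left; apply/eqP; ring.
split; apply: le_trans fin; apply: esum_int_geometric_le => // n hn.
  have [fn0|fn0] := ltP (fq n) (- n0%:R).
    by rewrite /plus_abs cp_eq0// cnorm0 mul0r mulr_ge0// expR_ge0.
  rewrite (plus_abs_shift _ _ _ ((1 - q) * y)); apply: gen; rewrite ?plus_abs_ge0 ?expR_ge0//.
    by have [] := HB n _ y'0.
  rewrite xE -[leLHS]mul1r ler_pM ?expR_ge0// -expRD ler_expR.
  (* The terms with frequency below -n0 are gone, so the frequency exceeds |n| - 2 n0 - 1 or equals
     it, also for negative n. This is the origin of 2 n0 + 1 in [weight_shift]. *)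
  have h1 : `|n|%N%:R <= fq n + 2 * n0%:R + 1.
    have := freq_ge hkappa j n; have := freq_lt hkappa j n.
    rewrite pmulrn abszE intr_norm; case: (ger0P (n%:~R : R)); lra.
  by have := ler_wpM2l (ltW x0) h1; lra.
apply: le_trans (minus_abs_le k cm y'0 yy' hn) _.
apply: gen; rewrite ?minus_abs_ge0 ?mulr_ge0 ?powR_ge0 ?expR_ge0//.
  by have [_] := HB n _ y'0; exact.
rewrite xE ler_pM ?powR_ge0 ?expR_ge0//.
  have -> : y / ((1 - q) * y) = (1 - q)^-1 by field; rewrite !gt_eqF.
  by rewrite lerDr.
rewrite -expRD ler_expR.
have h1 : `|n|%N%:R <= - fq n + 1.
  have := freq_lt hkappa j n; have : n < 0.
    by rewrite -(@ltrz0 R); apply: le_lt_trans hn; exact: freq_ge.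
  by move=> n00; rewrite pmulrn abszE ltr0_norm// rmorphN /=; lra.
have h2 : 0 <= x * n0%:R by rewrite mulr_ge0// (ltW x0).
by have := ler_wpM2l (ltW x0) h1; lra.
Qed.

End CoefficientGrowth.

(** * L-series as integrals *)

Section SumScaling.
Context {R : realType}.

Lemma csummableZl_nat (c : R[i]) (z : nat -> R[i]) : csummable setT z ->
  csummable setT (fun n => c * z n).
Proof.
move=> sz; have c0 := cnorm_ge0 c.
rewrite /csummable; under eq_esum do rewrite cnormM EFinM.
rewrite -nneseries_esumT; last by move=> n; rewrite mule_ge0// lee_fin cnorm_ge0.
rewrite nneseriesZl; last by move=> n _; rewrite lee_fin cnorm_ge0.
rewrite nneseries_esumT; last by move=> n; rewrite lee_fin cnorm_ge0.
by rewrite -ge0_fin_numE ?fin_numM ?esum_fin_num// ?mule_ge0 ?esum_ge0//;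
  move=> n _; rewrite ?lee_fin cnorm_ge0.
Qed.

(** A complex factor mixes the positive and negative parts of real and imaginary parts, so the two
    sides are compared through their partial sums. *)
Lemma csumZl_nat (c : R[i]) (z : nat -> R[i]) : csummable setT z ->
  csum setT (fun n => c * z n) = c * csum setT z.
Proof.
move=> sz; have scz := csummableZl_nat c sz.
apply/eqP; rewrite -subr_eq0; apply/eqP; apply: cnorm_eq0.
apply/eqP; rewrite eq_le cnorm_ge0 andbT; apply/ler_addgt0Pr => e e0; rewrite add0r.
pose d := e / (1 + cnorm c).
have c1 : 0 < 1 + cnorm c by rewrite ltr_wpDr// cnorm_ge0.
have d0 : 0 < d by rewrite divr_gt0.
have [N1 H1] := csum_tail sz d0; have [N2 H2] := csum_tail scz d0.
have h1 := H1 (maxn N1 N2) (leq_maxl _ _) z (fun n => lexx _).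
have h2 := H2 (maxn N1 N2) (leq_maxr _ _) (fun n => c * z n) (fun n => lexx _).
have -> : csum setT (fun n => c * z n) - c * csum setT z =
  (csum setT (fun n => c * z n) - \sum_(i < maxn N1 N2) c * z i)
  - c * (csum setT z - \sum_(i < maxn N1 N2) z i).
  by rewrite mulrBr mulr_sumr; ring.
apply: le_trans (cnormB _ _) _; rewrite cnormM.
have -> : e = d + cnorm c * d by rewrite /d; field; rewrite gt_eqF.
by rewrite lerD// ler_wpM2l// cnorm_ge0.
Qed.

Lemma csumZl (c : R[i]) (D : set int) (z : int -> R[i]) : csummable D z ->
  csum D (fun n => c * z n) = c * csum D z.
Proof.
move=> /csummable_int_nat sz; rewrite !csum_int_nat -csumZl_nat//.
by apply: eq_csum => n _; rewrite /nat_family; case: ifP; rewrite ?mulr0.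
Qed.

End SumScaling.

Section RealFactor.
Context {R : realType}.
Implicit Types (z : R[i]) (x : R).

Lemma Re_mulCr z x : Re (z * x%:C) = Re z * x.
Proof. by rewrite mulrC Re_mulr mulrC. Qed.

Lemma Im_mulCr z x : Im (z * x%:C) = Im z * x.
Proof. by rewrite mulrC Im_mulr mulrC. Qed.

Lemma Re_cintegral (D : set R) (g : R -> R[i]) :
  Re (cintegral D g) = \int[@lebesgue_measure R]_(x in D) Re (g x).
Proof. by []. Qed.

Lemma Im_cintegral (D : set R) (g : R -> R[i]) :
  Im (cintegral D g) = \int[@lebesgue_measure R]_(x in D) Im (g x).
Proof. by []. Qed.

End RealFactor.

(** * Fubini on the open quadrant *)

Section Fubini.
Context {R : realType}.
Local Notation mu := (@lebesgue_measure R).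
Local Notation posR := (`]0%R, +oo[%classic : set R).

Lemma measurable_ext0 (f : R -> R) : measurable_fun posR f ->
  measurable_fun [set: R] (fun x => if 0 < x then f x else 0).
Proof.
move=> mf; apply: measurable_fun_if => //.
- exact: measurable_fun_ltr.
- suff -> : [set: R] `&` (fun x : R => 0 < x) @^-1` [set true] = posR by [].
  apply/seteqP; split=> x /=; rewrite in_itv /= andbT; first by case.
  by move=> ->.
Qed.

Lemma fubini_pos (h : R * R -> R) : measurable_fun setT h ->
  (\int[mu]_(x in posR) \int[mu]_(y in posR) (`|h (x, y)|)%:E < +oo)%E ->
  (\int[mu]_(x in posR) \int[mu]_(y in posR) (h (x, y))%:E =
   \int[mu]_(y in posR) \int[mu]_(x in posR) (h (x, y))%:E)%E.
Proof.
move=> mh fh; have mP : measurable posR by exact: measurable_posR.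
(* The cut-off is made for g o h, so that the same computation applies to h and to |h|. *)
pose K (g : R -> R) (z : R * R) := (g (h z) * ((\1_posR z.1) * (\1_posR z.2)))%:E.
have mk g : measurable_fun setT g -> measurable_fun setT (K g).
  move=> mg; apply/measurable_EFinP; apply: measurable_funM.
    exact: (measurableT_comp mg mh).
  apply: measurable_funM.
    exact: (measurableT_comp (measurable_indic mP) measurable_fst).
  exact: (measurableT_comp (measurable_indic mP) measurable_snd).
have E1 g : (\int[mu]_x \int[mu]_y K g (x, y) =
    \int[mu]_(x in posR) \int[mu]_(y in posR) (g (h (x, y)))%:E)%E.
  rewrite [RHS]integral_mkcond; apply: eq_integral => x _; rewrite patchE.
  rewrite /K /= indicE; case: ifPn => xP.
    rewrite [RHS]integral_mkcond; apply: eq_integral => y _; rewrite patchE indicE.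
    by case: ifPn; rewrite ?mulr1 ?mulr0.
  by under eq_integral do rewrite mul0r mulr0; rewrite integral0.
have E2 g : (\int[mu]_y \int[mu]_x K g (x, y) =
    \int[mu]_(y in posR) \int[mu]_(x in posR) (g (h (x, y)))%:E)%E.
  rewrite [RHS]integral_mkcond; apply: eq_integral => y _; rewrite patchE.
  have ky x : K g (x, y) = (g (h (x, y)) * ((\1_posR x) * (y \in posR)%:R))%:E.
    by rewrite /K /= [\1_posR y]indicE.
  under eq_integral do rewrite ky.
  case: ifPn => yP.
    rewrite [RHS]integral_mkcond; apply: eq_integral => x _; rewrite patchE indicE.
    by case: ifPn; rewrite ?mulr1 ?mul0r ?mulr0.
  by under eq_integral do rewrite mulr0 mulr0; rewrite integral0.
rewrite -(E1 id) -(E2 id).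
apply: Fubini; apply/(integrable12ltyP mu mu); first exact: mk.
move: fh; rewrite -(E1 (fun x => `|x|)); congr (_ < +oo)%E.
apply: eq_integral => x _; apply: eq_integral => y _.
by rewrite /K abse_EFin normrM (ger0_norm (mulr_ge0 _ _)).
Qed.

End Fubini.

(** * From the integrals over t in L_f to the incomplete gamma function *)

Section GammaTerms.
Context {R : realType}.
Local Notation mu := (@lebesgue_measure R).
Local Notation posR := (`]0%R, +oo[%classic : set R).
Variable k : R.

Lemma measurable_gamma_kernel2 (a : R) :
  measurable_fun [set: R * R] (fun z : R * R => gamma_kernel k (a * z.1) z.2).
Proof.
apply: measurable_funM.
  apply: (measurableT_comp (@measurable_expR R)).
  apply: (measurableT_comp (@oppr_measurable R setT)).
  apply: measurable_funM.
    by apply: measurable_funM => //; apply: measurable_funM => //; exact: measurable_fst.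
  by apply: measurable_funD => //; apply: measurable_funM => //; exact: measurable_snd.
exact: (measurableT_comp (@measurable_powRV R k) measurable_snd).
Qed.

Lemma measurable_gamma_tail (a : R) : measurable_fun [set: R] (fun x => gamma_tail k (a * x)).
Proof.
have mP : measurable posR by exact: measurable_posR.
have -> : (fun x => gamma_tail k (a * x)) =
  fine \o (fun x => \int[mu]_t (gamma_kernel k (a * x) t * \1_posR t)%:E)%E.
  apply/funext => x /=; rewrite /gamma_tail /Rintegral integral_mkcond; congr fine.
  apply: eq_integral => t _; rewrite patchE indicE.
  by case: ifP; rewrite ?mulr1 ?mulr0.
apply: (measurableT_comp (@fine_measurable R setT measurableT)) => //.
apply: (@measurable_fun_fubini_tonelli_F _ _ _ _ _ mu
  (fun z : R * R => (gamma_kernel k (a * z.1) z.2 * \1_posR z.2)%:E)).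
  apply/measurable_EFinP; apply: measurable_funM; first exact: measurable_gamma_kernel2.
  exact: (measurableT_comp (measurable_indic mP) measurable_snd).
by move=> z; rewrite lee_fin mulr_ge0// gamma_kernel_ge0.
Qed.

Lemma measurable_gamma_part (a : R) : 0 < a -> measurable_fun posR (gamma_part k a).
Proof.
move=> a0; apply: (eq_measurable_fun (fun y => powR (a * y) (1 - k) * gamma_tail k (a * y))).
  by move=> y; rewrite inE posRP => y0; rewrite gamma_partE.
apply: measurable_funTS; apply: measurable_funM; last exact: measurable_gamma_tail.
by apply: (measurableT_comp (@measurable_powR R (1 - k))); exact: measurable_funM.
Qed.

Lemma powR_gamma_tail (a x : R) : 0 < a -> 0 < x ->
  powR a (1 - k) * powR x (1 - k) * gamma_tail k (a * x) = gamma_part k a x.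
Proof. by move=> a0 x0; rewrite gamma_partE// powRM// ltW. Qed.

Variables (phi : R -> R[i]) (a : R).
Hypotheses (mphi : cmeasurable posR phi) (a0 : 0 < a).

Lemma twist_powR (x : R) : 0 < x -> twist phi (2 - k%:C) x = phi x * (powR x (1 - k))%:C.
Proof.
move=> x0; rewrite /twist; congr (_ * _).
rewrite -cpow_real_real//; congr cpow.
by rewrite rmorphB /=; ring.
Qed.

Lemma laplace_abs_gamma (t : R) : 0 < t ->
  (laplace_abs (twist phi (2 - k%:C)%R) (a / 2 * (2 * t + 1))%R * ((powR (1 + t) k)^-1)%:E =
   \int[mu]_(x in posR) (cnorm (phi x) * powR x (1 - k) * gamma_kernel k (a * x) t)%:E)%E.
Proof.
move=> t0; rewrite /laplace_abs -ge0_integralZr//; last 3 first.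
- apply/measurable_EFinP; apply: measurable_funM.
    apply: cmeasurable_cnorm; apply: cmeasurableM => //; exact: cmeasurable_cpow.
  apply: measurable_funTS; apply: (measurableT_comp (@measurable_expR R)).
  exact: measurable_funM.
- by move=> x _; rewrite lee_fin mulr_ge0 ?cnorm_ge0 ?expR_ge0.
- by rewrite lee_fin invr_ge0 powR_ge0.
apply: eq_integral => x; rewrite inE posRP => x0.
rewrite twist_powR// cnormM cnorm_real ger0_norm ?powR_ge0// -EFinM; congr EFin.
by rewrite /gamma_kernel -!mulrA; congr (_ * (_ * (expR _ * _))); field.
Qed.

(** Tonelli in the extended reals presupposes no finiteness, so the identity can be used to verify
    the last condition of [test_space]. *)
Lemma laplace_abs_gamma_integral :
  ((powR a (1 - k))%:E * \int[mu]_(t in posR)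
     (laplace_abs (twist phi (2 - k%:C)%R) (a / 2 * (2 * t + 1))%R * ((powR (1 + t) k)^-1)%:E) =
   \int[mu]_(x in posR) (cnorm (phi x) * gamma_part k a x)%:E)%E.
Proof.
(* Extension by 0: phi is known to be measurable on ]0, +oo[ only, while the integrand in two
   variables has to be measurable on the plane. *)
pose A (x : R) := if 0 < x then cnorm (phi x) else 0.
have mA : measurable_fun [set: R] A by apply: measurable_ext0; exact: cmeasurable_cnorm.
pose h (z : R * R) := (A z.1 * powR z.1 (1 - k) * gamma_kernel k (a * z.1) z.2)%:E.
have A0 (x : R) : 0 <= A x by rewrite /A; case: ifP => // _; exact: cnorm_ge0.
have mpow : measurable_fun [set: R] (fun x : R => powR x (1 - k)) by exact: measurable_powR.
have mh : measurable_fun setT h.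
  apply/measurable_EFinP; apply: measurable_funM; last exact: measurable_gamma_kernel2.
  apply: measurable_funM; first exact: (measurableT_comp mA measurable_fst).
  exact: (measurableT_comp mpow measurable_fst).
have h0 z : (0 <= h z)%E by rewrite lee_fin mulr_ge0 ?gamma_kernel_ge0// mulr_ge0 ?powR_ge0.
transitivity ((powR a (1 - k))%:E *
    \int[mu]_(t in posR) \int[mu]_(x in posR) h (x, t))%E.
  congr (_ * _)%E; apply: eq_integral => t; rewrite inE posRP => t0.
  rewrite laplace_abs_gamma//; apply: eq_integral => x; rewrite inE posRP => x0.
  by rewrite /h /A /= x0.
rewrite -ge0_tonelli_pos//.
transitivity ((powR a (1 - k))%:E *
    \int[mu]_(x in posR) (A x * powR x (1 - k) * gamma_tail k (a * x))%:E)%E.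
  congr (_ * _)%E; apply: eq_integral => x; rewrite inE posRP => x0.
  have ax : 0 < a * x by rewrite mulr_gt0.
  rewrite EFinM EFin_gamma_tail// ge0_integralZ_posR//.
  - by rewrite mulr_ge0 ?powR_ge0.
  - exact: measurable_gamma_kernel.
  - by move=> t _; exact: gamma_kernel_ge0.
rewrite ge0_integralZ_posR ?powR_ge0//.
- apply: eq_integral => x; rewrite inE posRP => x0; congr EFin.
  by rewrite -powR_gamma_tail// /A x0; ring.
- apply: measurable_funM; last exact: measurable_gamma_tail.
  exact: measurable_funM.
- by move=> t t0; rewrite !mulr_ge0 ?powR_ge0 ?gamma_tail_ge0.
Qed.

Hypothesis fin : (\int[mu]_(x in posR) (cnorm (phi x) * gamma_part k a x)%:E < +oo)%E.
Hypothesis lapl : forall t, 0 < t ->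
  cintegrable posR (laplace_term (twist phi (2 - k%:C)) (a / 2 * (2 * t + 1))%:C).

(** Here r stands for [Re] or [Im]. Integrating the absolute value over t first gives a multiple of
    |r (phi x)| times [gamma_part], which [fin] dominates, so Fubini applies. *)
Lemma laplace_gamma_real (r : R[i] -> R) :
  (forall (z : R[i]) (y : R), r (z * y%:C) = r z * y) -> (forall z, `|r z| <= cnorm z) ->
  measurable_fun posR (fun x => r (phi x)) ->
  (forall t, 0 < t -> mu.-integrable posR
    (fun x => (r (laplace_term (twist phi (2 - k%:C)) (a / 2 * (2 * t + 1))%:C x))%:E)) ->
  \int[mu]_(t in posR) ((\int[mu]_(x in posR)
     r (laplace_term (twist phi (2 - k%:C)) (a / 2 * (2 * t + 1))%:C x)) * (powR (1 + t) k)^-1)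
  * powR a (1 - k)
  = \int[mu]_(x in posR) (r (phi x) * gamma_part k a x).
Proof.
move=> rM rle mr ri.
pose A (x : R) := if 0 < x then r (phi x) else 0.
have mA : measurable_fun [set: R] A by exact: measurable_ext0.
pose h (z : R * R) := A z.1 * powR z.1 (1 - k) * gamma_kernel k (a * z.1) z.2.
have mpow : measurable_fun [set: R] (fun x : R => powR x (1 - k)) by exact: measurable_powR.
have mh : measurable_fun setT h.
  apply: measurable_funM; last exact: measurable_gamma_kernel2.
  apply: measurable_funM; first exact: (measurableT_comp mA measurable_fst).
  exact: (measurableT_comp mpow measurable_fst).
have pa : 0 < powR a (1 - k) by exact: powR_gt0.
pose G x := cnorm (phi x) * gamma_part k a x.
have G0 x : 0 <= G x by rewrite mulr_ge0 ?cnorm_ge0 ?gamma_part_ge0.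
have mG : measurable_fun posR G.
  by apply: measurable_funM; [exact: cmeasurable_cnorm|exact: measurable_gamma_part].
have iG : mu.-integrable posR (EFin \o (fun x => (powR a (1 - k))^-1 * G x)).
  apply: integrableZ_EFin; first exact: measurable_posR.
  apply/integrableP; split; first exact/measurable_EFinP.
  by under eq_integral do rewrite /= ger0_norm//.
pose F (x : R) := A x * powR x (1 - k) * gamma_tail k (a * x).
have mF : measurable_fun [set: R] F.
  by apply: measurable_funM; [exact: measurable_funM|exact: measurable_gamma_tail].
have FG x : 0 < x -> `|F x| <= (powR a (1 - k))^-1 * G x.
  move=> x0; rewrite /G -powR_gamma_tail// /F /A x0 !normrM.
  rewrite (ger0_norm (powR_ge0 _ _)) (ger0_norm (gamma_tail_ge0 _ _)).
  have -> : (powR a (1 - k))^-1 * (cnorm (phi x) * (powR a (1 - k) * powR x (1 - k) *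
     gamma_tail k (a * x))) = cnorm (phi x) * powR x (1 - k) * gamma_tail k (a * x).
    by field; rewrite gt_eqF.
  by rewrite ler_wpM2r ?gamma_tail_ge0// ler_wpM2r ?powR_ge0.
have iF : mu.-integrable posR (EFin \o F).
  apply: le_integrable iG.
  - exact: measurable_posR.
  - by apply/measurable_EFinP; exact: measurable_funTS.
  - by move=> x; rewrite posRP => x0 /=; rewrite lee_fin (le_trans (FG x x0))// ler_norm.
have inner x (c : R) : 0 < x ->
    (\int[mu]_(t in posR) (c * gamma_kernel k (a * x) t)%:E = (c * gamma_tail k (a * x))%:E)%E.
  move=> x0; have ax : 0 < a * x by rewrite mulr_gt0.
  rewrite EFinM EFin_gamma_tail// -integralZl//; last exact: integrable_gamma_kernel.
have fubini : (\int[mu]_(x in posR) \int[mu]_(y in posR) (h (x, y))%:E =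
    \int[mu]_(y in posR) \int[mu]_(x in posR) (h (x, y))%:E)%E.
  apply: fubini_pos => //; have /integrableP[_] := iF; congr (_ < _)%E.
  apply: eq_integral => x; rewrite inE posRP => x0.
  rewrite /= /F normrM (ger0_norm (gamma_tail_ge0 _ _)) -inner//.
  by apply: eq_integral => t _; rewrite /h /= [in RHS]normrM (ger0_norm (gamma_kernel_ge0 _ _ _)).
have L : (\int[mu]_(x in posR) \int[mu]_(y in posR) (h (x, y))%:E)%E =
    (\int[mu]_(x in posR) (F x)%:E)%E.
  by apply: eq_integral => x; rewrite inE posRP => x0; rewrite /F -inner.
have Rt t : 0 < t -> (\int[mu]_(x in posR) (h (x, t))%:E)%E =
   ((\int[mu]_(x in posR) r (laplace_term (twist phi (2 - k%:C)) (a / 2 * (2 * t + 1))%:C x))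
     * (powR (1 + t) k)^-1)%:E.
  move=> t0; have it := ri t t0.
  have hE x : 0 < x -> h (x, t) = (powR (1 + t) k)^-1 *
      r (laplace_term (twist phi (2 - k%:C)) (a / 2 * (2 * t + 1))%:C x).
    move=> x0; rewrite /laplace_term (twist_powR x0).
    have -> : cexp (- (a / 2 * (2 * t + 1))%:C * x%:C) = (expR (- (a * x / 2 * (2 * t + 1))))%:C.
      rewrite -rmorphN.
      rewrite -rmorphM.
      rewrite cexp_real.
      congr (expR _)%:C.
      by field.
    rewrite rM.
    rewrite rM.
    rewrite -[LHS]/(A x * powR x (1 - k) * gamma_kernel k (a * x) t).
    have -> : A x = r (phi x) by rewrite /A x0.
    by rewrite /gamma_kernel; ring.
  rewrite [X in X%:E]mulrC EFinM /Rintegral fineK; last exact: integrable_fin_num it.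
  rewrite -integralZl; [|exact: measurable_posR|exact: it].
  by apply: eq_integral => x; rewrite inE posRP => x0; rewrite hE.
transitivity (powR a (1 - k) * \int[mu]_(x in posR) F x).
  rewrite mulrC; congr (_ * _); rewrite /Rintegral -L fubini; congr fine; apply: eq_integral => t.
  by rewrite inE posRP => t0; rewrite Rt.
rewrite -RintegralZl; [|exact: measurable_posR|exact: iF].
apply: eq_Rintegral => x; rewrite inE posRP => x0.
rewrite -(powR_gamma_tail a0 x0) /F.
have -> : A x = r (phi x) by rewrite /A x0.
by ring.
Qed.

Lemma laplace_gamma_integral :
  (powR a (1 - k))%:C * cintegral posR (fun t =>
     laplace (twist phi (2 - k%:C)) (a / 2 * (2 * t + 1))%:C / (powR (1 + t) k)%:C)
  = cintegral posR (fun x => phi x * (gamma_part k a x)%:C).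
Proof.
have [m1 m2] := mphi.
have E t : (powR (1 + t) k)%:C^-1 = ((powR (1 + t) k)^-1)%:C :> R[i] by rewrite fmorphV.
apply: eq_ReIm.
  rewrite Re_mulr mulrC !Re_cintegral.
  transitivity (\int[mu]_(x in posR) (Re (phi x) * gamma_part k a x)); last first.
    by apply: eq_Rintegral => x _; rewrite Re_mulCr.
  rewrite -(@laplace_gamma_real (@complex.Re R)); last 4 first.
  - by move=> z y; exact: Re_mulCr.
  - exact: Re_le_cnorm.
  - exact: m1.
  - by move=> t /lapl[].
  by congr (_ * _); apply: eq_Rintegral => t _; rewrite E Re_mulCr Re_cintegral.
rewrite Im_mulr mulrC !Im_cintegral.
transitivity (\int[mu]_(x in posR) (Im (phi x) * gamma_part k a x)); last first.
  by apply: eq_Rintegral => x _; rewrite Im_mulCr.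
rewrite -(@laplace_gamma_real (@complex.Im R)); last 4 first.
- by move=> z y; exact: Im_mulCr.
- exact: Im_le_cnorm.
- exact: m2.
- by move=> t /lapl[].
by congr (_ * _); apply: eq_Rintegral => t _; rewrite E Im_mulCr Im_cintegral.
Qed.


End GammaTerms.

(** * Sums over the integers under the integral, and the substitution x -> 1/x *)

Section ExchangeInt.
Context {R : realType}.
Local Notation mu := (@lebesgue_measure R).
Local Notation posR := (`]0%R, +oo[%classic : set R).

Lemma esum_integral_lty (D : set int) (g : int -> R -> R) (H : R -> R) :
  (forall n, D n -> measurable_fun posR (g n)) -> (forall n x, 0 <= g n x) ->
  (forall x : R, 0 < x -> (\esum_(n in D) (g n x)%:E <= (H x)%:E)%E) ->
  mu.-integrable posR (EFin \o H) ->
  (\esum_(n in D) \int[mu]_(x in posR) (g n x)%:E < +oo)%E.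
Proof.
move=> mg g0 gH iH; have mP := @measurable_posR R.
pose G i x : \bar R := if int_of_nat i \in D then (g (int_of_nat i) x)%:E else 0%E.
have G0 i x : (0 <= G i x)%E by rewrite /G; case: ifP => // _; rewrite lee_fin.
have mG i : measurable_fun posR (G i).
  rewrite /G; case: (boolP (int_of_nat i \in D)) => [/set_mem Di|_]; last exact: measurable_cst.
  by apply/measurable_EFinP; exact: mg.
have GE x : (\esum_(n in D) (g n x)%:E = \big[+%E/0%E]_(0 <= i <oo) G i x)%E.
  by rewrite esum_int_nat nneseries_esumT.
have -> : (\esum_(n in D) \int[mu]_(x in posR) (g n x)%:E =
    \int[mu]_(x in posR) \big[+%E/0%E]_(0 <= i <oo) G i x)%E.
  rewrite integral_nneseries//.
  rewrite esum_int_nat nneseries_esumT; last by move=> i; apply: integral_ge0.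
  by apply: eq_esum => i _; rewrite /G; case: ifP => // _; rewrite integral0.
have /integrableP[mH] := iH; apply: le_lt_trans; apply: ge0_le_integral => //.
- by move=> x _; apply: nneseries_ge0.
- by apply: (ge0_emeasurable_sum (h := G)) => [i x _ _|i _]; [exact: G0|exact: mG].
- exact: measurableT_comp.
- by move=> x; rewrite posRP => x0; rewrite -GE (le_trans (gH x x0))// lee_fin ler_norm.
Qed.

Lemma cintegral0 (D : set R) : cintegral D (fun=> 0 : R[i]) = 0.
Proof. by rewrite /cintegral /=; congr (_ +i* _); rewrite /Rintegral integral0. Qed.

Lemma csum_cintegral_int (D : set int) (phi : R -> R[i]) (T : R -> int -> R[i]) :
  (forall n, D n -> cmeasurable posR (fun x => phi x * T x n)) ->
  (forall x : R, 0 < x -> csummable D (T x)) ->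
  (\esum_(n in D) \int[mu]_(x in posR) (cnorm (phi x * T x n))%:E < +oo)%E ->
  cintegrable posR (fun x => phi x * csum D (T x)) /\
  cintegral posR (fun x => phi x * csum D (T x)) =
    csum D (fun n => cintegral posR (fun x => phi x * T x n)).
Proof.
move=> mT sT fT; pose g i x := nat_family D (fun n => phi x * T x n) i.
have gE (x : R) : 0 < x -> csum setT (g ^~ x) = phi x * csum D (T x).
  by move=> x0; rewrite -csumZl; [rewrite [RHS]csum_int_nat|exact: sT].
have [||||h1 h2] := @csum_cintegral R posR _ g.
- exact: measurable_posR.
- move=> i; rewrite /g /nat_family; case: (boolP (int_of_nat i \in D)) => [/set_mem Di|_]; first exact: mT.
  exact: cmeasurable_cst.
- move=> x; rewrite posRP => x0; apply: csummableW (_ : csummable setT (fun i => phi x * nat_family D (T x) i)).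
    by move=> i _; rewrite /g /nat_family; case: ifP => // _; rewrite mulr0.
  by apply: csummableZl_nat; apply/csummable_int_nat; exact: sT.
- move: fT; rewrite esum_int_nat; congr (_ < _)%E; apply: eq_esum => i _.
  rewrite /g /nat_family; case: ifP => // _.
  by under eq_integral do rewrite cnorm0; rewrite integral0.
split.
  by apply: eq_cintegrable h1 => [|x]; [exact: measurable_posR|rewrite posRP; exact: gE].
rewrite -(@eq_cintegral _ posR (fun x => csum setT (g ^~ x))); last first.
  by move=> x; rewrite posRP; exact: gE.
rewrite h2 [RHS]csum_int_nat; apply: eq_csum => i _.
by rewrite /g /nat_family; case: ifP => // _; rewrite cintegral0.
Qed.

Lemma cintegrable_cmeasurable (g : R -> R[i]) : cintegrable posR g -> cmeasurable posR g.
Proof.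
by move=> [/measurable_int /measurable_EFinP g1 /measurable_int /measurable_EFinP g2].
Qed.

Lemma cintegral_sum (I : Type) (s : seq I) (g : I -> R -> R[i]) :
  (forall i, cintegrable posR (g i)) ->
  cintegrable posR (fun x => \sum_(i <- s) g i x) /\
  cintegral posR (fun x => \sum_(i <- s) g i x) = \sum_(i <- s) cintegral posR (g i).
Proof.
move=> gi; elim: s => [|i s [IH1 IH2]].
  have -> : (fun x => \sum_(i <- [::]) g i x) = (fun=> 0) by apply/funext => x; exact: big_nil.
  by rewrite big_nil cintegral0; split=> //; split; exact: integrable0.
rewrite big_cons -IH2; split.
  apply: eq_cintegrable (cintegrableD _ (gi i) IH1); [exact: measurable_posR| |exact: measurable_posR].
  by move=> x _; rewrite big_cons.
rewrite -(cintegralD (@measurable_posR R) (gi i) IH1).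
by apply: eq_cintegral => x _; rewrite big_cons.
Qed.

(** With g(x) = x f(x) the left integrand is g(1/x) dx/x, so the inversion invariance of dx/x
    applies, to the positive and the negative part of f in turn. *)
Lemma Rintegral_inv (f : R -> R) : measurable_fun posR f ->
  \int[mu]_(x in posR) (f x^-1 * (x^-1 * x^-1)) = \int[mu]_(x in posR) f x.
Proof.
move=> mf; pose f0 (x : R) := if 0 < x then f x else 0.
have mf0 : measurable_fun [set: R] f0 by exact: measurable_ext0.
(* Here r is the positive or the negative part; being positively homogeneous it commutes with the
   Jacobian. *)
have key (r : R -> R) : measurable_fun setT r -> (forall x, 0 <= r x) ->
    (forall a b : R, 0 <= b -> r (a * b) = r a * b) ->
    (\int[mu]_(x in posR) (r (f x^-1 * (x^-1 * x^-1)))%:E = \int[mu]_(x in posR) (r (f x))%:E)%E.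
  move=> mr r0 rM.
  (* The maximum is x on ]0, +oo[ and keeps g nonnegative on the whole line. *)
  pose g (x : R) := (r (f0 x) * Num.max x 0)%:E.
  have := @ge0_integral_haar_inv R g.
  have -> : (\int[mu]_(x in posR) (g x^-1%R * (x^-1)%:E) =
      \int[mu]_(x in posR) (r (f x^-1 * (x^-1 * x^-1))%R)%:E)%E.
    apply: eq_integral => x; rewrite inE posRP => x0.
    have xV : 0 < x^-1 by rewrite invr_gt0.
    rewrite /g /f0 xV -EFinM rM ?mulr_ge0 ?(ltW xV)// (max_idPl (ltW xV)).
    by rewrite mulrA.
  have -> : (\int[mu]_(x in posR) (g x * (x^-1)%:E) = \int[mu]_(x in posR) (r (f x))%:E)%E.
    apply: eq_integral => x; rewrite inE posRP => x0.
    by rewrite /g /f0 x0 -EFinM (max_idPl (ltW x0)) mulfK// gt_eqF.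
  apply.
    apply/measurable_EFinP; apply: measurable_funM; first exact: (measurableT_comp mr mf0).
    exact: measurable_maxr.
  by move=> x; rewrite lee_fin mulr_ge0// le_max lexx orbT.
have maxM (a b : R) : 0 <= b -> Num.max (a * b) 0 = Num.max a 0 * b.
  by move=> b0; rewrite maxr_pMl// mul0r.
rewrite /Rintegral; congr fine; rewrite integralE [RHS]integralE.
have pE (h : R -> R) : (fun x => (h x)%:E)^\+%E = (fun x => (Num.max (h x) 0)%:E).
  by apply/funext => x; rewrite funeposE EFin_max.
have nE (h : R -> R) : (fun x => (h x)%:E)^\-%E = (fun x => (Num.max (- h x) 0)%:E).
  by apply/funext => x; rewrite funenegE EFin_max EFinN.
rewrite !pE !nE; congr (_ - _)%E.
  apply: (key (fun x => Num.max x 0)) => [|x|a b b0].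
  - exact: measurable_maxr.
  - by rewrite le_max lexx orbT.
  - exact: maxM.
apply: (key (fun x => Num.max (- x) 0)) => [|x|a b b0].
- by apply: measurable_maxr => //; exact: oppr_measurable.
- by rewrite le_max lexx orbT.
- by rewrite -mulNr maxM.
Qed.

Lemma cintegral_inv (g : R -> R[i]) : cmeasurable posR g ->
  cintegral posR (fun x => g x^-1 * (x^-1 * x^-1)%:C) = cintegral posR g.
Proof.
move=> [m1 m2]; apply: eq_ReIm; rewrite ?Re_cintegral ?Im_cintegral.
  rewrite -(Rintegral_inv m1); apply: eq_Rintegral => x _; exact: Re_mulCr.
rewrite -(Rintegral_inv m2); apply: eq_Rintegral => x _; exact: Im_mulCr.
Qed.

Lemma cmeasurable_cexp (s : R[i]) : cmeasurable posR (fun x : R => cexp (- s * x%:C)).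
Proof.
have mR (a : R) : measurable_fun posR (fun x : R => a * x).
  by apply: measurable_funTS; exact: measurable_funM.
have E x : - s * x%:C = (- Re s * x) +i* (- Im s * x).
  by apply: eq_ReIm; rewrite ?Re_mulCr ?Im_mulCr ?Re_opp ?Im_opp.
have -> : (fun x : R => cexp (- s * x%:C)) = (fun x => cexp ((- Re s * x) +i* (- Im s * x))).
  by apply/funext => x; rewrite E.
split; rewrite /cexp /=.
  apply: measurable_funM; first exact: (measurableT_comp (@measurable_expR R)).
  exact: (measurableT_comp (continuous_measurable_fun (@continuous_cos R))).
apply: measurable_funM; first exact: (measurableT_comp (@measurable_expR R)).
exact: (measurableT_comp (continuous_measurable_fun (@continuous_sin R))).
Qed.

Lemma laplace_cintegrable (b c : R) (phi : R -> R[i]) (s : R[i]) : 0 <= b -> b < c ->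
  cmeasurable posR phi -> rapid c phi -> - b <= Re s ->
  cintegrable posR (laplace_term phi s).
Proof.
move=> b0 bc mphi /rapidP[C C0 HC] hs.
apply: (@cintegrable_dominated _ posR _ _ (fun x => C * decay (c - b) x)).
- exact: measurable_posR.
- by apply: cmeasurableM => //; exact: cmeasurable_cexp.
- move=> x; rewrite posRP => x0; rewrite /laplace_term cnormM cnorm_cexp.
  have -> : Re (- s * x%:C) = - Re s * x by rewrite Re_mulCr Re_opp.
  have -> : decay (c - b) x = decay c x * decay (- b) x by rewrite decayM.
  rewrite mulrA ler_pM ?cnorm_ge0 ?expR_ge0 ?HC// ler_expR.
  have -> : - (- b * (x + x^-1)) = b * (x + x^-1) by rewrite mulNr opprK.
  have h1 : - Re s <= b by lra.
  apply: (@le_trans _ _ (b * x)); first by rewrite ler_wpM2r ?(ltW x0).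
  by rewrite ler_wpM2l// lerDl invr_ge0 ltW.
- by apply: integrableZ_EFin; [exact: measurable_posR|apply: integrable_decay; lra].
Qed.

End ExchangeInt.

(** * L_f as an integral against f on the imaginary axis *)

Section LSeriesIntegral.
Context {R : realType}.
Local Notation mu := (@lebesgue_measure R).
Local Notation posR := (`]0%R, +oo[%classic : set R).
Variables (m : nat) (k : R) (kappa : 'I_m -> R).
Hypothesis hkappa : forall j, 0 <= kappa j < 1.
Variables (f : R[i] -> 'cV[R[i]]_m) (cp cm : 'I_m -> int -> R[i]).
Hypothesis hc : fourier_expansion k kappa f cp cm.
Variable n0 : nat.
Hypothesis hgrow : forall d : R, 0 < d -> exists2 B : R, 0 <= B & forall (j : 'I_m) (u y : R), 0 < y ->
  cnorm (f (u +i* y) j 0) <= B * decay (- (2 * pi * (n0%:R + d))) y.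

(* Unlike the decay condition with a fixed rate, this class is stable under twist. *)
Definition admissible (phi : R -> R[i]) :=
  piecewise_smooth phi /\ exists2 d : R, 0 < d & rapid (2 * pi * (n0%:R + d)) phi.

Lemma admissible_twist phi s : admissible phi -> admissible (twist phi s).
Proof.
move=> [sphi [d d0 rphi]]; split.
  by apply: piecewise_smoothM => // c e c0; exact: smooth_on_cpow.
exists (d / 2); first by rewrite divr_gt0.
apply: rapid_twist rphi; rewrite ltr_pM2l ?mulr_gt0 ?pi_gt0// ltrD2l; lra.
Qed.

Lemma admissible_slashS (chi : 'M[int]_2 -> R[i]) phi :
  admissible phi -> admissible (slashS k chi phi).
Proof.
move=> [sphi [d d0 rphi]].
have -> : slashS k chi phi =
    (fun x => (phi x^-1 * cpow x%:C (k%:C - 1)) * chi Smx).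
  by apply/funext => x; rewrite /slashS mulrAC; congr (_ * _); rewrite mulrC.
split.
  apply: piecewise_smoothM => [c e _|]; first exact: smooth_on_cst.
  apply: piecewise_smoothM => [c e c0|]; first exact: smooth_on_cpow.
  exact: piecewise_smooth_compV.
exists (d / 2); first by rewrite divr_gt0.
have [|C HC] := @rapid_cpow R (2 * pi * (n0%:R + d)) (2 * pi * (n0%:R + d / 2)) (k%:C - 1)
  (fun x => phi x^-1) _ (rapid_compV rphi).
  by rewrite ltr_pM2l ?mulr_gt0 ?pi_gt0// ltrD2l; lra.
exists (cnorm (chi Smx) * C) => x x0.
by rewrite mulrC cnormM -mulrA ler_wpM2l ?cnorm_ge0// HC.
Qed.

Variable phi : R -> R[i].
Hypothesis aphi : admissible phi.

Let mphi : cmeasurable posR phi.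
Proof. by have [/piecewise_smooth_measurable] := aphi. Qed.

Let growj j (d : R) : 0 < d -> exists2 B : R, 0 <= B & forall u y : R, 0 < y ->
  cnorm (f (u +i* y) j 0) <= B * decay (- (2 * pi * (n0%:R + d))) y.
Proof. by move=> /hgrow[B B0 HB]; exists B => // u y; exact: HB. Qed.

Let pn0 : 0 <= 2 * pi * n0%:R :> R.
Proof. by rewrite !mulr_ge0// pi_ge0. Qed.

Lemma admissible_laplace (s : R[i]) : - (2 * pi * n0%:R) <= Re s ->
  cintegrable posR (laplace_term phi s).
Proof.
move=> hs; have [_ [d d0 rphi]] := aphi.
apply: laplace_cintegrable rphi hs => //.
by rewrite ltr_pM2l ?mulr_gt0 ?pi_gt0// ltrDl.
Qed.

Lemma laplace_cexp_freq (j : 'I_m) (n : int) (x : R) :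
  phi x * fourier_plus kappa cp j (0 +i* x) n =
  cp j n * laplace_term phi (2 * pi * freq kappa j n)%:C x.
Proof.
rewrite /fourier_plus qexpE mulr0 circle0 mulr1 /laplace_term -rmorphN -rmorphM cexp_real mulNr.
by rewrite mulrCA.
Qed.

Lemma fourier_minus_ray (j : 'I_m) (n : int) (x : R) :
  phi x * fourier_minus k kappa cm j (0 +i* x) n =
  cm j n * (phi x * (gamma_part k (- (4 * pi * freq kappa j n)) x)%:C).
Proof. by rewrite fourier_minusE mulr0 circle0 mulr1 mulrCA. Qed.

Lemma neg_freq_gt0 (j : 'I_m) n : neg_freq kappa j n -> 0 < - (4 * pi * freq kappa j n).
Proof. by move=> nn; rewrite oppr_gt0 pmulr_rlt0// mulr_gt0// pi_gt0. Qed.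

(** The function phi decays at rate n0 + d while the sums grow at rate n0 + d / 2 at most; the
    remaining d / 2 makes the product integrable. *)
Lemma sum_dominated (j : 'I_m) : exists2 H : R -> R, mu.-integrable posR (EFin \o H) &
  forall x : R, 0 < x ->
  (\esum_(n in [set: int]) (cnorm (phi x) * plus_abs kappa cp j x n)%:E <= (H x)%:E)%E /\
  (\esum_(n in neg_freq kappa j) (cnorm (phi x) * minus_abs k kappa cm j x n)%:E <= (H x)%:E)%E.
Proof.
have [_ [d d0 /rapidP[C C0 HC]]] := aphi.
have d2 : 0 < d / 2 by rewrite divr_gt0.
have [B B0 HB] := sum_growth hkappa hc (@growj j) d2.
exists (fun x => C * B * decay (2 * pi * (d / 2)) x).
  apply: integrableZ_EFin; first exact: measurable_posR.
  by apply: integrable_decay; rewrite !mulr_gt0 ?pi_gt0.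
move=> x x0; have [h1 h2] := HB x x0.
have key : (cnorm (phi x) * (B * decay (- (2 * pi * (n0%:R + d / 2))) x)) <=
    C * B * decay (2 * pi * (d / 2)) x.
  have -> : 2 * pi * (d / 2) = 2 * pi * (n0%:R + d) + - (2 * pi * (n0%:R + d / 2)) :> R.
    by move: (@pi R) => p; field.
  rewrite -decayM [leRHS]mulrACA ler_pM ?cnorm_ge0 ?mulr_ge0 ?decay_ge0//.
  exact: HC.
have c0 := cnorm_ge0 (phi x).
split.
  rewrite esumZl_int//; last by move=> n; exact: plus_abs_ge0.
  apply: (@le_trans _ _ ((cnorm (phi x))%:E * (B * decay (- (2 * pi * (n0%:R + d / 2))) x)%:E)%E).
    by rewrite lee_wpmul2l ?lee_fin.
  by rewrite -EFinM lee_fin.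
rewrite esumZl_int//; last by move=> n; exact: minus_abs_ge0.
apply: (@le_trans _ _ ((cnorm (phi x))%:E * (B * decay (- (2 * pi * (n0%:R + d / 2))) x)%:E)%E).
  by rewrite lee_wpmul2l ?lee_fin.
by rewrite -EFinM lee_fin.
Qed.

Lemma measurable_plus_abs (j : 'I_m) n :
  measurable_fun posR (fun x => cnorm (phi x) * plus_abs kappa cp j x n).
Proof.
apply: measurable_funM; first exact: cmeasurable_cnorm.
apply: measurable_funTS; apply: measurable_funM => //.
apply: (measurableT_comp (@measurable_expR R)).
by apply: (measurableT_comp (@oppr_measurable R setT)); exact: measurable_funM.
Qed.

Lemma measurable_minus_abs (j : 'I_m) n : neg_freq kappa j n ->
  measurable_fun posR (fun x => cnorm (phi x) * minus_abs k kappa cm j x n).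
Proof.
move=> nn; apply: measurable_funM; first exact: cmeasurable_cnorm.
by apply: measurable_funM => //; apply: measurable_gamma_part; exact: neg_freq_gt0.
Qed.

Lemma plus_integral_lty (j : 'I_m) : (\esum_(n in [set: int])
  \int[mu]_(x in posR) (cnorm (phi x) * plus_abs kappa cp j x n)%:E < +oo)%E.
Proof.
have [H iH HH] := sum_dominated j.
apply: (esum_integral_lty (H := H)) => // [n _|n x|x x0].
- exact: measurable_plus_abs.
- by rewrite mulr_ge0 ?cnorm_ge0 ?plus_abs_ge0.
- by have [] := HH x x0.
Qed.

Lemma minus_integral_lty (j : 'I_m) : (\esum_(n in neg_freq kappa j)
  \int[mu]_(x in posR) (cnorm (phi x) * minus_abs k kappa cm j x n)%:E < +oo)%E.
Proof.
have [H iH HH] := sum_dominated j.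
apply: (esum_integral_lty (H := H)) => // [n nn|n x|x x0].
- exact: measurable_minus_abs.
- by rewrite mulr_ge0 ?cnorm_ge0 ?minus_abs_ge0.
- by have [] := HH x x0.
Qed.

Lemma plus_term_abs (j : 'I_m) n :
  ((cnorm (cp j n))%:E * laplace_abs phi (2 * pi * freq kappa j n)%R =
   \int[mu]_(x in posR) (cnorm (phi x) * plus_abs kappa cp j x n)%:E)%E.
Proof.
rewrite /laplace_abs -ge0_integralZl.
- apply: eq_integral => x _; rewrite -EFinM /plus_abs mulNr; congr EFin.
  by rewrite mulrCA.
- exact: measurable_posR.
- apply/measurable_EFinP; apply: measurable_funM; first exact: cmeasurable_cnorm.
  apply: measurable_funTS; apply: (measurableT_comp (@measurable_expR R)).
  exact: measurable_funM.
- by move=> x _; rewrite lee_fin mulr_ge0 ?cnorm_ge0 ?expR_ge0.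
- by rewrite lee_fin cnorm_ge0.
Qed.

Lemma freq_laplace_arg (j : 'I_m) n (t : R) :
  - (2 * pi * freq kappa j n * (2 * t + 1)) =
  - (4 * pi * freq kappa j n) / 2 * (2 * t + 1).
Proof. by move: (@pi R) => p; field. Qed.

Lemma minus_term_abs (j : 'I_m) n : neg_freq kappa j n ->
  ((cnorm (cm j n) * powR (4 * pi * `|freq kappa j n|) (1 - k))%:E
     * \int[mu]_(t in posR)
         (laplace_abs (twist phi (2 - k%:C)%R) (- (2 * pi * freq kappa j n * (2 * t + 1)))%R
          * ((powR (1 + t) k)^-1)%:E) =
   \int[mu]_(x in posR) (cnorm (phi x) * minus_abs k kappa cm j x n)%:E)%E.
Proof.
move=> nn; have a0 := neg_freq_gt0 nn.
have -> : 4 * pi * `|freq kappa j n| = - (4 * pi * freq kappa j n).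
  by rewrite ltr0_norm// mulrN.
under eq_integral do rewrite freq_laplace_arg.
rewrite EFinM -muleA laplace_abs_gamma_integral// -ge0_integralZl//.
- by apply: eq_integral => x _; rewrite -EFinM; congr EFin; rewrite mulrCA.
- apply/measurable_EFinP; apply: measurable_funM; first exact: cmeasurable_cnorm.
  exact: measurable_gamma_part.
- by move=> x _; rewrite lee_fin mulr_ge0 ?cnorm_ge0 ?gamma_part_ge0.
- by rewrite lee_fin cnorm_ge0.
Qed.

Lemma admissible_laplace_twist (s : R[i]) : 0 < Re s ->
  cintegrable posR (laplace_term (twist phi (2 - k%:C)) s).
Proof.
move=> s0; have [st [d d0 rt]] := admissible_twist (2 - k%:C) aphi.
apply: (@laplace_cintegrable _ 0) rt _ => //.
- by rewrite mulr_gt0 ?mulr_gt0 ?pi_gt0// ltr_wpDl.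
- exact: piecewise_smooth_measurable.
- by rewrite oppr0 ltW.
Qed.

Lemma admissible_test_space : test_space k kappa n0 cp cm phi.
Proof.
split.
- by case: aphi.
- exact: admissible_laplace.
- exact: admissible_laplace_twist.
move=> j; rewrite (eq_esum (fun n _ => plus_term_abs j n)) (eq_esum (@minus_term_abs j)).
by rewrite lte_add_pinfty// ?plus_integral_lty ?minus_integral_lty.
Qed.

Lemma cnorm_plus_ray (j : 'I_m) n x :
  cnorm (phi x * fourier_plus kappa cp j (0 +i* x) n) = cnorm (phi x) * plus_abs kappa cp j x n.
Proof. by rewrite cnormM cnorm_fourier_plus. Qed.

Lemma cnorm_minus_ray (j : 'I_m) n x :
  cnorm (phi x * fourier_minus k kappa cm j (0 +i* x) n) =
  cnorm (phi x) * minus_abs k kappa cm j x n.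
Proof. by rewrite cnormM cnorm_fourier_minus. Qed.

Lemma Lf_plus (j : 'I_m) :
  cintegrable posR (fun x => phi x * csum setT (fourier_plus kappa cp j (0 +i* x))) /\
  cintegral posR (fun x => phi x * csum setT (fourier_plus kappa cp j (0 +i* x))) =
  csum setT (fun n => cp j n * laplace phi (2 * pi * freq kappa j n)%:C).
Proof.
(* Below -n0 the decay of phi need not make the Laplace integral converge, but there [cp_eq0] gives
   a zero coefficient. *)
have int n : cp j n != 0 -> cintegrable posR (laplace_term phi (2 * pi * freq kappa j n)%:C).
  move=> cn; apply: admissible_laplace => /=; rewrite -mulrN ler_wpM2l ?mulr_ge0 ?pi_ge0//.
  by rewrite leNgt; apply: contra cn => cn; rewrite (cp_eq0 hc (@growj j) cn).
have [|||h1 h2] := @csum_cintegral_int R setT phi (fun x => fourier_plus kappa cp j (0 +i* x)).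
- move=> n _; apply: (@eq_cmeasurable _ posR (fun x => cp j n * laplace_term phi (2 * pi * freq kappa j n)%:C x)).
    by move=> x _; rewrite laplace_cexp_freq.
  apply: cmeasurableM; first exact: cmeasurable_cst.
  by apply: cmeasurableM => //; exact: cmeasurable_cexp.
- by move=> x x0; have [_ /(_ j (0 +i* x) x0) []] := hc.
- move: (plus_integral_lty j); congr (_ < _)%E; apply: eq_esum => n _.
  by apply: eq_integral => x _; rewrite cnorm_plus_ray.
split=> //; rewrite h2; apply: eq_csum => n _.
rewrite (@eq_cintegral _ posR _ (fun x => cp j n * laplace_term phi (2 * pi * freq kappa j n)%:C x)); last first.
  by move=> x _; rewrite laplace_cexp_freq.
have [->|cn0] := eqVneq (cp j n) 0.
  rewrite mul0r -[RHS](cintegral0 posR); apply: eq_cintegral => x _; exact: mul0r.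
rewrite cintegralZl//; exact: int.
Qed.

Lemma Lf_minus (j : 'I_m) :
  cintegrable posR (fun x => phi x * csum (neg_freq kappa j) (fourier_minus k kappa cm j (0 +i* x))) /\
  cintegral posR (fun x => phi x * csum (neg_freq kappa j) (fourier_minus k kappa cm j (0 +i* x))) =
  csum (neg_freq kappa j) (fun n =>
    cm j n * (powR (- (4 * pi * freq kappa j n)) (1 - k))%:C
    * cintegral `]0, +oo[ (fun t =>
        laplace (twist phi (2 - k%:C)) (- (2 * pi * freq kappa j n * (2 * t + 1)))%:C
        / (powR (1 + t) k)%:C)).
Proof.
have mg n : neg_freq kappa j n ->
    cmeasurable posR (fun x => phi x * (gamma_part k (- (4 * pi * freq kappa j n)) x)%:C).
  move=> nn; apply: cmeasurableM => //; split => /=; last exact: measurable_cst.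
  by apply: measurable_gamma_part; exact: neg_freq_gt0.
have [|||h1 h2] := @csum_cintegral_int R (neg_freq kappa j) phi
    (fun x => fourier_minus k kappa cm j (0 +i* x)).
- move=> n nn; apply: (@eq_cmeasurable _ posR (fun x => cm j n * (phi x * (gamma_part k (- (4 * pi * freq kappa j n)) x)%:C))).
    by move=> x _; rewrite fourier_minus_ray.
  by apply: cmeasurableM; [exact: cmeasurable_cst|exact: mg].
- by move=> x x0; have [_ /(_ j (0 +i* x) x0) []] := hc.
- move: (minus_integral_lty j); congr (_ < _)%E; apply: eq_esum => n _.
  by apply: eq_integral => x _; rewrite cnorm_minus_ray.
split=> //; rewrite h2; apply: eq_csum => n nn.
rewrite (@eq_cintegral _ posR _ (fun x => cm j n * (phi x * (gamma_part k (- (4 * pi * freq kappa j n)) x)%:C))); last first.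
  by move=> x _; rewrite fourier_minus_ray.
have a0 := neg_freq_gt0 nn.
(* The integrability of phi times [gamma_part] is extracted below from a bound that contains the
   factor |cm j n|, so a zero coefficient is treated apart; then both sides vanish. *)
have [->|cn0] := eqVneq (cm j n) 0.
  rewrite mul0r mul0r -[RHS](cintegral0 posR); apply: eq_cintegral => x _; exact: mul0r.
have cpos : 0 < cnorm (cm j n) by exact: cnorm_gt0.
have fin : (\int[mu]_(x in posR) (cnorm (phi x) * gamma_part k (- (4 * pi * freq kappa j n)) x)%:E < +oo)%E.
  have : (\int[mu]_(x in posR) (cnorm (phi x) * minus_abs k kappa cm j x n)%:E < +oo)%E.
    apply: le_lt_trans (minus_integral_lty j).
    pose F l := (\int[mu]_(x in posR) (cnorm (phi x) * minus_abs k kappa cm j x l)%:E)%E.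
    rewrite -[leLHS](@esum_set1 _ _ n F); last by apply: integral_ge0 => x _; rewrite lee_fin mulr_ge0 ?cnorm_ge0 ?minus_abs_ge0.
    rewrite esum_mkcond [leRHS]esum_mkcond; apply: le_esum => l _.
    case: ifPn => [/set_mem ->|_]; first by rewrite mem_set.
    case: ifP => // _; apply: integral_ge0 => x _.
    by rewrite lee_fin mulr_ge0 ?cnorm_ge0 ?minus_abs_ge0.
  have -> : (\int[mu]_(x in posR) (cnorm (phi x) * minus_abs k kappa cm j x n)%:E =
     (cnorm (cm j n))%:E * \int[mu]_(x in posR) (cnorm (phi x) * gamma_part k (- (4 * pi * freq kappa j n)) x)%:E)%E.
    rewrite -ge0_integralZl//.
    - by apply: eq_integral => x _; rewrite -EFinM; congr EFin; rewrite /minus_abs mulrCA.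
    - apply/measurable_EFinP; apply: measurable_funM; first exact: cmeasurable_cnorm.
      exact: measurable_gamma_part.
    - by move=> x _; rewrite lee_fin mulr_ge0 ?cnorm_ge0 ?gamma_part_ge0.
    - by rewrite lee_fin cnorm_ge0.
  rewrite !ltey; apply: contra => /eqP ->.
  by rewrite gt0_muley ?lte_fin.
have lapl (t : R) : 0 < t -> cintegrable posR (laplace_term (twist phi (2 - k%:C))
    (- (4 * pi * freq kappa j n) / 2 * (2 * t + 1))%:C).
  move=> t0; apply: admissible_laplace_twist => /=.
  by rewrite mulr_gt0// ?divr_gt0//; lra.
rewrite cintegralZl.
- rewrite -(laplace_gamma_integral mphi a0 fin lapl) mulrA.
  have -> : (fun t : R => laplace (twist phi (2 - k%:C))
        (- (2 * pi * freq kappa j n * (2 * t + 1)))%:C / (powR (1 + t) k)%:C) =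
      (fun t : R => laplace (twist phi (2 - k%:C))
        (- (4 * pi * freq kappa j n) / 2 * (2 * t + 1))%:C / (powR (1 + t) k)%:C).
    by apply/funext => t; rewrite freq_laplace_arg.
  reflexivity.
- exact: measurable_posR.
apply: (@cintegrable_dominated _ posR _ _ (fun x => cnorm (phi x) * gamma_part k (- (4 * pi * freq kappa j n)) x)).
- exact: measurable_posR.
- exact: mg.
- by move=> x _; rewrite cnormM cnorm_real ger0_norm// gamma_part_ge0.
apply/integrableP; split.
  apply/measurable_EFinP; apply: measurable_funM; first exact: cmeasurable_cnorm.
  exact: measurable_gamma_part.
apply: le_lt_trans fin; rewrite le_eqVlt; apply/orP; left; apply/eqP.
apply: eq_integral => x _; rewrite [LHS]abse_EFin ger0_norm//.
by rewrite mulr_ge0 ?cnorm_ge0 ?gamma_part_ge0.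
Qed.

Lemma Lf_integral (j : 'I_m) :
  cintegrable posR (fun x => phi x * f (0 +i* x) j 0) /\
  Lf k kappa cp cm phi j 0 = cintegral posR (fun x => phi x * f (0 +i* x) j 0).
Proof.
have [p1 p2] := Lf_plus j; have [q1 q2] := Lf_minus j.
have E x : 0 < x -> phi x * csum setT (fourier_plus kappa cp j (0 +i* x)) +
    phi x * csum (neg_freq kappa j) (fourier_minus k kappa cm j (0 +i* x)) =
    phi x * f (0 +i* x) j 0.
  by move=> x0; have [_ /(_ j (0 +i* x) x0) [_ _ ->]] := hc; rewrite mulrDr.
split.
  apply: eq_cintegrable (cintegrableD _ p1 q1); [exact: measurable_posR| |exact: measurable_posR].
  by move=> x; rewrite posRP; exact: E.
rewrite /Lf mxE -p2 -q2 -(cintegralD (@measurable_posR R) p1 q1).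
by apply: eq_cintegral => x; rewrite posRP; exact: E.
Qed.

Lemma ray_rapid (j : 'I_m) : exists2 c : R, 0 < c & rapid c (fun x => phi x * f (0 +i* x) j 0).
Proof.
have [_ [d d0 /rapidP[C C0 HC]]] := aphi.
have d2 : 0 < d / 2 by rewrite divr_gt0.
have [B B0 HB] := hgrow d2.
exists (2 * pi * (d / 2)); first by rewrite !mulr_gt0 ?pi_gt0.
exists (C * B) => x x0.
have -> : 2 * pi * (d / 2) = 2 * pi * (n0%:R + d) + - (2 * pi * (n0%:R + d / 2)) :> R.
  by move: (@pi R) => p; field.
rewrite -decayM cnormM mulrACA ler_pM ?cnorm_ge0//; first exact: HC.
exact: HB.
Qed.

End LSeriesIntegral.

(** * Functional equation *)

Section FunctionalEquation.
Context {R : realType}.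
Local Notation posR := (`]0%R, +oo[%classic : set R).
Variables (m : nat) (k : R) (chi : 'M[int]_2 -> R[i]).
Hypothesis hchi : unitary_multiplier_system k chi.
Variables (rho : 'M[int]_2 -> 'M[R[i]]_m).
Hypothesis hrho : unitary_representation rho.
Variable f : R[i] -> 'cV[R[i]]_m.
Hypothesis hslash : forall g tau, SL2Z g -> 0 < Im tau -> slash k chi rho f g tau = f tau.

Lemma SL2Z_Smx : SL2Z Smx.
Proof. by rewrite /SL2Z det_2x2 !mxE. Qed.

Lemma autj_Smx (x : R) : autj Smx (0 +i* x) = 'i%C * x%:C.
Proof.
by rewrite autjE !mxE /=; apply: eq_ReIm; rewrite ?Re_mul ?Im_mul /=; ring.
Qed.

Lemma mobius_Smx (x : R) : 0 < x -> mobius Smx (0 +i* x) = 0 +i* x^-1.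
Proof.
move=> x0; have ix0 : 'i%C * x%:C != 0 :> R[i].
  by apply/eqP => /(congr1 (@complex.Im R)); rewrite Im_mul /= => /eqP; rewrite mul0r add0r mul1r gt_eqF.
rewrite /mobius -/(autj Smx (0 +i* x)) autj_Smx; apply: (mulIf ix0).
rewrite divfK// !mxE /= mulr0z mul0r add0r.
have -> : (-1)%:~R = (-1 : R)%:C :> R[i] by rewrite !rmorphN1.
have -> : 'i%C * x%:C = 0 +i* x by apply: eq_ReIm; rewrite ?Re_mul ?Im_mul /=; ring.
by apply: eq_ReIm; rewrite ?Re_mul ?Im_mul /= ?mulVf ?gt_eqF//; ring.
Qed.

Lemma modular_ray (x : R) : 0 < x ->
  f (0 +i* x^-1) = (cpow 'i k%:C * cpow x%:C k%:C * chi Smx) *: (rho Smx *m f (0 +i* x)).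
Proof.
move=> x0; have [hchi1 _] := hchi; have [hrho1 _] := hrho.
have chi0 : chi Smx != 0.
  apply/eqP => c0; have := hchi1 _ SL2Z_Smx; rewrite c0 cnorm0 => /eqP.
  by rewrite eq_sym oner_eq0.
have uS : rho Smx \in unitmx by apply: unitarymx_unit; exact: hrho1 SL2Z_Smx.
rewrite -[in RHS](hslash SL2Z_Smx (_ : 0 < Im (0 +i* x)))// /slash autj_Smx mobius_Smx//.
rewrite -scalemxAr mulmxA mulmxV// mul1mx scalerA cpow_imag//.
set i1 := cpow 'i k%:C; rewrite cpowN (cpowN x%:C).
have i0 : i1 != 0 by exact: cpow_neq0.
have c0 : cpow x%:C k%:C != 0 by exact: cpow_neq0.
rewrite -/i1.
have -> : i1 * cpow x%:C k%:C * chi Smx * (i1^-1 * (cpow x%:C k%:C)^-1 * (chi Smx)^-1) = 1.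
  by field; rewrite i0 c0 chi0.
by rewrite scale1r.
Qed.

(** The exponents match: x^(1-s) from the twist at 1/x, x^k from the modularity of f and x^-2 from
    the Jacobian give x^(k-1) x^(-s), where the first power belongs to [slashS] and the second to
    the twist at 1 - s. *)
Lemma ray_integrand_inv (phi : R -> R[i]) (s : R[i]) (j : 'I_m) (x : R) : 0 < x ->
  twist phi s x^-1 * f (0 +i* x^-1) j 0 * (x^-1 * x^-1)%:C =
  cpow 'i k%:C * \sum_l rho Smx j l * (twist (slashS k chi phi) (1 - s) x * f (0 +i* x) l 0).
Proof.
move=> x0; rewrite modular_ray// !mxE /twist /slashS.
rewrite !mulr_sumr mulr_suml; apply: eq_bigr => l _.
have xV : (x^-1 * x^-1)%:C = cpow x%:C (- 1) * cpow x%:C (- 1).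
  have <- : (x^-1)%:C = cpow x%:C (- 1).
    by rewrite -(rmorphN1 (real_complex R)) cpow_real_real// powR_inv1// ltW.
  exact: rmorphM.
rewrite xV cpow_realV// opprB.
have -> : cpow x%:C (1 - s) = cpow x%:C 1 * cpow x%:C (- s) by rewrite cpow_realD.
have -> : cpow x%:C (1 - s - 1) = cpow x%:C (- s) by congr cpow; ring.
have -> : cpow x%:C (k%:C - 1) = cpow x%:C k%:C * cpow x%:C (- 1) by rewrite cpow_realD.
have -> : cpow x%:C 1 = (cpow x%:C (- 1))^-1 by rewrite cpowN invrK.
have c0 : cpow x%:C (- 1) != 0 by exact: cpow_neq0.
by field.
Qed.

End FunctionalEquation.

Lemma scale_mulmx_entry (A : comNzRingType) (m : nat) (a : A) (M : 'M[A]_m) (V : 'cV[A]_m)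
    (j : 'I_m) :
  (a *: (M *m V)) j 0 = a * \sum_l M j l * V l 0.
Proof. by rewrite !mxE. Qed.

Theorem theorem3p3 (R : realType) (m : nat) (k : R)
    (hk : exists h : int, k = h%:~R / 2)
    (chi : 'M[int]_2 -> R[i]) (hchi : unitary_multiplier_system k chi)
    (rho : 'M[int]_2 -> 'M[R[i]]_m) (hrho : unitary_representation rho)
    (kappa : 'I_m -> R) (hkappa : forall j, 0 <= kappa j < 1)
    (f : R[i] -> 'cV[R[i]]_m) (hf : harmonic_maass_form k kappa chi rho f)
    (cp cm : 'I_m -> int -> R[i]) (hc : fourier_expansion k kappa f cp cm)
    (n0 : nat)
    (hn0 : forall j, exists M : R, \forall v \near +oo, forall u : R,
       cnorm (f (u +i* v) j 0) <= M * expR (2 * pi * n0%:R * v))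
    (phi : R -> R[i]) (hphi : piecewise_smooth phi)
    (hphi0 : exists x : R, 0 < x /\ phi x != 0)
    (eps : R) (heps : 0 < eps)
    (hdecay : little_o_pinfty phi
       (fun x : R => expR (- (2 * pi * (n0%:R + eps) * x))))
    (hdecayV : little_o_pinfty (fun x : R => phi x^-1)
       (fun x : R => expR (- (2 * pi * (n0%:R + eps) * x)))) :
  let phiS := slashS k chi phi in
  [/\ forall s : R[i], 1 / 2 < complex.Re s ->
        Lseries_converges k kappa n0 cp cm phi s,
      forall s : R[i], 1 / 2 < complex.Re s ->
        Lseries_converges k kappa n0 cp cm phiS s &
      exists Lam LamS : R[i] -> 'cV[R[i]]_m,
        [/\ Lseries_continuation k kappa cp cm phi Lam,
            Lseries_continuation k kappa cp cm phiS LamS &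
            forall s : R[i],
              Lam s = cpow 'i k%:C *: (rho Smx *m LamS (1 - s))]].
Proof.
move=> phiS; have [_ hslash _ _] := hf.
have hgrow := modular_growth hchi hrho hkappa hslash hc hn0.
have aphi : admissible n0 phi.
  split=> //; exists eps => //; apply: rapid_of_decay => //.
  by rewrite !mulr_ge0 ?pi_ge0// addr_ge0// ltW.
have aphiS : admissible n0 phiS by exact: admissible_slashS.
have conv psi s : admissible n0 psi -> Lseries_converges k kappa n0 cp cm psi s.
  by move=> apsi; apply: (admissible_test_space hkappa hc hgrow); exact: admissible_twist.
pose posR : set R := `]0, +oo[%classic.
have LE psi s j : admissible n0 psi ->
    cintegrable posR (fun x => twist psi s x * f (0 +i* x) j 0) /\
    Lseries k kappa cp cm psi s j 0 = cintegral posR (fun x => twist psi s x * f (0 +i* x) j 0).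
  by move=> apsi; exact: (Lf_integral hkappa hc hgrow (admissible_twist s apsi) j).
have cont psi : admissible n0 psi ->
    Lseries_continuation k kappa cp cm psi (Lseries k kappa cp cm psi).
  move=> apsi; split=> // j.
  (* Integrability on the ray is taken here for the measurability of psi(x) f(ix), which
     [mellin_entire] asks for. *)
  have [mH _] := Lf_integral hkappa hc hgrow apsi j.
  have [c c0 rH] := ray_rapid hgrow apsi j.
  have -> : (fun s => Lseries k kappa cp cm psi s j 0) =
      (fun s => cintegral posR (twist (fun x => psi x * f (0 +i* x) j 0) s)).
    apply/funext => s; have [_ ->] := LE psi s j apsi.
    by apply: eq_cintegral => x _; rewrite /twist mulrAC.
  by apply: mellin_entire rH => //; exact: cintegrable_cmeasurable.
split=> [s _|s _|]; [exact: conv|exact: conv|].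
(* Convergence holds at every s, so each series is its own continuation. *)
exists (Lseries k kappa cp cm phi), (Lseries k kappa cp cm phiS).
split=> [||s]; [exact: cont|exact: cont|].
have EL j := LE phi s j aphi; have ES l := LE phiS (1 - s) l aphiS.
move: (Lseries k kappa cp cm phi s) (Lseries k kappa cp cm phiS (1 - s)) EL ES => V W EL ES.
apply/matrixP => j l; rewrite ord1 {l} scale_mulmx_entry.
have [iL ->] := EL j.
(* The substitution x -> 1/x, after which the integrands agree pointwise by [ray_integrand_inv]. *)
rewrite -(cintegral_inv (cintegrable_cmeasurable iL)).
pose g l x := rho Smx j l * (twist phiS (1 - s) x * f (0 +i* x) l 0).
have mP : measurable posR by exact: measurable_posR.
have ig l : cintegrable posR (g l) by have [il _] := ES l; exact: cintegrableZl.
have [isum Esum] := cintegral_sum (index_enum 'I_m) ig.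
transitivity (cintegral posR (fun x => cpow 'i k%:C * \sum_l g l x)).
  apply: eq_cintegral => x; rewrite posRP => x0.
  exact: (ray_integrand_inv hchi hrho hslash).
rewrite (cintegralZl mP _ isum) Esum; congr (_ * _); apply: eq_bigr => l _.
by have [il ->] := ES l; exact: cintegralZl.
Qed.
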